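(* Let $k\ge 1$ be an integer. For $p\in\{1,2,3,4,5\}$ let $a_p$ and $\beta^{(p)}_n$ ($n\ge 0$) be $$a_1=q,\ \beta^{(1)}_n=\frac{1}{(q;q)_{2n}};\quad a_2=q^2,\ \beta^{(2)}_n=\frac{1}{(q^2;q)_{2n}};\quad a_3=q,\ \beta^{(3)}_n=\frac{q^{n^2-n}}{(q;q)_{2n}};$$ $$a_4=q^2,\ \beta^{(4)}_n=\frac{q^{n^2}}{(q^2;q)_{2n}};\quad a_5=q,\ \beta^{(5)}_n=\frac{(-1;q^3)_n}{(q;q)_{2n}(-1;q)_n}.$$ For integers $i\ge 0$ define three kinds of multisums. (I) For $p\in\{1,2,3,4,5\}$, with $a=a_p$: if $0\le i\le k$, $$S^{(p)}_{k,i}=\sum_{j_1\ge\cdots\ge j_k\ge 0}\frac{a^{j_1+\cdots+j_k}\,q^{j_1^2+\cdots+j_k^2-(j_1+\cdots+j_i)}}{(q)_{j_1-j_2}(q)_{j_2-j_3}\cdots(q)_{j_{k-1}-j_k}}\,\beta^{(p)}_{j_k};$$ if $i>k$, $$S^{(p)}_{k,i}=\sum_{j_1\ge\cdots\ge j_{2i-k}\ge 0}(-1)^{j_i+j_{2i-k}}\,\frac{a^{(j_1+\cdots+j_{i-1})-(j_{i+1}+\cdots+j_{2i-k-1})}\;q^{E}}{(q)_{j_1-j_2}(q)_{j_2-j_3}\cdots(q)_{j_{2i-k-1}-j_{2i-k}}}\,\beta^{(p)}_{j_{2i-k}},$$ $$E=\sum_{r=1}^{i-1}j_r^2-\sum_{r=i+1}^{2i-k-1}j_r^2-\sum_{r=1}^{i}j_r+\sum_{r=i}^{2i-k-1}\binom{j_r-j_{r+1}}{2}.$$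 (II) For $p\in\{2,4\}$, with $a=a_p=q^2$: if $i=0$, $$T^{(p)}_{k,0}=\frac{1}{(-q^2;q)_\infty}\sum_{j_1\ge\cdots\ge j_k\ge 0}\frac{(-q)_{j_1}\,a^{j_1+\cdots+j_k}\,q^{\binom{j_1}{2}+j_2^2+\cdots+j_k^2}}{(q)_{j_1-j_2}\cdots(q)_{j_{k-1}-j_k}}\,\beta^{(p)}_{j_k};$$ if $1\le i\le k$, $$T^{(p)}_{k,i}=\frac{1}{(-q;q)_\infty}\sum_{j_1\ge\cdots\ge j_k\ge 0}\frac{(-q)_{j_1}\,a^{j_1+\cdots+j_k}\,q^{\binom{j_1}{2}+j_2^2+\cdots+j_k^2-(j_1+\cdots+j_i)}}{(q)_{j_1-j_2}\cdots(q)_{j_{k-1}-j_k}}\,\beta^{(p)}_{j_k};$$ if $i>k$, $$T^{(p)}_{k,i}=\frac{1}{(-q;q)_\infty}\sum_{j_1\ge\cdots\ge j_{2i-k}\ge 0}(-1)^{j_i+j_{2i-k}}\,\frac{(-q)_{j_1}\,a^{(j_1+\cdots+j_{i-1})-(j_{i+1}+\cdots+j_{2i-k-1})}\;q^{F}}{(q)_{j_1-j_2}\cdots(q)_{j_{2i-k-1}-j_{2i-k}}}\,\beta^{(p)}_{j_{2i-k}},$$ $$F=\binom{j_1}{2}+\sum_{r=2}^{i-1}j_r^2-\sum_{r=i+1}^{2i-k-1}j_r^2-\sum_{r=1}^{i}j_r+\sum_{r=i}^{2i-k-1}\binom{j_r-j_{r+1}}{2}.$$ (III) For $p\in\{1,3,5\}$,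 with $a=a_p=q$: if $0\le i\le k-1$, $$U^{(p)}_{k,i}=\sum_{j_1\ge\cdots\ge j_k\ge 0}\frac{(-q)_{j_k}\,a^{j_1+\cdots+j_k}\,q^{j_1^2+\cdots+j_{k-1}^2-(j_1+\cdots+j_i)+\binom{j_k}{2}}}{(q)_{j_1-j_2}\cdots(q)_{j_{k-1}-j_k}\,(-a)_{j_{k-1}}}\,\beta^{(p)}_{j_k},$$ where for $k=1$ the factor $(-a)_{j_{k-1}}$ is read as $(-a)_\infty$; if $i\ge k$, $$U^{(p)}_{k,i}=\sum_{j_1\ge\cdots\ge j_{2i-k+2}\ge 0}(-1)^{j_i+j_{2i-k+1}}\,\frac{(-q)_{j_{2i-k+2}}\,a^{(j_1+\cdots+j_{i-1})-(j_{i+1}+\cdots+j_{2i-k})+j_{2i-k+2}}\;q^{G}}{(q)_{j_1-j_2}\cdots(q)_{j_{2i-k+1}-j_{2i-k+2}}\,(-a)_{j_{2i-k+1}}}\,\beta^{(p)}_{j_{2i-k+2}},$$ $$G=\sum_{r=1}^{i-1}j_r^2-\sum_{r=i+1}^{2i-k}j_r^2-\sum_{r=1}^{i}j_r+\sum_{r=i}^{2i-k}\binom{j_r-j_{r+1}}{2}+\binom{j_{2i-k+2}}{2}.$$ Then the following hold; in each item, as $i$ runs over the stated range, every standard module of the stated level occurs exactly once. 1. $S^{(1)}_{k,i}=\chi(\Omega(6k+1-2i,\,i))$ for $0\le i\le 3k$ (level $6k+1$, $3k+1$ modules, modulus $12k+8$). 2. $U^{(1)}_{k,i}=\chi(\Omega(6k-2-2i,\,i))$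 for $0\le i\le 3k-1$ (level $6k-2$, $3k$ modules, modulus $12k+2$). 3. $S^{(2)}_{k,i}=(1-q)\,\chi(\Omega(2i+1,\,3k-i))$ for $0\le i\le 3k$ (level $6k+1$, $3k+1$ modules, modulus $12k+8$). 4. $T^{(2)}_{k,i}=c_i\,\chi(\Omega(2i,\,3k-1-i))$ for $0\le i\le 3k-1$ (level $6k-2$, $3k$ modules, modulus $12k+2$). 5. $S^{(3)}_{k,i}=\chi(\Omega(6k-1-2i,\,i))$ for $0\le i\le 3k-1$ (level $6k-1$, $3k$ modules, modulus $12k+4$). 6. $U^{(3)}_{k,i}=\chi(\Omega(6k-4-2i,\,i))$ for $0\le i\le 3k-2$ (level $6k-4$, $3k-1$ modules, modulus $12k-2$). 7. $S^{(4)}_{k,i}=(1-q)\,\chi(\Omega(2i+1,\,3k-1-i))$ for $0\le i\le 3k-1$ (level $6k-1$, $3k$ modules, modulus $12k+4$). 8. $T^{(4)}_{k,i}=c_i\,\chi(\Omega(2i,\,3k-2-i))$ for $0\le i\le 3k-2$ (level $6k-4$, $3k-1$ modules, modulus $12k-2$). 9. $S^{(5)}_{k,i}=\chi(\Omega(6k-2i,\,i))$ for $0\le i\le 3k$ (level $6k$, $3k+1$ modules, modulus $12k+6$). 10. $U^{(5)}_{k,i}=\chi(\Omega(6k-3-2i,\,i))$ for $0\le i\le 3k-2$ (level $6k-3$, $3k-1$ modules, modulus $12k$). Here $c_0=1-q^2$ and $c_i=1-q$ for $i\ge1$.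
   Context: Here $q$ is a formal variable; identities are between formal series in $q$. Notation: $(x;q)_n=\prod_{0\le t<n}(1-xq^t)$ for $n\in\mathbb{Z}_{\ge0}\cup\{\infty\}$, $(x)_n=(x;q)_n$, $(x_1,\dots,x_m;q)_n=\prod_{r}(x_r;q)_n$, and $\binom{m}{2}=m(m-1)/2$. Empty sums are $0$ and empty products are $1$. All multisums are read as a sum over $j_1\ge0$ of the finite sum over the remaining indices. For integers $s_0,s_1\ge0$, the level is $\ell=s_0+2s_1$, and $\chi(\Omega(s_0,s_1))$ denotes the principal character of the standard (integrable highest-weight) irreducible module $L(s_0,s_1)$ for the affine Lie algebra $A_2^{(2)}$, that is, the principally specialized character of its vacuum space with respect to the principal Heisenberg subalgebra. It is given by the known product formula, which may be taken as its definition: $$\chi(\Omega(s_0,s_1))=\frac{(q^{s_1+1},q^{s_0+s_1+2},q^{s_0+2s_1+3};\,q^{s_0+2s_1+3})_\infty\,(q^{s_0+1},q^{s_0+4s_1+5};\,q^{2(s_0+2s_1+3)})_\infty}{(q;q)_\infty}.$$ The modulus of this product is $2(s_0+2s_1+3)=2\ell+6$. The standard irreducible modules of level $\ell$ are, up to isomorphism, exactly the $L(s_0,s_1)$ with $s_0,s_1\ge0$ and $s_0+2s_1=\ell$; there are $1+\lfloor \ell/2\rfloor$ of them. *)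

(* Defs.v *)
From HB Require Import structures.
From mathcomp Require Import all_boot all_order all_algebra.
From mathcomp Require Import boolp classical_sets.

Set Implicit Arguments.
Unset Strict Implicit.
Unset Printing Implicit Defensive.

Import GRing.Theory.
Local Open Scope ring_scope.

(* Formal power series over the rationals.  The Laurent series field Q((q))
   is obtained as the fraction field of Q[[q]]. *)
Record fps := Fps { fps_coef : nat -> rat }.

HB.instance Definition _ := gen_eqMixin fps.
HB.instance Definition _ := gen_choiceMixin fps.

Lemma fpsP (f g : fps) : (forall n, fps_coef f n = fps_coef g n) -> f = g.
Proof. by case: f g => [f] [g] /= fg; congr Fps; apply/funext. Qed.

Definition fps_poly (n : nat) (f : fps) : {poly rat} :=
  \poly_(i < n) fps_coef f i.
Definition fps_of_poly (p : {poly rat}) : fps := Fps (fun n => p`_n).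

Definition fps_add (f g : fps) : fps :=
  Fps (fun n => fps_coef f n + fps_coef g n).
Definition fps_opp (f : fps) : fps := Fps (fun n => - fps_coef f n).
Definition fps_mul (f g : fps) : fps :=
  Fps (fun n => \sum_(i < n.+1) fps_coef f i * fps_coef g (n - i)%N).

Lemma fps_addA : associative fps_add.
Proof. by move=> f g h; apply: fpsP => n /=; rewrite addrA. Qed.

Lemma fps_addC : commutative fps_add.
Proof. by move=> f g; apply: fpsP => n /=; rewrite addrC. Qed.

Lemma fps_add0 : left_id (fps_of_poly 0) fps_add.
Proof. by move=> f; apply: fpsP => n /=; rewrite coef0 add0r. Qed.

Lemma fps_addN : left_inverse (fps_of_poly 0) fps_opp fps_add.
Proof. by move=> f; apply: fpsP => n /=; rewrite coef0 addNr. Qed.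

HB.instance Definition _ :=
  GRing.isZmodule.Build fps fps_addA fps_addC fps_add0 fps_addN.

Lemma fps_coefD (f g : fps) n :
  fps_coef (f + g) n = fps_coef f n + fps_coef g n.
Proof. by []. Qed.

Lemma fps_coefM_poly (f g : fps) (p r : {poly rat}) n :
    (forall i, (i <= n)%N -> fps_coef f i = p`_i) ->
    (forall i, (i <= n)%N -> fps_coef g i = r`_i) ->
  fps_coef (fps_mul f g) n = (p * r)`_n.
Proof.
move=> fp gr; rewrite coefM /=; apply: eq_bigr => i _.
by rewrite fp ?gr ?leq_subr // -ltnS.
Qed.

Lemma coef_fps_poly n f i :
  (i <= n)%N -> fps_coef f i = (fps_poly n.+1 f)`_i.
Proof. by move=> lein; rewrite coef_poly ltnS lein. Qed.

Lemma fps_coefM_trunc (f g : fps) n i : (i <= n)%N ->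
  fps_coef (fps_mul f g) i = (fps_poly n.+1 f * fps_poly n.+1 g)`_i.
Proof.
move=> lein; apply: fps_coefM_poly => j leji; apply: coef_fps_poly;
  exact: leq_trans lein.
Qed.

Lemma fps_mulA : associative fps_mul.
Proof.
move=> f g h; apply: fpsP => n.
rewrite (fps_coefM_poly (p := fps_poly n.+1 f)
  (r := fps_poly n.+1 g * fps_poly n.+1 h)).
- rewrite (fps_coefM_poly (p := fps_poly n.+1 f * fps_poly n.+1 g)
    (r := fps_poly n.+1 h)) ?mulrA //.
  + by move=> i; apply: fps_coefM_trunc.
  + by move=> i; apply: coef_fps_poly.
- by move=> i; apply: coef_fps_poly.
- by move=> i; apply: fps_coefM_trunc.
Qed.

Lemma fps_mulC : commutative fps_mul.
Proof.
by move=> f g; apply: fpsP => n; rewrite !(fps_coefM_trunc _ _ (leqnn n)) mulrC.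
Qed.

Lemma fps_mul1 : left_id (fps_of_poly 1) fps_mul.
Proof.
move=> f; apply: fpsP => n.
rewrite (fps_coefM_poly (p := 1) (r := fps_poly n.+1 f)) //.
- by rewrite mul1r -coef_fps_poly.
- by move=> i; apply: coef_fps_poly.
Qed.

Lemma fps_mulD : left_distributive fps_mul fps_add.
Proof.
move=> f g h; apply: fpsP => n /=; rewrite -big_split /=.
by apply: eq_bigr => i _; rewrite mulrDl.
Qed.

Lemma fps_one_neq0 : fps_of_poly 1 != fps_of_poly 0.
Proof.
apply/eqP => /(congr1 (fun f => fps_coef f 0)) /=.
by rewrite coef1 coef0 => /eqP; rewrite oner_eq0.
Qed.

HB.instance Definition _ := GRing.Zmodule_isComNzRing.Build fps
  fps_mulA fps_mulC fps_mul1 fps_mulD fps_one_neq0.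

Definition fps_unit : pred fps := fun f => `[< exists g, g * f = 1 >].
Definition fps_inv (f : fps) : fps := xget f [set g | g * f = 1].

Lemma fps_mulV : {in fps_unit, left_inverse 1 fps_inv *%R}.
Proof. by move=> f /asboolP /(xgetPex f). Qed.

Lemma fps_unitP (f g : fps) : g * f = 1 -> fps_unit f.
Proof. by move=> gf; apply/asboolP; exists g. Qed.

Lemma fps_inv_out : {in [predC fps_unit], fps_inv =1 id}.
Proof.
move=> f /negP nu; apply: xgetPN => g gf; apply: nu; exact: fps_unitP gf.
Qed.

HB.instance Definition _ := GRing.ComNzRing_hasMulInverse.Build fps
  fps_mulV fps_unitP fps_inv_out.

Lemma fps_neq0 (f : fps) : f != 0 ->
  exists2 m, fps_coef f m != 0 & forall i, (i < m)%N -> fps_coef f i = 0.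
Proof.
move=> f0; have exf : exists n, fps_coef f n != 0.
  apply: contrapT => /forallNP nf; move/eqP: f0; apply; apply: fpsP => n /=.
  by rewrite coef0; move/negP: (nf n); rewrite negbK => /eqP.
case: (ex_minnP exf) => m fm minm; exists m => // i ltim.
by apply/eqP; apply: contraLR ltim => /minm; rewrite -leqNgt.
Qed.

Lemma fps_idomain : GRing.integral_domain_axiom fps.
Proof.
move=> f g fg0; apply/norP => -[/fps_neq0[m fm f0] /fps_neq0[n gn g0]].
have /= := congr1 (fun h => fps_coef h (m + n)%N) fg0; rewrite coef0.
have ltm : (m < (m + n).+1)%N by rewrite ltnS leq_addr.
rewrite (bigD1 (Ordinal ltm)) //= addKn big1 ?addr0.
  by move/eqP; rewrite mulf_eq0 (negPf fm) (negPf gn).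
move=> i; rewrite -val_eqE /= neq_ltn => /orP[ltim|ltmi].
  by rewrite f0 ?mul0r.
rewrite [fps_coef g _]g0 ?mulr0 // ltn_subLR; last by rewrite -ltnS.
by rewrite ltn_add2r.
Qed.

HB.instance Definition _ := GRing.ComUnitRing_isIntegral.Build fps fps_idomain.

Definition laurent : fieldType := {fraction fps}.

Local Notation "x %:F" := (FracField.tofrac x).

Definition q : laurent := (fps_of_poly 'X)%:F.

(* Convergence in the q-adic topology of Q((q)). *)
Definition q_cvg (u : nat -> laurent) (l : laurent) : Prop :=
  forall M : nat, exists N : nat, forall n : nat, (N <= n)%N ->
    exists f : fps, u n - l = q ^+ M * f%:F.

(* Junk value 0 on sequences that do not converge. *)
Definition q_lim (u : nat -> laurent) : laurent :=
  xget 0 [set l | q_cvg u l].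

Lemma coef_fpsXM M f n : fps_coef (fps_of_poly 'X ^+ M * f) n =
  if (n < M)%N then 0 else fps_coef f (n - M)%N.
Proof.
have fpX : fps_of_poly 'X ^+ M = fps_of_poly 'X^M.
  elim: M => [|M IH]; first by rewrite expr0 expr0.
  rewrite exprS IH; apply: fpsP => i.
  by rewrite (fps_coefM_poly (p := 'X) (r := 'X^M)) //= -exprS.
rewrite fpX (fps_coefM_poly (p := 'X^M) (r := fps_poly n.+1 f)) //.
  rewrite coefXnM; case: ltnP => // leMn.
  by rewrite -coef_fps_poly // leq_subr.
by move=> i; apply: coef_fps_poly.
Qed.

Lemma laurent_frac (d : laurent) : exists x y : fps, y != 0 /\ d * y%:F = x%:F.
Proof.
elim/quotW: d => r; exists (\n_r), (\d_r); split; first exact: denom_ratioP.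
unlock FracField.tofrac; rewrite -[LHS]FracField.pi_mul.
apply/eqmodP; rewrite /= FracField.equivfE /FracField.mulf.
by rewrite !numden_Ratio ?(oner_eq0, mulr1, mulf_neq0, denom_ratioP) // mulrC.
Qed.

Lemma q_cvg_unique (u : nat -> laurent) l l' : q_cvg u l -> q_cvg u l' -> l = l'.
Proof.
move=> ul ul'; apply/eqP; rewrite -subr_eq0; apply/eqP.
have dvd M : exists f : fps, l - l' = q ^+ M * f%:F.
  have [N HN] := ul M; have [N' HN'] := ul' M.
  have [f Ef] := HN _ (leq_maxl N N'); have [g Eg] := HN' _ (leq_maxr N N').
  exists (g - f); rewrite rmorphB mulrBr -Eg -Ef.
  by rewrite opprB [RHS]addrC subrKA.
have [x [y [y0 dy]]] := laurent_frac (l - l').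
suff x0 : x = 0.
  apply/eqP; move/eqP: dy; rewrite x0 rmorph0 mulf_eq0 tofrac_eq0 (negPf y0).
  by rewrite orbF.
apply: fpsP => n /=; rewrite coef0; have [f df] := dvd n.+1.
have : x = fps_of_poly 'X ^+ n.+1 * (f * y).
  by apply/eqP; rewrite -tofrac_eq -dy df !rmorphM rmorphXn mulrA.
by move->; rewrite coef_fpsXM ltnS leqnn.
Qed.

Lemma q_limE (u : nat -> laurent) l : q_cvg u l -> q_lim u = l.
Proof.
by move=> ul; apply: xget_unique => // l' ul'; apply: q_cvg_unique ul' ul.
Qed.

Definition q_summable (u : nat -> laurent) : Prop :=
  exists l, q_cvg (fun n => \sum_(j < n) u j) l.

Definition q_sum (u : nat -> laurent) : laurent :=
  q_lim (fun n => \sum_(j < n) u j).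

(* (x; b)_n; below, qpochoo x b is (x; b)_oo. *)
Definition qpoch (x b : laurent) (n : nat) : laurent :=
  \prod_(t < n) (1 - x * b ^+ t).

Definition qpochoo (x b : laurent) : laurent := q_lim (qpoch x b).

(* The limit defining (x; b)_oo exists for x in Q[[q]] and b in q Q[[q]]. *)
Lemma qpoch_cvg (f g : fps) :
  exists l : fps, q_cvg (qpoch f%:F (q * g%:F)) l%:F.
Proof.
pose X := fps_of_poly 'X.
pose P n : fps := \prod_(t < n) (1 - f * (X * g) ^+ t).
have PE n : qpoch f%:F (q * g%:F) n = (P n)%:F.
  rewrite rmorph_prod; apply: eq_bigr => t _.
  by rewrite rmorphB rmorph1 !rmorphM rmorphXn rmorphM.
have step m i : (i < m)%N -> fps_coef (P m.+1) i = fps_coef (P m) i.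
  move=> ltim.
  have -> : P m.+1 = P m + X ^+ m * (- (P m * f * g ^+ m)).
    rewrite /P big_ord_recr /= mulrBr mulr1 exprMn mulrN; congr (_ - _).
    by rewrite mulrA mulrCA.
  by rewrite fps_coefD coef_fpsXM ltim addr0.
have stable i m : fps_coef (P (m + i.+1)%N) i = fps_coef (P i.+1) i.
  by elim: m => // m IH; rewrite addSn step ?IH // leq_addl.
pose l := Fps (fun i => fps_coef (P i.+1) i).
exists l => M; exists M => n leMn.
pose h := Fps (fun i => fps_coef (P n - l) (i + M)%N).
exists h; rewrite PE -rmorphB -rmorphXn -rmorphM; congr (_%:F).
apply: fpsP => i; rewrite coef_fpsXM; case: ltnP => [ltiM|leMi].
  rewrite fps_coefD /= -(stable i (n - i.+1)%N) subnK ?subrr //.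
  exact: leq_trans ltiM leMn.
by rewrite /= subnK.
Qed.

(* The label (s0, s1) stands for the standard module L(s0, s1) of A_2^(2). *)
Definition level (s : nat * nat) : nat := (s.1 + 2 * s.2)%N.

Definition modulus (s : nat * nat) : nat := (2 * (s.1 + 2 * s.2 + 3))%N.

(* The principal character of the vacuum space Omega(s0, s1) of L(s0, s1),
   defined here by its product formula. *)
Definition chi (s : nat * nat) : laurent :=
  let: (s0, s1) := s in
  let M := (s0 + 2 * s1 + 3)%N in
  qpochoo (q ^+ (s1 + 1)) (q ^+ M) * qpochoo (q ^+ (s0 + s1 + 2)) (q ^+ M)
  * qpochoo (q ^+ M) (q ^+ M)
  * (qpochoo (q ^+ (s0 + 1)) (q ^+ modulus s)
     * qpochoo (q ^+ (s0 + 4 * s1 + 5)) (q ^+ modulus s))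
  / qpochoo q q.

Definition num_standard (l : nat) : nat :=
  #|[pred s : 'I_l.+1 * 'I_l.+1 | level (val s.1, val s.2) == l]|.

Definition every_standard_once (l N m imax : nat)
    (Omega : nat -> nat * nat) : Prop :=
  [/\ forall i, (i <= imax)%N -> level (Omega i) = l,
      forall s, level s = l -> exists! i, (i <= imax)%N /\ Omega i = s,
      num_standard l = N
    & forall i, (i <= imax)%N -> modulus (Omega i) = m].

Variant pair_index := P1 | P2 | P3 | P4 | P5.

Definition bailey_a (p : pair_index) : laurent :=
  match p with P1 | P3 | P5 => q | P2 | P4 => q ^+ 2 end.

Definition bailey_beta (p : pair_index) (n : nat) : laurent :=
  match p with
  | P1 => 1 / qpoch q q (2 * n)
  | P2 => 1 / qpoch (q ^+ 2) q (2 * n)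
  | P3 => q ^+ (n ^ 2 - n) / qpoch q q (2 * n)
  | P4 => q ^+ (n ^ 2) / qpoch (q ^+ 2) q (2 * n)
  | P5 => qpoch (-1) (q ^+ 3) n / (qpoch q q (2 * n) * qpoch (-1) q n)
  end.

(* A multi-index j_1 >= ... >= j_m >= 0 is passed to a summand as a function
   j : nat -> nat with j r = j_r for 1 <= r <= m.  [block m F n] is the finite
   sum of F over the multi-indices with j_1 = n. *)
Definition tuple_index (n m : nat) (t : m.-tuple 'I_n.+1) (r : nat) : nat :=
  nth 0%N [seq val x | x <- t] r.-1.

Definition block (m : nat) (F : (nat -> nat) -> laurent) (n : nat) : laurent :=
  \sum_(t : m.-tuple 'I_n.+1 |
        sorted geq [seq val x | x <- t] && (tuple_index t 1 == n))
     F (tuple_index t).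

Section Exponents.
Variable j : nat -> nat.

(* Sums over m <= r <= n, empty when n < m. *)
Definition sum1 (m n : nat) : int := \sum_(m <= r < n.+1) (j r)%:Z.
Definition sum2 (m n : nat) : int := \sum_(m <= r < n.+1) (j r ^ 2)%:Z.
Definition sumbin (m n : nat) : int :=
  \sum_(m <= r < n.+1) 'C(j r - j r.+1, 2)%:Z.

(* (q)_{j_1 - j_2} ... (q)_{j_{m-1} - j_m} *)
Definition denom (m : nat) : laurent :=
  \prod_(1 <= r < m) qpoch q q (j r - j r.+1).
End Exponents.

Definition S_block (p : pair_index) (k i : nat) : nat -> laurent :=
  let a := bailey_a p in
  if (i <= k)%N then
    block k (fun j =>
      a ^ sum1 j 1 k * q ^ (sum2 j 1 k - sum1 j 1 i)
      / denom j k * bailey_beta p (j k))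
  else
    let m := (2 * i - k)%N in
    block m (fun j =>
      (-1) ^+ (j i + j m)
      * (a ^ (sum1 j 1 (i - 1) - sum1 j (i + 1) (m - 1))
         * q ^ (sum2 j 1 (i - 1) - sum2 j (i + 1) (m - 1) - sum1 j 1 i
                + sumbin j i (m - 1)))
      / denom j m * bailey_beta p (j m)).

Definition S_sum (p : pair_index) (k i : nat) : laurent := q_sum (S_block p k i).

Definition T_block (p : pair_index) (k i : nat) : nat -> laurent :=
  let a := bailey_a p in
  if (i <= k)%N then
    block k (fun j =>
      qpoch (- q) q (j 1%N) * a ^ sum1 j 1 k
      * q ^ ('C(j 1%N, 2)%:Z + sum2 j 2 k - sum1 j 1 i)
      / denom j k * bailey_beta p (j k))
  else
    let m := (2 * i - k)%N in
    block m (fun j =>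
      (-1) ^+ (j i + j m)
      * (qpoch (- q) q (j 1%N)
         * a ^ (sum1 j 1 (i - 1) - sum1 j (i + 1) (m - 1))
         * q ^ ('C(j 1%N, 2)%:Z + sum2 j 2 (i - 1) - sum2 j (i + 1) (m - 1)
                - sum1 j 1 i + sumbin j i (m - 1)))
      / denom j m * bailey_beta p (j m)).

Definition T_sum (p : pair_index) (k i : nat) : laurent :=
  1 / qpochoo (if i == 0%N then - q ^+ 2 else - q) q * q_sum (T_block p k i).

Definition U_block (p : pair_index) (k i : nat) : nat -> laurent :=
  let a := bailey_a p in
  if (i < k)%N then
    block k (fun j =>
      qpoch (- q) q (j k) * a ^ sum1 j 1 k
      * q ^ (sum2 j 1 (k - 1) - sum1 j 1 i + 'C(j k, 2)%:Z)
      / (denom j k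
         * (if k == 1%N then qpochoo (- a) q else qpoch (- a) q (j (k - 1)%N)))
      * bailey_beta p (j k))
  else
    let m := (2 * i - k + 2)%N in
    block m (fun j =>
      (-1) ^+ (j i + j (m - 1)%N)
      * (qpoch (- q) q (j m)
         * a ^ (sum1 j 1 (i - 1) - sum1 j (i + 1) (m - 2) + (j m)%:Z)
         * q ^ (sum2 j 1 (i - 1) - sum2 j (i + 1) (m - 2) - sum1 j 1 i
                + sumbin j i (m - 2) + 'C(j m, 2)%:Z))
      / (denom j m * qpoch (- a) q (j (m - 1)%N)) * bailey_beta p (j m)).

Definition U_sum (p : pair_index) (k i : nat) : laurent := q_sum (U_block p k i).

Definition T_factor (i : nat) : laurent := if i == 0%N then 1 - q ^+ 2 else 1 - q.

(* Main.v *)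
(** Let X_r(n) = (1 - a q^(2r)) / ((q)_(n-r) (q)_(n+r+e)) with a = q^e.  Each
    beta^(p) is a bilateral sum of multiples of the kernels X_(3s), s in Z; this
    follows from q-Pascal recursions between neighbouring kernels and the
    symmetry r -> -r-e.  Every kernel is an eigenvector of a Bailey step
    beta_n |-> sum_r a^r q^(r^2) beta_r / (q)_(n-r), hence also of the inverse
    step, and the factors (-q)_j q^C(j,2) only change the eigenvalue.  Rewriting
    X_r through kernels relative to a/q after k - i steps (inverse steps when
    i > k) and then performing i steps relative to a/q, each multisum becomes a
    single theta series over Z that is uniform in i.  The quintuple product
    identity, obtained as the limit of a finite identity with a WZ proof,
    evaluates it as the numerator of the character. *)

Require Import Defs.
From HB Require Import structures.
From mathcomp Require Import all_boot all_order all_algebra.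
From mathcomp Require Import boolp.
From mathcomp Require Import zify ring.

Set Implicit Arguments.
Unset Strict Implicit.
Unset Printing Implicit Defensive.

Import Order.TTheory GRing.Theory Num.Theory.
Local Open Scope ring_scope.

(** * Finite q-series and Bailey kernels *)

Section QSeries.
Variables (F : fieldType) (q : F).

(** Expanding β over kernels adds a second infinite summation, and exchanging it with the multisum
    is the analytic difficulty. It is met by working at fixed j_1 = n: there all sums are finite,
    the contribution of each kernel is evaluated exactly, and this gives it a valuation of at least
    |s| - c with c independent of n. Only then are the sums over n and s exchanged. The sum over n
    is one more Bailey step, with its upper bound sent to infinity.

    The signs and binomial exponents for i > k are those of the inverse of the triangular matrix
    1/(q)_(n-r); along consecutive inverse steps the signs cancel, except at j_i and at the
    innermost index.

    Uniformity in i for the family S: relative to a = q^(e+1), X_r equals Y_r - q^(2r+e+1) Y_(r+1),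
    with Y_r = 1/((q)_(n-r) (q)_(n+r+e)). The eigenvalues q^(r^2+er) taken at r+1 and at r have
    ratio q^(2r+e+1) as well. The base change and the i steps after it, the sum over n included,
    therefore separate the two terms by q^((i+1)(2r+e+1)), which also covers i = 0, where X_r itself
    contributes 1 - q^(2r+e+1). *)

Definition pochhammer (x : F) (n : nat) : F := \prod_(t < n) (1 - x * q ^+ t).

Arguments pochhammer x n%_N.

Lemma poch0 x : pochhammer x 0 = 1.
Proof. by rewrite /pochhammer big_ord0. Qed.

Lemma pochS x n : pochhammer x n.+1 = pochhammer x n * (1 - x * q ^+ n).
Proof. by rewrite /pochhammer big_ord_recr. Qed.

Lemma pochSl x n : pochhammer x n.+1 = (1 - x) * pochhammer (x * q) n.
Proof.
rewrite /pochhammer big_ord_recl expr0 mulr1; congr (_ * _).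
by apply: eq_bigr => i _; rewrite exprS mulrA.
Qed.

Lemma pochD x m n : pochhammer x (m + n) = pochhammer x m * pochhammer (x * q ^+ m) n.
Proof.
elim: n => [|n IH]; first by rewrite addn0 poch0 mulr1.
by rewrite addnS !pochS IH exprD !mulrA.
Qed.

Lemma pochqS n : pochhammer q n.+1 = pochhammer q n * (1 - q ^+ n.+1).
Proof. by rewrite pochS -exprS. Qed.

(** Extending 1/(q)_z by 0 to negative z keeps the rule 1/(q)_(z-1) = (1 - q^z)/(q)_z valid at every
    integer, so the recursions need no case analysis on supports. *)
Definition qfacV (z : int) : F := if z is Posz n then (pochhammer q n)^-1 else 0.

Arguments qfacV z%_Z : simpl never.

Lemma rq_neg z : (z < 0)%R -> qfacV z = 0.
Proof. by case: z. Qed.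

Lemma rq0 : qfacV 0 = 1.
Proof. by rewrite -[qfacV 0]/((pochhammer q 0)^-1) poch0 invr1. Qed.

(* With [a = q ^ e], the kernels [1 / ((q)_(n-r) (aq)_(n+r))] of a Bailey pair
   relative to [a], normalised to be defined and symmetric ([r -> -r-e]) for all
   integers [r]. *)
Definition bkerY (e : nat) (r : int) (n : nat) : F :=
  qfacV (n%:Z - r) * qfacV (n%:Z + r + e%:Z).
Definition bkerX (e : nat) (r : int) (n : nat) : F :=
  (1 - q ^ (2 * r + e%:Z)) * bkerY e r n.

Lemma kerY_sym e r n : bkerY e (- r - e%:Z) n = bkerY e r n.
Proof. by rewrite /bkerY mulrC; congr (qfacV _ * qfacV _); lia. Qed.

Lemma kerY_neg e (r n : nat) : (n < r)%N -> bkerY e r n = 0.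
Proof. by move=> ltnr; rewrite /bkerY rq_neg ?mul0r //; lia. Qed.

Lemma sum_rev (f : nat -> F) n :
  \sum_(x < n.+1) f x = \sum_(m < n.+1) f (n - m)%N.
Proof.
by rewrite (reindex_inj rev_ord_inj) /=; apply: eq_bigr => i _; rewrite subSS.
Qed.

Hypotheses (q0 : q != 0) (q1 : forall n, q ^+ n.+1 != 1).

Lemma pochq_neq0 n : pochhammer q n != 0.
Proof.
elim: n => [|n IH]; first by rewrite poch0 oner_neq0.
by rewrite pochqS mulf_neq0 // subr_eq0 eq_sym q1.
Qed.

Lemma rqS z : qfacV (z - 1) = (1 - q ^ z) * qfacV z.
Proof.
case: z => [[|n]|n].
- by rewrite expr0z subrr mul0r.
- rewrite (_ : n.+1%:Z - 1 = n%:Z); last by lia.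
  rewrite /qfacV pochqS -exprnP invfM mulrCA mulfV ?mulr1 //.
  by rewrite subr_eq0 eq_sym q1.
- by rewrite !rq_neg ?mulr0 //; lia.
Qed.

Lemma exprzqD m n : q ^ (m + n) = q ^ m * q ^ n.
Proof. exact: expfzDr. Qed.

Lemma exprzq_neq0 m : q ^ m != 0.
Proof. by rewrite expfz_neq0. Qed.

(** Split 1 - q^(A+B) as (1 - q^B) + q^B (1 - q^A). This q-Pascal rule drives both the summation
    formula below and the Bailey pairs. *)
Lemma rq_pascalr A B :
  (1 - q ^ (A + B)) * (qfacV A * qfacV B)
  = q ^ B * (qfacV (A - 1) * qfacV B) + qfacV A * qfacV (B - 1).
Proof. by rewrite !rqS exprzqD; ring. Qed.

(* [y = 0] and [c = 0] give the limiting cases. *)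
Lemma vandermonde (c y : F) (L : nat) :
  \sum_(m < L.+1) q ^+ 'C(m, 2) * \prod_(t < m) (c * q ^+ t - y)
     * pochhammer (c * q ^+ m) (L - m) * (qfacV m * qfacV (L%:Z - m%:Z))
  = pochhammer y L * qfacV L.
Proof.
elim: L c y => [|L IH] c y.
  by rewrite big_ord_recl !big_ord0 bin0n !poch0 subr0 /qfacV !poch0 invr1; ring.
have qL : 1 - q ^ L.+1%:Z != 0 by rewrite subr_eq0 eq_sym q1.
apply: (mulfI qL).
pose u (m : nat) := q ^+ 'C(m, 2) * \prod_(t < m) (c * q ^+ t - y).
have -> : (1 - q ^ L.+1%:Z) * (pochhammer y L.+1 * qfacV L.+1) =
   (1 - y) * (pochhammer (y * q) L * qfacV L).
  have := rqS L.+1; rewrite (_ : L.+1%:Z - 1 = L) => [->|]; last by lia.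
  by rewrite pochSl; ring.
(* Taking 1 - y out of (y)_(L+1) leaves (yq)_L, so the induction hypothesis is needed at (cq, yq).
   The two Pascal terms, the second shifted by one in m, then match it summand by summand. *)
rewrite -(IH (c * q)) !mulr_sumr.
transitivity (\sum_(m < L.+2) (u m * pochhammer (c * q ^+ m) (L.+1 - m) *
     (q ^ m * (qfacV m * qfacV (L%:Z - m%:Z)))
   + u m * pochhammer (c * q ^+ m) (L.+1 - m) * (qfacV (m%:Z - 1) * qfacV (L.+1%:Z - m%:Z)))).
  apply: eq_bigr => m _; rewrite -mulrDr.
  have := rq_pascalr (L.+1%:Z - m%:Z) m; rewrite subrK.
  rewrite (_ : L.+1%:Z - m%:Z - 1 = L%:Z - m%:Z); last by lia.
  by move=> E; rewrite mulrCA [qfacV m * _]mulrC E /u; ring.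
rewrite big_split /= [X in X + _]big_ord_recr [X in _ + X]big_ord_recl /=.
rewrite [qfacV (L%:Z - L.+1%:Z)]rq_neg; last by lia.
rewrite (@rq_neg ((ord0 : 'I_L.+2)%:Z - 1)) // mul0r !mulr0 addr0 add0r -big_split /=.
apply: eq_bigr => m _.
have lemL : (m <= L)%N by rewrite -ltnS.
rewrite (_ : L.+1 - m = (L - m).+1)%N; last by lia.
rewrite (_ : L.+1 - bump 0 m = L - m)%N; last by rewrite /bump /=; lia.
rewrite (_ : (bump 0 m)%:Z - 1 = m); last by rewrite /bump /=; lia.
rewrite (_ : L.+1%:Z - (bump 0 m)%:Z = L%:Z - m%:Z); last by rewrite /bump /=; lia.
rewrite /u /bump /= add1n big_ord_recr /= pochSl binS bin1 exprD.
rewrite -[q ^ m%:Z]/(q ^+ m).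
have -> : \prod_(t < m) (c * q * q ^+ t - y * q) =
    q ^+ m * \prod_(t < m) (c * q ^+ t - y).
  rewrite -[in q ^+ m](card_ord m) -prodr_const -big_split /=.
  by apply: eq_bigr => t _; ring.
rewrite -[c * q * q ^+ m]mulrA -exprS -[c * q ^+ m * q]mulrA -exprSr.
ring.
Qed.

(** This is [vandermonde] at c = 0, y = 1, where (1)_L vanishes for L > 0. The range may exceed L so
    that the relation applies after two sums over a common square range have been exchanged. *)
Lemma rq_orthogonal (L n : nat) : (L <= n)%N ->
  \sum_(m < n.+1) (-1) ^+ m * q ^+ 'C(m, 2) * (qfacV m * qfacV (L%:Z - m%:Z))
  = (L == 0)%:R.
Proof.
move=> leLn; have lLn : (L.+1 <= n.+1)%N by [].
rewrite (bigID (fun m : 'I_n.+1 => (m < L.+1)%N)) /= [X in _ + X]big1 => [|m].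
  rewrite -(big_ord_widen _ (fun m => (-1) ^+ m * q ^+ 'C(m, 2) *
    (qfacV m * qfacV (L%:Z - m%:Z))) lLn) addr0.
  have := vandermonde 0 1 L.
  have -> : pochhammer 1 L * qfacV L = (L == 0)%:R.
    case: (L) => [|l]; first by rewrite /qfacV !poch0 invr1 mulr1.
    by rewrite pochSl subrr !mul0r.
  move=> <-; apply: eq_bigr => m _; rewrite mul0r.
  have -> : pochhammer 0 (L - m) = 1.
    by rewrite /pochhammer big1 // => i _; rewrite mul0r subr0.
  rewrite mulr1; congr (_ * _); rewrite mulrC; congr (_ * _).
  under eq_bigr do rewrite mul0r add0r.
  by rewrite prodr_const card_ord.
by rewrite -leqNgt => ltLm; rewrite [qfacV (_ - _)]rq_neg ?mulr0 //; lia.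
Qed.

(** By orthogonality the matrix 1/(q)_(n-x) has inverse (-1)^(n-x) q^C(n-x,2)/(q)_(n-x), so an
    eigenvector of a step gives one of the inverse step. The sign is split as (-1)^n (-1)^x over the
    two sides, which is how signs disappear inside a chain of inverse steps. *)
Lemma inverse_eigen (w g : nat -> F) (lam : F) : lam != 0 ->
    (forall n, \sum_(x < n.+1) qfacV (n - x)%N * (w x * g x) = lam * g n) ->
  forall n, \sum_(x < n.+1)
      q ^+ 'C(n - x, 2) * qfacV (n - x)%N * ((-1) ^+ x * g x)
    = lam^-1 * ((-1) ^+ n * (w n * g n)).
Proof.
move=> lam0 eig n; apply: (mulfI lam0); rewrite mulVKf // mulr_sumr.
transitivity (\sum_(x < n.+1) \sum_(y < n.+1) (w y * g y) *
   ((-1) ^+ x * q ^+ 'C(n - x, 2) * (qfacV (n - x)%N * qfacV (x%:Z - y%:Z)))).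
  apply: eq_bigr => x _; rewrite mulrCA [lam * _]mulrCA -eig !mulr_sumr.
  have lexn : (x.+1 <= n.+1)%N by [].
  rewrite (big_ord_widen n.+1 (fun y => q ^+ 'C(n - x, 2) * qfacV (n - x)%N *
     ((-1) ^+ x * (qfacV (x - y)%N * (w y * g y))))) //.
  rewrite [RHS](bigID (fun y : 'I_n.+1 => (y < x.+1)%N)) /=.
  rewrite [X in _ = _ + X]big1 ?addr0 => [|y]; last first.
    by rewrite -leqNgt => ltxy; rewrite [qfacV (_ - _)]rq_neg ?mulr0 //; lia.
  apply: eq_bigr => y ltyx; rewrite subzn //; ring.
rewrite exchange_big /= (bigD1 ord_max) //= [X in _ + X]big1 => [|y ney].
  rewrite addr0 -mulr_sumr [RHS]mulrC; congr (_ * _) => /=.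
  rewrite (sum_rev (fun x => (-1) ^+ x * q ^+ 'C(n - x, 2) *
    (qfacV (n - x)%N * qfacV (x%:Z - n%:Z)))).
  rewrite big_ord_recl /= big1 ?addr0 => [|i _]; last first.
    by rewrite [qfacV (_ - _)]rq_neg ?mulr0 // /bump /=; have := ltn_ord i; lia.
  by rewrite subn0 subnn subrr !rq0 !mulr1.
rewrite -mulr_sumr (sum_rev (fun x => (-1) ^+ x * q ^+ 'C(n - x, 2) *
    (qfacV (n - x)%N * qfacV (x%:Z - y%:Z)))).
have ltyn : (y < n)%N.
  by rewrite ltn_neqAle -ltnS ltn_ord andbT; move: ney; rewrite -val_eqE.
have := @rq_orthogonal (n - y) n (leq_subr _ _).
rewrite subn_eq0 leqNgt ltyn /= => E.
suff -> : \sum_(m < n.+1) (-1) ^+ (n - m) * q ^+ 'C(n - (n - m), 2) *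
    (qfacV (n - (n - m))%N * qfacV ((n - m)%N%:Z - y%:Z)) = 0 by rewrite mulr0.
rewrite -[RHS](mulr0 ((-1) ^+ n)) -[X in _ = _ * X]E mulr_sumr.
apply: eq_bigr => m _; have lemn : (m <= n)%N by rewrite -ltnS.
rewrite subKn // (_ : (n - m)%N%:Z - y%:Z = (n - y)%N%:Z - m%:Z); last by lia.
have -> : (-1) ^+ n = (-1) ^+ (n - m) * (-1) ^+ m :> F by rewrite -exprD subnK.
by rewrite -!mulrA; congr (_ * _); rewrite [RHS]mulrA -expr2 sqrr_sign mul1r.
Qed.

(** Passage from base a to a/q. With A = n-r and B = n+r+e+1 one has q^B = q^(2r+e+1) q^A, so 1 -
    q^(2r+e+1) = (1 - q^B) - q^(2r+e+1) (1 - q^A), and each bracket lowers one of the two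
    q-factorials. *)
Lemma kerXY e r n :
  bkerX e.+1 r n = bkerY e r n - q ^ (2 * r + e.+1%:Z) * bkerY e (r + 1) n.
Proof.
rewrite /bkerX /bkerY.
have := rqS (n%:Z - r); have := rqS (n%:Z + r + e.+1%:Z).
rewrite (_ : n%:Z + r + e.+1%:Z - 1 = n%:Z + r + e%:Z); last by lia.
rewrite (_ : n%:Z - r - 1 = n%:Z - (r + 1)); last by lia.
rewrite (_ : n%:Z + (r + 1) + e%:Z = n%:Z + r + e.+1%:Z); last by lia.
move=> -> ->.
have -> : q ^ (n%:Z + r + e.+1%:Z) = q ^ (2 * r + e.+1%:Z) * q ^ (n%:Z - r).
  by rewrite -exprzqD; congr (q ^ _); lia.
by ring.
Qed.

(** The hypothesis makes w (r + m) equal to w r times q^C(m,2) and the product of the q^(2r+e+1) q^t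
    - y over t < m, which is the summand of [vandermonde] with L = N - r. The choice y = 0 gives the
    weights q^(n^2+en), and y = -q^(r+e) those containing (-q)_n. *)
Lemma kernel_sum (w : nat -> F) (y : F) (e r N : nat) :
    (forall m, w (r + m).+1 =
       w (r + m)%N * (q ^+ m * (q ^+ (2 * r + e + 1 + m) - y))) ->
  \sum_(n < N.+1) qfacV (N - n)%N * (w n * bkerY e r n)
  = w r * pochhammer y (N - r) * bkerY e r N.
Proof.
move=> wS; have [ltNr|lerN] := ltnP N r.
  rewrite kerY_neg // mulr0 big1 // => n _.
  by rewrite kerY_neg ?mulr0 //; apply: leq_trans ltNr; rewrite ltn_ord.
pose L := (N - r)%N; have EN : N = (r + L)%N by rewrite subnKC.
rewrite EN addKn -addnS big_split_ord /= big1 ?add0r => [|i _]; last first.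
  by rewrite kerY_neg ?mulr0.
pose s := (2 * r + e)%N.
have wE m : w (r + m)%N = w r * (q ^+ 'C(m, 2) *
    \prod_(t < m) (q ^+ s.+1 * q ^+ t - y)).
  elim: m => [|m IH]; first by rewrite addn0 big_ord0 bin0n expr0 !mulr1.
  rewrite addnS wS IH big_ord_recr /= binS bin1 -/s addn1.
  by rewrite (exprD _ s.+1) (exprD _ 'C(m, 2)); ring.
have YE m : (m <= L)%N ->
    bkerY e r (r + m) = pochhammer (q ^+ s.+1 * q ^+ m) (L - m) * (qfacV m * qfacV (L + s)%N).
  move=> lemL; rewrite /bkerY.
  rewrite (_ : (r + m)%N%:Z - r%:Z = m); last by lia.
  rewrite (_ : (r + m)%N%:Z + r%:Z + e%:Z = (s + m)%N); last by rewrite /s; lia.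
  rewrite mulrCA; congr (_ * _); rewrite /qfacV.
  have -> : (L + s = (s + m) + (L - m))%N by lia.
  have E : pochhammer q (s + m + (L - m)) =
      pochhammer q (s + m) * pochhammer (q ^+ s.+1 * q ^+ m) (L - m).
    by rewrite pochD -exprS -addSn exprD.
  have := pochq_neq0 (s + m + (L - m)); rewrite E mulf_eq0 negb_or => /andP[_ P0].
  by rewrite invfM mulrCA mulfV // mulr1.
rewrite YE // subnn poch0 mul1r.
transitivity (w r * qfacV (L + s)%N * (pochhammer y L * qfacV L)); last by ring.
rewrite -(vandermonde (q ^+ s.+1)) mulr_sumr; apply: eq_bigr => m _.
have lemL : (m <= L)%N by rewrite -ltnS.
rewrite YE // wE subnDl subzn //; ring.
Qed.

End QSeries.

Arguments pochhammer {F} q x n%_N.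
Arguments qfacV {F} q z%_Z : simpl never.

(** The number r(r+1)/2 at every integer: the two constructors share a value because it is invariant
    under r -> -1-r. *)
Definition tri (r : int) : int :=
  match r with Posz n | Negz n => 'C(n.+1, 2)%:Z end.

Lemma bin2S n : ('C(n.+1, 2) * 2 = n * n.+1)%N.
Proof. by elim: n => // n IH; rewrite binS bin1 mulnDl IH; lia. Qed.

Lemma triE r : 2 * tri r = r * (r + 1).
Proof. by case: r => n; rewrite /tri; have := bin2S n; nia. Qed.

(** * Bailey kernels as eigenvectors of Bailey steps *)

Section Eigenvalues.
Variables (F : fieldType) (q : F).
Hypotheses (q0 : q != 0) (q1 : forall n, q ^+ n.+1 != 1).
Local Notation poch := (pochhammer q).
Local Notation rq := (qfacV q).
Local Notation kerX := (bkerX q).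
Local Notation kerY := (bkerY q).
Local Notation qzD := (exprzqD q0).

(** Summation formulas are obtained for r >= 0, where the support starts at n = r, and are carried
    over by the symmetry r -> -r-e; the naturals and their images cover Z as long as e <= 1. *)
Lemma kernel_cases (e : nat) (P : int -> Prop) :
    (e <= 1)%N -> (forall r : nat, P r) -> (forall r : nat, P (- r%:Z - e%:Z)) ->
  forall r, P r.
Proof.
move=> le1 P1 P2 [n|n]; first exact: P1.
have -> : Negz n = - (n.+1 - e)%N%:Z - e%:Z by lia.
exact: P2.
Qed.

Lemma poch0l n : poch 0 n = 1.
Proof. by rewrite /pochhammer big1 // => i _; rewrite mul0r subr0. Qed.

Lemma kerY_sum_nat (e r N : nat) :
  \sum_(n < N.+1) rq (N - n)%N * (q ^ (n * n + e * n)%N%:Z * kerY e r n)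
  = q ^ (r * r + e * r)%N%:Z * kerY e r N.
Proof.
rewrite (kernel_sum q0 q1 (w := fun n => q ^ (n * n + e * n)%N%:Z) (y := 0)).
  by rewrite poch0l mulr1.
by move=> m; rewrite subr0 -!exprnP -!exprD; congr (q ^+ _); nia.
Qed.

Lemma kerY_sum (e : nat) (r : int) (N : nat) : (e <= 1)%N ->
  \sum_(n < N.+1) rq (N - n)%N * (q ^ (n%:Z * n%:Z + e%:Z * n%:Z) * kerY e r n)
  = q ^ (r * r + e%:Z * r) * kerY e r N.
Proof.
move=> le1; pattern r; apply: kernel_cases (le1) _ _ r => {}r.
  exact: kerY_sum_nat.
under eq_bigr do rewrite kerY_sym.
rewrite kerY_sym (_ : q ^ (_ * _ + _) = q ^ (r * r + e * r)%N%:Z).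
  exact: kerY_sum_nat.
by congr (q ^ _); lia.
Qed.

Lemma kerX_sum_nat (e r N : nat) :
  \sum_(n < N.+1) rq (N - n)%N * (q ^ (n * n + e * n)%N%:Z * kerX e r n)
  = q ^ (r * r + e * r)%N%:Z * kerX e r N.
Proof.
rewrite /bkerX mulrCA -kerY_sum_nat mulr_sumr.
by apply: eq_bigr => n _; ring.
Qed.

Lemma kerX_sym e r n :
  kerX e (- r - e%:Z) n = - q ^ (- (2 * r + e%:Z)) * kerX e r n.
Proof.
rewrite /bkerX kerY_sym mulrA; congr (_ * _).
rewrite (_ : 2 * (- r - e%:Z) + e%:Z = - (2 * r + e%:Z)); last by lia.
by rewrite mulrBr mulr1 mulNr -qzD addNr expr0z; ring.
Qed.

Lemma kerX2_N1 n : kerX 2 (-1) n = 0.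
Proof. by rewrite /bkerX expr0z subrr mul0r. Qed.

(** For e = 2 the symmetry leaves out its fixed point r = -1, where the factor 1 - q^(2r+2) of the
    kernel vanishes. *)
Lemma kernelX_cases (e : nat) (P : int -> Prop) :
    (e <= 2)%N -> (e = 2%N -> P (-1)) ->
    (forall r : nat, P r) -> (forall r : nat, P (- r%:Z - e%:Z)) ->
  forall r, P r.
Proof.
move=> le2 PN1 P1 P2 [n|n]; first exact: P1.
have [[-> e2]|h] : (n = 0 /\ e = 2)%N \/ (e <= n.+1)%N by lia.
  exact: PN1.
have -> : Negz n = - (n.+1 - e)%N%:Z - e%:Z by lia.
exact: P2.
Qed.

Lemma kerX_sum (e : nat) (r : int) (N : nat) : (e <= 2)%N ->
  \sum_(n < N.+1) rq (N - n)%N * (q ^ (n%:Z * n%:Z + e%:Z * n%:Z) * kerX e r n)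
  = q ^ (r * r + e%:Z * r) * kerX e r N.
Proof.
move=> le2; pattern r; apply: kernelX_cases (le2) _ _ _ r => [->|{}r|{}r].
- by rewrite kerX2_N1 mulr0 big1 // => n _; rewrite kerX2_N1 !mulr0.
- exact: kerX_sum_nat.
rewrite kerX_sym mulrCA (_ : q ^ (_ * _ + _) = q ^ (r * r + e * r)%N); last first.
  by congr (q ^ _); lia.
rewrite -kerX_sum_nat mulr_sumr; apply: eq_bigr => n _.
by rewrite kerX_sym; ring.
Qed.

(** With a = q^e this is (-q)_n a^n q^C(n,2): the weight of the outermost index in T, relative to a
    or a/q, and of the innermost one in U. *)
Definition half_weight (e n : nat) : F := poch (- q) n * q ^+ ('C(n, 2) + e * n).

Lemma kerY_half_nat (e r N : nat) :
  \sum_(n < N.+1) rq (N - n)%N * (half_weight e n * kerY e r n)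
  = half_weight e r * poch (- q ^+ (r + e)) (N - r) * kerY e r N.
Proof.
apply: (kernel_sum q0 q1) => m; rewrite /half_weight pochS.
rewrite binS bin1 mulnS.
rewrite (_ : 'C(r + m, 2) + (r + m) + (e + e * (r + m)) =
  ('C(r + m, 2) + e * (r + m)) + (m + (r + e)))%N; last by lia.
rewrite (_ : 2 * r + e + 1 + m = (r + m).+1 + (r + e))%N; last by lia.
by rewrite !exprD exprS exprD; set u := q ^+ (e * _); ring.
Qed.

Lemma poch_shift r L : poch (- q) (r + L) = poch (- q) r * poch (- q ^+ r.+1) L.
Proof. by rewrite pochD // mulNr -exprS. Qed.

Lemma poch_addr m r N : (r <= N)%N ->
  poch (- q) (r + m) * poch (- q ^+ (r + m).+1) (N - r) = poch (- q) (N + m).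
Proof. by move=> lerN; rewrite -poch_shift; congr (poch _ _); lia. Qed.

Lemma kerY1_half_nat (r N : nat) :
  \sum_(n < N.+1) rq (N - n)%N * (half_weight 1 n * kerY 1 r n)
  = q ^ tri r * (poch (- q) N * kerY 1 r N).
Proof.
rewrite kerY_half_nat; have [lerN|ltNr] := leqP r N; last by rewrite kerY_neg ?mulr0.
have := poch_addr 0 lerN; rewrite !addn0 addn1 /half_weight mul1n => <-.
rewrite (_ : 'C(r, 2) + r = 'C(r.+1, 2))%N; last by rewrite binS bin1.
by rewrite /tri -exprnP; ring.
Qed.

Lemma kerY1_half (r : int) (N : nat) :
  \sum_(n < N.+1) rq (N - n)%N * (half_weight 1 n * kerY 1 r n)
  = q ^ tri r * (poch (- q) N * kerY 1 r N).
Proof.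
pattern r; apply: (@kernel_cases 1%N) r => // r; first exact: kerY1_half_nat.
under eq_bigr do rewrite kerY_sym.
rewrite kerY_sym (_ : tri _ = tri r); first exact: kerY1_half_nat.
by have := triE r; have := triE (- r%:Z - 1%N%:Z); nia.
Qed.

Lemma kerX1_half (r : int) (N : nat) :
  \sum_(n < N.+1) rq (N - n)%N * (half_weight 1 n * kerX 1 r n)
  = q ^ tri r * (poch (- q) N * kerX 1 r N).
Proof.
rewrite /bkerX.
transitivity ((1 - q ^ (2 * r + 1)) * (q ^ tri r * (poch (- q) N * kerY 1 r N))).
  2: by ring.
rewrite -kerY1_half mulr_sumr; apply: eq_bigr => n _; ring.
Qed.

(** For e = 2 the step turns X into Y. The factor 1 - q^(2r+2) supplies the 1 + q^(r+1) missing
    between (-q)_r and (-q^(r+2))_(N-r), which completes (-q)_(N+1) and leaves 1 - q^(r+1) over. *)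
Lemma kerX2_half (r : int) (N : nat) :
  \sum_(n < N.+1) rq (N - n)%N * (half_weight 2 n * kerX 2 r n)
  = (1 - q ^ (r + 1)) * q ^ (tri r + r) * (poch (- q) N.+1 * kerY 2 r N).
Proof.
have main (p : nat) : \sum_(n < N.+1) rq (N - n)%N * (half_weight 2 n * kerX 2 p n)
    = (1 - q ^+ p.+1) * q ^+ ('C(p, 2) + 2 * p) * (poch (- q) N.+1 * kerY 2 p N).
  transitivity ((1 - q ^+ (2 * p.+1)) *
     (half_weight 2 p * poch (- q ^+ (p + 2)) (N - p) * kerY 2 p N)).
    rewrite -kerY_half_nat mulr_sumr; apply: eq_bigr => n _.
    rewrite /bkerX (_ : 2 * p%:Z + 2%N%:Z = (2 * p.+1)%N); last by lia.
    by rewrite -exprnP; ring.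
  have [lepN|ltNp] := leqP p N; last by rewrite kerY_neg ?mulr0.
  have := poch_addr 1 lepN; rewrite !addn1 /half_weight addn2 pochS => <-.
  by rewrite [(2 * _.+1)%N]mulnC exprM [q ^+ p.+1]exprS; set u := q ^+ (_ + _); ring.
pattern r; apply: (@kernelX_cases 2%N) r => // [_|p|p].
- rewrite addNr expr0z subrr !mul0r big1 // => n _.
  by rewrite kerX2_N1 !mulr0.
- rewrite main (_ : p%:Z + 1 = p.+1); last by lia.
  rewrite (_ : tri p + p = ('C(p, 2) + 2 * p)%N) //.
  by rewrite /tri binS bin1; lia.
rewrite kerY_sym; transitivity (- q ^ (- (2 * p%:Z + 2)) *
   \sum_(n < N.+1) rq (N - n)%N * (half_weight 2 n * kerX 2 p n)).
  by rewrite mulr_sumr; apply: eq_bigr => n _; rewrite kerX_sym; ring.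
rewrite main !mulrA; congr (_ * _ * _).
rewrite (_ : - p%:Z - 2%N%:Z + 1 = - p.+1%:Z); last by lia.
rewrite (_ : tri _ + _ = - (2 * p%:Z + 2) + (p.+1%:Z + ('C(p, 2) + 2 * p)%N)); last first.
  have := triE (- p%:Z - 2%N%:Z); have := triE p.
  by rewrite {1}/tri binS bin1; nia.
rewrite !qzD.
have : q ^ (- p.+1%:Z) * q ^ p.+1%:Z = 1 by rewrite -qzD addNr.
rewrite -[q ^ p.+1%:Z]/(q ^+ p.+1) -[q ^ ('C(p, 2) + 2 * p)%N]/(q ^+ ('C(p, 2) + 2 * p)).
set x := q ^ (- p.+1%:Z); set y := q ^+ p.+1; set z := q ^ (- _).
set u := q ^+ (_ + _) => E.
congr (_ * _); transitivity ((y - x * y) * (z * u)); first by rewrite E; ring.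
by ring.
Qed.

End Eigenvalues.

(** * The five Bailey pairs *)

Section BilateralSums.
Variable F : fieldType.
Implicit Types (f g : int -> F) (W : nat).

(** Windows symmetric about 0 make s -> -s exact; a shift costs two boundary terms, which vanish for
    finite support or in the limit. *)
Definition bsum W f : F := f 0 + \sum_(t < W) (f t.+1%:Z + f (- t.+1%:Z)).

Lemma bsum0 f : bsum 0 f = f 0.
Proof. by rewrite /bsum big_ord0 addr0. Qed.

Lemma bsumS W f : bsum W.+1 f = bsum W f + (f W.+1%:Z + f (- W.+1%:Z)).
Proof. by rewrite /bsum big_ord_recr addrA. Qed.

Lemma eq_bsum W f g : f =1 g -> bsum W f = bsum W g.
Proof. by move=> fg; rewrite /bsum fg; congr (_ + _); apply: eq_bigr => t _; rewrite !fg. Qed.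

Lemma bsumD W f g : bsum W (fun s => f s + g s) = bsum W f + bsum W g.
Proof. by elim: W => [|W IH]; rewrite ?bsum0 ?bsumS // IH; ring. Qed.

Lemma bsumZ W c f : bsum W (fun s => c * f s) = c * bsum W f.
Proof. by elim: W => [|W IH]; rewrite ?bsum0 ?bsumS // IH; ring. Qed.

Lemma bsumN W f : bsum W (fun s => - f s) = - bsum W f.
Proof. by elim: W => [|W IH]; rewrite ?bsum0 ?bsumS // IH; ring. Qed.

Lemma bsumB W f g : bsum W (fun s => f s - g s) = bsum W f - bsum W g.
Proof. by rewrite bsumD bsumN. Qed.

Lemma bsum_opp W f : bsum W (fun s => f (- s)) = bsum W f.
Proof.
by elim: W => [|W IH]; rewrite ?bsum0 ?bsumS ?oppr0 // IH opprK [f (- _) + _]addrC.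
Qed.

Lemma bsum_shift W f :
  bsum W (fun s => f (s + 1)) = bsum W f + f W.+1%:Z - f (- W%:Z).
Proof.
elim: W => [|W IH]; first by rewrite !bsum0 oppr0 add0r; ring.
rewrite !bsumS IH.
rewrite (_ : - W.+1%:Z + 1 = - W%:Z); last by lia.
rewrite (_ : W.+1%:Z + 1 = W.+2); last by lia.
by ring.
Qed.

Definition has_zsum f (l : F) : Prop :=
  exists W, (forall s : int, (W%:Z < `|s|)%R -> f s = 0) /\ bsum W f = l.

Lemma bsum_widen W W' f : (W <= W')%N ->
  (forall s : int, (W%:Z < `|s|)%R -> f s = 0) -> bsum W' f = bsum W f.
Proof.
move=> /subnKC <- supp; elim: (W' - W)%N => [|d IH]; first by rewrite addn0.
by rewrite addnS bsumS IH !supp ?addr0 //; lia.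
Qed.

Lemma has_zsumP f l : has_zsum f l ->
  exists W, forall W', (W <= W')%N -> bsum W' f = l.
Proof. by case=> W [supp <-]; exists W => W' leW; apply: bsum_widen. Qed.

Lemma eq_has_zsum f g l : f =1 g -> has_zsum f l -> has_zsum g l.
Proof.
move=> fg [W [supp <-]]; exists W; split; last exact/esym/eq_bsum.
by move=> s /supp; rewrite fg.
Qed.

Lemma has_zsumD f g l m :
  has_zsum f l -> has_zsum g m -> has_zsum (fun s => f s + g s) (l + m).
Proof.
move=> [W [Wf Ef]] [V [Vg Eg]]; exists (maxn W V); split.
  by move=> s ls; rewrite Wf ?Vg ?addr0 //; lia.
rewrite bsumD -Ef -Eg; congr (_ + _); apply: bsum_widen => //.
  exact: leq_maxl.
exact: leq_maxr.
Qed.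

Lemma has_zsumZ c f l : has_zsum f l -> has_zsum (fun s => c * f s) (c * l).
Proof.
move=> [W [Wf <-]]; exists W; rewrite bsumZ; split=> // s /Wf ->.
by rewrite mulr0.
Qed.

Lemma has_zsumB f g l m :
  has_zsum f l -> has_zsum g m -> has_zsum (fun s => f s - g s) (l - m).
Proof.
move=> hf /(has_zsumZ (-1)) hg; rewrite -[- m]mulN1r.
by apply: eq_has_zsum (has_zsumD hf hg) => s; rewrite mulN1r.
Qed.

Lemma has_zsum_sum n (f : nat -> int -> F) (l : nat -> F) :
    (forall i, (i < n)%N -> has_zsum (f i) (l i)) ->
  has_zsum (fun s => \sum_(i < n) f i s) (\sum_(i < n) l i).
Proof.
elim: n => [|n IH] fl.
  exists 0%N; split; first by move=> s _; rewrite big_ord0.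
  by rewrite bsum0 !big_ord0.
rewrite big_ord_recr /=.
have := has_zsumD (IH (fun i h => fl i (ltnW h))) (fl n (ltnSn n)).
by apply: eq_has_zsum => s; rewrite big_ord_recr.
Qed.

End BilateralSums.

(** * q-Pascal recursions for sums over every third kernel *)

Section BaileyPairs.
Variables (F : fieldType) (q : F).
Hypotheses (q0 : q != 0) (q1 : forall n, q ^+ n.+1 != 1).
Local Notation poch := (pochhammer q).
Local Notation rq := (qfacV q).
Local Notation qzD := (exprzqD q0).
Local Notation qz_neq0 := (exprzq_neq0 q0).
Implicit Types (A B : int) (u v : int -> F).

(** At (A, B) = (n, n+e) this is u(s) times the kernel Y_r(n) at r = 3s; at (n-1, n+e+1) it is the
    one at r = 3s+1. *)
Definition Eterm A B u (s : int) : F := u s * (rq (A - 3 * s) * rq (B + 3 * s)).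
Definition Esum A B u : F := bsum (`|A| + `|B|)%N (Eterm A B u).

Lemma Eterm_supp A B u (s : int) :
  ((`|A| + `|B|)%N%:Z < `|s|)%R -> Eterm A B u s = 0.
Proof.
move=> lts; rewrite /Eterm; have [s_ge0|s_lt0] := leP 0 s.
  by rewrite rq_neg ?mul0r ?mulr0 //; lia.
by rewrite [rq (B + _)]rq_neg ?mulr0 //; lia.
Qed.

Lemma bsumE A B u W : (`|A| + `|B| <= W)%N -> bsum W (Eterm A B u) = Esum A B u.
Proof. by move=> leW; apply: bsum_widen leW _ => s; apply: Eterm_supp. Qed.

Lemma has_zsumE A B u : has_zsum (Eterm A B u) (Esum A B u).
Proof. by exists (`|A| + `|B|)%N; split=> // s; apply: Eterm_supp. Qed.

Lemma eq_Esum A B u v : u =1 v -> Esum A B u = Esum A B v.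
Proof. by move=> uv; apply: eq_bsum => s; rewrite /Eterm uv. Qed.

Lemma EsumZ A B c u : Esum A B (fun s => c * u s) = c * Esum A B u.
Proof. by rewrite /Esum -bsumZ; apply: eq_bsum => s; rewrite /Eterm -mulrA. Qed.

Lemma Esum_sym A B u : Esum A B u = Esum B A (fun s => u (- s)).
Proof.
rewrite /Esum [in RHS]addnC -[LHS]bsum_opp; apply: eq_bsum => s.
by rewrite /Eterm [rq _ * _]mulrC; congr (_ * (rq _ * rq _)); lia.
Qed.

Lemma Esum_shift A B u : Esum A B u = Esum (A - 3) (B + 3) (fun s => u (s + 1)).
Proof.
pose W := (`|A| + `|B| + `|(A - 3)%R| + `|(B + 3)%R|).+1%N.
rewrite -(@bsumE A B u W) -?(@bsumE (A - 3) (B + 3) _ W); try lia.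
have := bsum_shift W (Eterm A B u).
rewrite [Eterm _ _ _ W.+1%:Z]Eterm_supp ?[Eterm _ _ _ (- W%:Z)]Eterm_supp; try lia.
rewrite addr0 subr0 => <-; apply: eq_bsum => s.
by rewrite /Eterm; congr (_ * (rq _ * rq _)); lia.
Qed.

Lemma Esum_pascalr A B u : (1 - q ^ (A + B)) * Esum A B u =
  Esum (A - 1) B (fun s => u s * q ^ (B + 3 * s)) + Esum A (B - 1) u.
Proof.
pose W := (`|A| + `|B| + `|(A - 1)%R| + `|(B - 1)%R|).+1%N.
rewrite -(@bsumE A B u W) -?(@bsumE (A - 1) B _ W) -?(@bsumE A (B - 1) _ W); try lia.
rewrite -bsumD -bsumZ; apply: eq_bsum => s; rewrite /Eterm.
have := rq_pascalr q0 q1 (A - 3 * s) (B + 3 * s).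
rewrite (_ : A - 3 * s + (B + 3 * s) = A + B); last by lia.
rewrite (_ : A - 3 * s - 1 = A - 1 - 3 * s); last by lia.
rewrite (_ : B + 3 * s - 1 = B - 1 + 3 * s); last by lia.
by move=> E; rewrite mulrCA E; ring.
Qed.

Lemma Esum_pascall A B u : (1 - q ^ (A + B)) * Esum A B u =
  Esum (A - 1) B u + Esum A (B - 1) (fun s => u s * q ^ (A - 3 * s)).
Proof.
rewrite [Esum A B u]Esum_sym [A + B]addrC Esum_pascalr addrC.
rewrite [Esum B (A - 1) _]Esum_sym [Esum (B - 1) A _]Esum_sym.
by congr (_ + _); apply: eq_Esum => s; rewrite opprK // mulrN.
Qed.

(** By [kerXY], the sum of u(s) X_(3s)(n) relative to q^(e+1) has this form, with A = n, B = n+e and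
    v(s) = u(s) q^(6s+e+1). Keeping u and v independent lets the recursions pass through sums of
    other kinds. *)
Definition Vsum A B u v := Esum A B u - Esum (A - 1) (B + 1) v.

Lemma eq_Vsum A B u v u' v' : u =1 u' -> v =1 v' -> Vsum A B u v = Vsum A B u' v'.
Proof. by move=> uu vv; rewrite /Vsum (eq_Esum _ _ uu) (eq_Esum _ _ vv). Qed.

Lemma VsumZ A B c u v :
  Vsum A B (fun s => c * u s) (fun s => c * v s) = c * Vsum A B u v.
Proof. by rewrite /Vsum !EsumZ mulrBr. Qed.

Lemma Esum_flip A B u :
  Esum A B u = Esum (B - 3) (A + 3) (fun s => u (- 1 - s)).
Proof.
rewrite Esum_sym Esum_shift; apply: eq_Esum => s; congr u; lia.
Qed.

(** The suffix records the rules applied to the two sums, [b] for [Esum_pascalr] and [a] for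
    [Esum_pascall]. Each rule produces a sum at (A-1, B), and the hypothesis makes these cancel. The
    reflections s -> -s and s -> -1-s bring the rest back to the form [Vsum]. *)
Lemma Vsum_ba A B u v :
    (forall s, u s * q ^ (B + 3 * s) = v s * q ^ (A - 1 - 3 * s)) ->
  (1 - q ^ (A + B)) * Vsum A B u v
  = Vsum (B - 1) A (fun s => u (- s)) (fun s => v (- 1 - s)).
Proof.
move=> uv; rewrite /Vsum mulrBr Esum_pascalr.
rewrite (_ : A + B = (A - 1) + (B + 1)); last by lia.
rewrite Esum_pascall addrK (eq_Esum _ _ uv).
rewrite [Esum A (B - 1) u]Esum_sym [Esum (A - 1 - 1) _ _]Esum_flip.
rewrite (_ : B + 1 - 3 = B - 1 - 1) 1?(_ : A - 1 - 1 + 3 = A + 1); [|lia..].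
by ring.
Qed.

(** With the rules interchanged, the sums at (A-1, B) carry the bare coefficients, so they cancel
    when both coefficients are u. *)
Lemma Vsum_ab A B u : (1 - q ^ (A + B)) * Vsum A B u u
  = Vsum (B - 1) A (fun s => u (- s) * q ^ (A + 3 * s))
                   (fun s => u (- 1 - s) * q ^ (B - 2 - 3 * s)).
Proof.
rewrite /Vsum mulrBr Esum_pascall.
rewrite (_ : A + B = (A - 1) + (B + 1)); last by lia.
rewrite Esum_pascalr addrK.
rewrite [Esum A (B - 1) _]Esum_sym [Esum (A - 1 - 1) _ _]Esum_flip.
rewrite (_ : B + 1 - 3 = B - 1 - 1) 1?(_ : A - 1 - 1 + 3 = A + 1); [|lia..].
transitivity (Esum (B - 1) A (fun s => u (- s) * q ^ (A - 3 * - s)) -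
  Esum (B - 1 - 1) (A + 1) (fun s => u (-1 - s) * q ^ (B + 1 + 3 * (-1 - s)))).
  by ring.
by congr (_ - _); apply: eq_Esum => s; congr (_ * q ^ _); lia.
Qed.

(** Here the bare sums sit at (A, A-1) and (A-1, A) and cancel through s -> -s, which is why the two
    parameters coincide. *)
Lemma Vsum_bb A u v : (forall s, u (- s) = v s) ->
  (1 - q ^ (A + A)) * Vsum A A u v
  = Vsum (A - 1) A (fun s => u s * q ^ (A + 3 * s))
                   (fun s => v (- 1 - s) * q ^ (A - 2 - 3 * s)).
Proof.
move=> uv; rewrite /Vsum mulrBr Esum_pascalr.
rewrite (_ : A + A = (A - 1) + (A + 1)); last by lia.
rewrite Esum_pascalr addrK [Esum A (A - 1) _]Esum_sym (eq_Esum _ _ uv).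
rewrite [Esum (A - 1 - 1) _ _]Esum_flip.
rewrite (_ : A + 1 - 3 = A - 1 - 1) 1?(_ : A - 1 - 1 + 3 = A + 1); [|lia..].
transitivity (Esum (A - 1) A (fun s => u s * q ^ (A + 3 * s)) -
  Esum (A - 1 - 1) (A + 1) (fun s => v (-1 - s) * q ^ (A + 1 + 3 * (-1 - s)))).
  by ring.
by congr (_ - _); apply: eq_Esum => s; congr (_ * q ^ _); lia.
Qed.

Lemma Vsum0 u v : Vsum 0 0 u v = u 0.
Proof.
rewrite /Vsum [X in _ - X](_ : _ = 0).
  by rewrite /Esum bsum0 /Eterm mulr0 !subr0 ?addr0 !rq0 !mulr1.
transitivity (bsum (`|(0 - 1 : int)%R| + `|(0 + 1 : int)%R|)%N (fun s : int => 0 * v s)).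
  apply: eq_bsum => s; rewrite /Eterm mul0r; have [s_ge0|s_lt0] := leP 0 s.
    by rewrite rq_neg ?mul0r ?mulr0 //; lia.
  by rewrite [rq (0 + 1 + _)]rq_neg ?mulr0 //; lia.
by rewrite bsumZ mul0r.
Qed.

Lemma rq_div (n : nat) x y : (1 - q ^ n.+1%:Z) * x = y * rq n -> x = y * rq n.+1.
Proof.
have n1 : 1 - q ^ n.+1%:Z != 0 by rewrite subr_eq0 eq_sym q1.
have := rqS q0 q1 n.+1; rewrite (_ : n.+1%:Z - 1 = n) => [->|]; last by lia.
by rewrite mulrCA => /(mulfI n1).
Qed.

Lemma Vsum_even_step (n : nat) u v x y :
    (1 - q ^ (n.+1%:Z + n.+1%:Z)) * Vsum n.+1 n.+1 u v = x * (y * rq (2 * n + 1)%N) ->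
  Vsum n.+1 n.+1 u v = x * y * rq (2 * n.+1)%N.
Proof.
move=> E; rewrite (_ : 2 * n.+1 = (2 * n + 1).+1)%N; last by lia.
by apply: rq_div; rewrite -mulrA -E; congr ((1 - q ^ _) * _); lia.
Qed.

Lemma Vsum_odd_step (n : nat) u v x y :
    (1 - q ^ (n%:Z + (n%:Z + 1))) * Vsum n (n%:Z + 1) u v = x * (y * rq (2 * n)%N) ->
  Vsum n (n%:Z + 1) u v = x * y * rq (2 * n + 1)%N.
Proof.
move=> E; rewrite addn1; apply: rq_div; rewrite -mulrA -E.
by congr ((1 - q ^ _) * _); lia.
Qed.

Lemma Vsum_pred (n : nat) u v : Vsum (n.+1%:Z - 1) n.+1 u v = Vsum n (n%:Z + 1) u v.
Proof. by congr Vsum; lia. Qed.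

(** The sums for a = q and a = q^2 feed each other: [Vsum_ba] sends (n, n+1) to (n, n) and (n+1,
    n+1) to (n, n+1), each time clearing one factor of the q-factorial on the right. Hence one
    induction for both pairs. *)
Lemma pair12 (n : nat) :
  Vsum n n (fun s => q ^ (6 * s * s - s)) (fun s => q ^ (6 * s * s + 5 * s + 1))
    = rq (2 * n)%N /\
  Vsum n (n%:Z + 1) (fun s => q ^ (6 * s * s + s))
     (fun s => q ^ (6 * s * s + 7 * s + 2)) = rq (2 * n + 1)%N.
Proof.
have odd_of_even (m : nat) :
    Vsum m m (fun s => q ^ (6 * s * s - s)) (fun s => q ^ (6 * s * s + 5 * s + 1))
      = rq (2 * m)%N ->
    Vsum m (m%:Z + 1) (fun s => q ^ (6 * s * s + s))
     (fun s => q ^ (6 * s * s + 7 * s + 2)) = rq (2 * m + 1)%N.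
  move=> E; rewrite -[RHS]mul1r -[1 in RHS]mul1r; apply: Vsum_odd_step.
  rewrite !mul1r Vsum_ba => [|s]; last by rewrite -!qzD; congr (q ^ _); ring.
  by rewrite addrK -E; apply: eq_Vsum => s; congr (q ^ _); ring.
have odd_of n := odd_of_even n.
elim: n => [|n [_ IH]].
  have E0 := Vsum0 (fun s => q ^ (6 * s * s - s)) (fun s => q ^ (6 * s * s + 5 * s + 1)).
  by split; [|apply: odd_of]; rewrite E0 expr0z muln0 rq0.
suff E : Vsum n.+1 n.+1 (fun s => q ^ (6 * s * s - s))
    (fun s => q ^ (6 * s * s + 5 * s + 1)) = rq (2 * n.+1)%N.
  by split=> //; apply: odd_of.
rewrite -[RHS]mul1r -[1 in RHS]mul1r; apply: Vsum_even_step.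
rewrite !mul1r Vsum_ba => [|s]; last by rewrite -!qzD; congr (q ^ _); ring.
by rewrite Vsum_pred -IH; apply: eq_Vsum => s; congr (q ^ _); ring.
Qed.

(** Auxiliary families with equal coefficients, to which the third and fourth pairs reduce by a
    single use of [Vsum_ba]. The half steps contribute q^n and q^(n+1), which accumulate to q^(n^2)
    and q^(n^2+n). *)
Lemma pair56 (n : nat) :
  Vsum n n (fun s => q ^ (3 * s * s + s)) (fun s => q ^ (3 * s * s + s))
    = q ^ (n%:Z * n%:Z) * rq (2 * n)%N /\
  Vsum n (n%:Z + 1) (fun s => q ^ (3 * s * s + 2 * s))
     (fun s => q ^ (3 * s * s + 2 * s))
    = q ^ (n%:Z * n%:Z + n%:Z) * rq (2 * n + 1)%N.
Proof.
have odd_of_even (m : nat) :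
    Vsum m m (fun s => q ^ (3 * s * s + s)) (fun s => q ^ (3 * s * s + s))
      = q ^ (m%:Z * m%:Z) * rq (2 * m)%N ->
    Vsum m (m%:Z + 1) (fun s => q ^ (3 * s * s + 2 * s))
       (fun s => q ^ (3 * s * s + 2 * s))
      = q ^ (m%:Z * m%:Z + m%:Z) * rq (2 * m + 1)%N.
  move=> E; rewrite [_ * _ + m%:Z]addrC qzD; apply: Vsum_odd_step.
  rewrite Vsum_ab -E -VsumZ addrK.
  by apply: eq_Vsum => s; rewrite -!qzD; congr (q ^ _); ring.
elim: n => [|n [_ IH]].
  have E0 : Vsum 0 0 (fun s => q ^ (3 * s * s + s)) (fun s => q ^ (3 * s * s + s))
    = q ^ (0%N%:Z * 0%N%:Z) * rq (2 * 0)%N.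
    by rewrite Vsum0 muln0 rq0 !mulr0 addr0 mulr1.
  by split=> //; apply: odd_of_even.
suff E : Vsum n.+1 n.+1 (fun s => q ^ (3 * s * s + s)) (fun s => q ^ (3 * s * s + s))
    = q ^ (n.+1%:Z * n.+1%:Z) * rq (2 * n.+1)%N.
  by split=> //; apply: odd_of_even.
rewrite (_ : n.+1%:Z * n.+1%:Z = n.+1%:Z + (n%:Z * n%:Z + n%:Z)); last by lia.
rewrite qzD; apply: Vsum_even_step; rewrite Vsum_ab Vsum_pred -IH -VsumZ.
by apply: eq_Vsum => s; rewrite -!qzD; congr (q ^ _); ring.
Qed.

Lemma pair3 (n : nat) :
  Vsum n n (fun s => q ^ (3 * s * s - 2 * s)) (fun s => q ^ (3 * s * s + 4 * s + 1))
  = q ^ (n%:Z * n%:Z - n%:Z) * rq (2 * n)%N.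
Proof.
case: n => [|n]; first by rewrite Vsum0 muln0 rq0 !mulr0 subr0 mulr1.
rewrite -[q ^ _]mul1r; apply: Vsum_even_step.
rewrite Vsum_ba => [|s]; last by rewrite -!qzD; congr (q ^ _); ring.
rewrite Vsum_pred mul1r (_ : _ - _ = n%:Z * n%:Z + n%:Z); last by lia.
have [_ <-] := pair56 n.
by apply: eq_Vsum => s; congr (q ^ _); ring.
Qed.

Lemma pair4 (n : nat) :
  Vsum n (n%:Z + 1) (fun s => q ^ (3 * s * s - s)) (fun s => q ^ (3 * s * s + 5 * s + 2))
  = q ^ (n%:Z * n%:Z) * rq (2 * n + 1)%N.
Proof.
rewrite -[q ^ _ in RHS]mul1r; apply: Vsum_odd_step.
rewrite Vsum_ba => [|s]; last by rewrite -!qzD; congr (q ^ _); ring.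
rewrite addrK mul1r; have [<- _] := pair56 n.
by apply: eq_Vsum => s; congr (q ^ _); ring.
Qed.

(** The recursion does not close on the even and odd sums alone. A third sum [Gv], with q^tri(3s) as
    its second coefficient, also reduces to [Od], so that [Gv m] is q^m times [Ev m]; expanding [Od]
    gives Ev + q^m (Gv - Ev), whence the factor 1 - q^m + q^(2m). *)
Lemma pair5 (n : nat) :
  Vsum n n (fun s => q ^ tri (3 * s - 1)) (fun s => q ^ tri (3 * s + 1))
  = (\prod_(t < n) (1 - q ^+ t + q ^+ (2 * t))) * rq (2 * n)%N.
Proof.
pose c n : F := \prod_(t < n) (1 - q ^+ t + q ^+ (2 * t)).
pose Ev (n : nat) := Vsum n n (fun s => q ^ tri (3 * s - 1)) (fun s => q ^ tri (3 * s + 1)).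
pose Od (n : nat) := Vsum n (n%:Z + 1) (fun s => q ^ tri (3 * s)) (fun s => q ^ tri (3 * s + 1)).
pose Gv (n : nat) := Vsum n n (fun s => q ^ tri (3 * s - 1)) (fun s => q ^ tri (3 * s)).
have triN (r r' : int) : r + r' = - 1 -> tri r = tri r'.
  move=> E; have -> : r' = - 1 - r by lia.
  by apply: (@mulfI _ 2) => //; rewrite !triE; ring.
have triB (r r' x : int) : 2 * x = r * (r + 1) - r' * (r' + 1) -> tri r = tri r' + x.
  by move=> E; apply: (@mulfI _ 2) => //; rewrite mulrDr !triE E; ring.
have EvOd (m : nat) : (1 - q ^ (m.+1%:Z + m.+1%:Z)) * Ev m.+1 = Od m.
  rewrite Vsum_ba => [|s].
    by rewrite Vsum_pred; apply: eq_Vsum => s; congr (q ^ _); apply: triN; lia.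
  rewrite -!qzD; congr (q ^ _).
  by rewrite (@triB (3 * s + 1) (3 * s - 1) (6 * s + 1)); ring.
have GvOd (m : nat) : (1 - q ^ (m.+1%:Z + m.+1%:Z)) * Gv m.+1 = q ^ m.+1%:Z * Od m.
  rewrite Vsum_bb => [|s]; last by congr (q ^ _); apply: triN; lia.
  rewrite Vsum_pred -VsumZ; apply: eq_Vsum => s; rewrite -!qzD; congr (q ^ _).
    by rewrite (@triB (3 * s) (3 * s - 1) (3 * s)); ring.
  by rewrite (@triB (3 * (- 1 - s)) (3 * s + 1) (3 * s + 2)); ring.
have GvEv (m : nat) : Gv m = q ^+ m * Ev m.
  case: m => [|m]; first by rewrite /Gv /Ev !Vsum0 mul1r.
  apply: (@mulfI _ (1 - q ^ (m.+1%:Z + m.+1%:Z))).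
    by rewrite subr_eq0 eq_sym -exprnP q1.
  by rewrite GvOd mulrCA EvOd.
have OdEv (m : nat) :
    (1 - q ^ (m%:Z + (m%:Z + 1))) * Od m = (1 - q ^+ m + q ^+ (2 * m)) * Ev m.
  transitivity (Ev m + q ^+ m * (Gv m - Ev m)); last first.
    by rewrite GvEv mul2n -addnn exprD; ring.
  rewrite /Od /Vsum mulrBr Esum_pascalr addrK.
  rewrite (_ : m%:Z + (m%:Z + 1) = (m%:Z - 1) + (m%:Z + 1 + 1)); last by lia.
  rewrite Esum_pascall addrK [Esum m m _]Esum_sym [Esum (m%:Z - 1 - 1) _ _]Esum_flip.
  rewrite (_ : m%:Z + 1 + 1 - 3 = m%:Z - 1) 1?(_ : m%:Z - 1 - 1 + 3 = m%:Z + 1); [|lia..].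
  rewrite (@eq_Esum _ _ (fun s => q ^ tri (3 * s) * _)
    (fun s => q ^+ m * q ^ tri (3 * s + 1))) => [|s]; last first.
    rewrite exprnP -!qzD; congr (q ^ _).
    by rewrite (@triB (3 * s + 1) (3 * s) (3 * s + 1)); ring.
  rewrite (@eq_Esum _ _ (fun s => q ^ tri (3 * s + 1) * _)
    (fun s => q ^+ m * q ^ tri (3 * s))) => [|s]; last first.
    rewrite exprnP -!qzD; congr (q ^ _).
    by rewrite (@triB (3 * s + 1) (3 * s) (3 * s + 1)); ring.
  rewrite !EsumZ.
  rewrite (@eq_Esum _ _ (fun s => q ^ tri (3 * - s)) (fun s => q ^ tri (3 * s - 1))) => [|s];
    last by congr (q ^ _); apply: triN; lia.
  rewrite (@eq_Esum _ _ (fun s => q ^ tri (3 * (-1 - s) + 1))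
      (fun s => q ^ tri (3 * s + 1))) => [|s];
    last by congr (q ^ _); apply: triN; lia.
  by rewrite /Gv /Ev /Vsum; ring.
rewrite -/(Ev n) -/(c n); elim: n => [|n IH].
  by rewrite /Ev /c big_ord0 Vsum0 muln0 rq0 mulr1.
rewrite -[c _]mul1r; apply: Vsum_even_step; rewrite EvOd mul1r.
have -> : c n.+1 = (1 - q ^+ n + q ^+ (2 * n)) * c n by rewrite /c big_ord_recr mulrC.
by apply: Vsum_odd_step; rewrite OdEv IH.
Qed.

Lemma has_zsum_pair1 (n : nat) u v : (forall s, v s = u s * q ^ (6 * s + 1)) ->
  has_zsum (fun s => u s * bkerX q 1 (3 * s) n) (Vsum n n u v).
Proof.
move=> uv; apply: eq_has_zsum (has_zsumB (has_zsumE _ _ u) (has_zsumE _ _ v)) => s.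
rewrite kerXY // /Eterm /bkerY uv addr0 (_ : 2 * (3 * s) + 1%N%:Z = 6 * s + 1); last by lia.
rewrite (_ : n%:Z - (3 * s + 1) = n%:Z - 1 - 3 * s); last by lia.
rewrite (_ : n%:Z + (3 * s + 1) + 0 = n%:Z + 1 + 3 * s); last by lia.
by ring.
Qed.

Lemma has_zsum_pair2 (n : nat) u v : (forall s, v s = u s * q ^ (6 * s + 2)) ->
  has_zsum (fun s => u s * bkerX q 2 (3 * s) n) (Vsum n (n%:Z + 1) u v).
Proof.
move=> uv; apply: eq_has_zsum (has_zsumB (has_zsumE _ _ u) (has_zsumE _ _ v)) => s.
rewrite kerXY // /Eterm /bkerY uv (_ : 2 * (3 * s) + 2%N%:Z = 6 * s + 2); last by lia.
rewrite (_ : n%:Z - (3 * s + 1) = n%:Z - 1 - 3 * s); last by lia.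
rewrite (_ : n%:Z + 3 * s + 1%N%:Z = n%:Z + 1 + 3 * s); last by lia.
rewrite (_ : n%:Z + (3 * s + 1) + 1%N%:Z = n%:Z + 1 + 1 + 3 * s); last by lia.
by ring.
Qed.

End BaileyPairs.

(** * The finite quintuple product identity *)

Section FiniteQuintuple.
Variables (F : fieldType) (q : F).
Hypotheses (q0 : q != 0) (q1 : forall n, q ^+ n.+1 != 1).
Local Notation poch := (pochhammer q).
Local Notation rq := (qfacV q).
Local Notation qzD := (exprzqD q0).

(** Summand of the finite quintuple product identity, in which the terms (1 + z q^k) z^k q^(k^2)
    [n choose k]_q / (z^2 q^k)_(n+1) add up to 1/(z)_(n+1); both sides are divided by (q)_n. *)
Definition quint_term (z : F) (n k : nat) : F :=
  (1 + z * q ^+ k) * z ^+ k * q ^+ (k * k) * (rq k * rq (n%:Z - k%:Z))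
  / poch (z ^+ 2 * q ^+ k) n.+1.

(* The telescoping partner of [quint_term] in the WZ proof. *)
Definition quint_cert (z : F) (n k : nat) : F :=
  - (q ^ (n.+1%:Z - k%:Z) * z ^+ k * q ^+ (k * k)
     * (rq (k%:Z - 1) * rq (n.+1%:Z - k%:Z)) / poch (z ^+ 2 * q ^+ k) n.+1).

Lemma quint_telescope (z : F) (n k : nat) :
    1 - z ^+ 2 * q ^+ k != 0 -> 1 - z ^+ 2 * q ^+ (k + n.+1) != 0 ->
  (1 - q ^+ n.+1) * (1 - z * q ^+ n.+1) * quint_term z n.+1 k - quint_term z n k
  = quint_cert z n k.+1 - quint_cert z n k.
Proof.
move=> h1 h2; rewrite /quint_term /quint_cert.
set P := poch (z ^+ 2 * q ^+ k.+1) n.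
have zS : z ^+ 2 * q ^+ k * q = z ^+ 2 * q ^+ k.+1 by rewrite -mulrA -exprSr.
have P1 : poch (z ^+ 2 * q ^+ k) n.+1 = (1 - z ^+ 2 * q ^+ k) * P.
  by rewrite pochSl zS.
have P3 : poch (z ^+ 2 * q ^+ k.+1) n.+1 = P * (1 - z ^+ 2 * q ^+ (k + n.+1)).
  by rewrite pochS -mulrA -exprD addSnnS.
have P2 : poch (z ^+ 2 * q ^+ k) n.+2 =
    (1 - z ^+ 2 * q ^+ k) * (P * (1 - z ^+ 2 * q ^+ (k + n.+1))).
  by rewrite pochSl zS P3.
have := rqS q0 q1 (n.+1%:Z - k%:Z).
rewrite (_ : n.+1%:Z - k%:Z - 1 = n%:Z - k%:Z); last by lia.
rewrite (_ : n.+1%:Z - k.+1%:Z = n%:Z - k%:Z); last by lia.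
have := rqS q0 q1 k; rewrite -exprnP.
rewrite (_ : k.+1%:Z - 1 = k); last by lia.
move=> -> ->; rewrite P1 P2 P3 !invfM.
have -> : q ^+ (k.+1 * k.+1) = q ^+ (k * k) * q ^+ k * q ^+ k * q.
  by rewrite -!exprD -exprSr; congr (q ^+ _); lia.
have E1 : q ^+ n.+1 = q ^+ k * q ^ (n.+1%:Z - k%:Z).
  by rewrite (exprnP q n.+1) (exprnP q k) -qzD; congr (q ^ _); lia.
have E2 : q ^ (n.+1%:Z - k%:Z) = q ^ (n%:Z - k%:Z) * q.
  by rewrite -[X in _ * X]expr1z -qzD; congr (q ^ _); lia.
move: h2; rewrite exprD [z ^+ k.+1]exprSr E1 E2 => h2.
move: h1 h2 (P^-1) (rq k) (rq _) (q ^+ (k * k)) (z ^+ k).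
set K := q ^+ k; set U := q ^ _ => h1 h2 iP r1 r2 e w.
by field; rewrite h1 h2.
Qed.

(** Summing the telescoped relation yields (1 - q^(n+1)) (1 - z q^(n+1)) S_(n+1) = S_n, the
    recurrence of the right-hand side; both boundary certificates contain 1/(q)_(-1) = 0. *)
Lemma quint_finite (z : F) (n : nat) : (forall j, z ^+ 2 * q ^+ j != 1) ->
  \sum_(k < n.+1) quint_term z n k = rq n / poch z n.+1.
Proof.
move=> hz; have nz j : 1 - z ^+ 2 * q ^+ j != 0 by rewrite subr_eq0 eq_sym.
have nz1 j : 1 - z * q ^+ j != 0.
  apply: contra (nz (2 * j)%N); rewrite !subr_eq0 => /eqP E.
  by rewrite mul2n -addnn exprD expr2 mulrACA -E mulr1.
elim: n => [|n IH].
  rewrite big_ord_recl big_ord0 /quint_term subrr !rq0 !mulr1 addr0 !pochS !poch0.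
  rewrite !expr0 !mulr1 !mul1r /=.
  have := nz 0%N; have := nz1 0%N; rewrite expr0 !mulr1 => h1 h2.
  by field; rewrite h1.
apply: (@mulfI _ ((1 - q ^+ n.+1) * (1 - z * q ^+ n.+1))).
  by rewrite mulf_neq0 // subr_eq0 eq_sym q1.
transitivity (\sum_(k < n.+2) quint_term z n k).
  rewrite mulr_sumr; apply/eqP; rewrite -subr_eq0 -sumrB.
  under eq_bigr do rewrite quint_telescope //.
  rewrite -(big_mkord xpredT (fun k => quint_cert z n k.+1 - quint_cert z n k)).
  rewrite telescope_sumr // /quint_cert.
  rewrite [rq (n.+1%:Z - n.+2%:Z)]rq_neg ?[rq (0%N%:Z - 1)]rq_neg //; last by lia.
  by rewrite ?mul0r ?mulr0 ?mul0r subrr.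
rewrite big_ord_recr /= IH /quint_term [rq (n%:Z - n.+1%:Z)]rq_neg; last by lia.
rewrite !mulr0 mul0r addr0 [poch z n.+2]pochS invfM.
have := rqS q0 q1 n.+1; rewrite (_ : n.+1%:Z - 1 = n) => [->|]; last by lia.
rewrite -[q ^ n.+1]/(q ^+ n.+1); move: (nz1 n.+1) => h.
by move: (poch z n.+1)^-1 (rq _) => P r; field.
Qed.

Lemma poch_reverse (x : F) (j : nat) : x != 0 ->
  poch (x * q ^ (- j%:Z)) j = (- x) ^+ j * q ^ (- tri j) * poch (q / x) j.
Proof.
move=> x0; elim: j => [|j IH]; first by rewrite !poch0 expr0 !mul1r.
rewrite pochSl -mulrA -[X in q ^ _ * X]expr1z -qzD.
rewrite (_ : - j.+1%:Z + 1 = - j%:Z); last by lia.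
rewrite IH pochS exprSr (_ : - tri j.+1 = - tri j + - j.+1%:Z); last first.
  by rewrite /tri binS bin1; lia.
rewrite qzD.
have E : q ^ (- j.+1%:Z) * (q * q ^+ j) = 1.
  by rewrite -exprS exprnP -qzD addNr.
rewrite -[poch (q / x) j * _]mulrC.
move: ((- x) ^+ j) (q ^ (- tri j)) (poch (q / x) j) => a b c.
transitivity (a * b * c * (q ^ (- j.+1%:Z) * (q * q ^+ j) - x * q ^ (- j.+1%:Z))).
  by rewrite E; ring.
by field.
Qed.

(** [quint_term] at n = 2m and k = m+s with z replaced by -z q^(-m), up to a factor free of s. The
    substitution centres the sum, so that it becomes bilateral as m grows. *)
Definition quint_sterm (z : F) (m : nat) (s : int) : F :=
  (1 - z * q ^ s) * z ^ (3 * s) * q ^ (3 * tri s - 2 * s)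
  * (rq (m%:Z + s) * rq (m%:Z - s))
  / (poch (q / z ^+ 2) `|(m%:Z - s)%R|%N * poch (z ^+ 2) `|(m%:Z + s + 1)%R|%N).

Lemma bsum_ord (f : int -> F) (m : nat) :
  bsum m f = \sum_(k < (2 * m).+1) f (k%:Z - m%:Z).
Proof.
elim: m f => [|m IH] f; first by rewrite bsum0 big_ord_recl big_ord0 subr0 addr0.
rewrite bsumS IH mulnS add2n [RHS]big_ord_recl [X in _ = _ + X]big_ord_recr /=.
rewrite addrA addrC; congr (f _ + (_ + f _)); rewrite /bump /=; [lia| |lia].
by apply: eq_bigr => i _; congr f; lia.
Qed.

Lemma quint_sfinite (z : F) (m : nat) : z != 0 ->
    (forall j : int, z ^+ 2 * q ^ j != 1) ->
  bsum m (quint_sterm z m) =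
    rq (2 * m)%N / (poch (- (q / z)) m * poch (- z) m.+1).
Proof.
move=> z0 hz; pose x := - (z * q ^ (- m%:Z)).
have xsq j : x ^+ 2 * q ^ j = z ^+ 2 * q ^ (j - 2 * m%:Z).
  rewrite /x sqrrN expr2 (_ : j - 2 * m%:Z = - m%:Z + - m%:Z + j); last by lia.
  by rewrite !qzD; ring.
have hx j : x ^+ 2 * q ^+ j != 1 by rewrite (exprnP q) xsq.
have qz_neq0 := exprzq_neq0 q0.
have pz j n : poch (z ^+ 2 * q ^ j) n != 0.
  rewrite /pochhammer; apply/prodf_neq0 => t _.
  by rewrite subr_eq0 eq_sym (exprnP q) -mulrA -qzD.
have mz0 : - z ^+ 2 != 0 by rewrite oppr_eq0 expf_neq0.
have pqz n : poch (q / z ^+ 2) n != 0.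
  have := pz (- n%:Z) n; rewrite poch_reverse ?expf_neq0 // mulf_eq0.
  by rewrite negb_or => /andP[].
(* The factor free of s is what reversing the first m factors of (x)_(2m+1) leaves over. *)
rewrite bsum_ord; apply: (@mulfI _ (z ^+ m * q ^ (- tri m))^-1).
  by rewrite invr_eq0 mulf_neq0 ?expf_neq0.
have := @quint_finite x (2 * m) hx; rewrite mulr_sumr.
have -> : poch x (2 * m).+1 =
    z ^+ m * q ^ (- tri m) * (poch (- (q / z)) m * poch (- z) m.+1).
  rewrite /x -mulNr (_ : (2 * m).+1 = m + m.+1)%N; last by lia.
  have Ez : - z * q ^ (- m%:Z) * q ^+ m = - z.
    by rewrite (exprnP q) -mulrA -qzD addNr expr0z mulr1.
  by rewrite pochD Ez poch_reverse ?oppr_eq0 // opprK invrN mulrN mulrA.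
rewrite invfM mulrCA => <-; apply: eq_bigr => k _.
have lek : (k <= 2 * m)%N by rewrite -ltnS.
move: (nat_of_ord k) lek => {}k lek.
pose j := (2 * m - k)%N; rewrite /quint_term /quint_sterm.
rewrite (_ : m%:Z + (k%:Z - m%:Z) = k); last by lia.
rewrite (_ : m%:Z - (k%:Z - m%:Z) = (2 * m)%N%:Z - k%:Z); last by lia.
rewrite (_ : `|((2 * m)%N%:Z - k%:Z)%R|%N = j); last by rewrite /j; lia.
rewrite (_ : `|(k%:Z + 1)%R|%N = k.+1); last by lia.
have -> : 1 + x * q ^+ k = 1 - z * q ^ (k%:Z - m%:Z).
  rewrite /x (exprnP q k) mulNr -mulrA -qzD; congr (1 - _ * q ^ _); lia.
have -> : poch (x ^+ 2 * q ^+ k) (2 * m).+1 = (- z ^+ 2) ^+ j * q ^ (- tri j) *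
    poch (q / z ^+ 2) j * poch (z ^+ 2) k.+1.
  rewrite (exprnP q k) xsq (_ : (2 * m).+1 = j + k.+1)%N; last by rewrite /j; lia.
  rewrite (_ : k%:Z - _ = - j%:Z) ?pochD ?poch_reverse ?expf_neq0 //; last by rewrite /j; lia.
  congr (_ * poch _ _); rewrite (exprnP q j) -mulrA -qzD addNr; exact: mulr1.
have Ex : x ^+ k = (-1) ^+ k * z ^+ k * q ^ (- (m%:Z * k%:Z)).
  rewrite /x -[- (_ * _)]mulN1r !exprMn mulrA; congr (_ * _).
  by rewrite exprnP exprz_exp mulNr.
have Ej : (- z ^+ 2) ^+ j = (-1) ^+ k * z ^ (2 * j%:Z).
  rewrite -[- (_ ^+ _)]mulN1r exprMn -exprM [z ^+ _]exprnP PoszM; congr (_ * _).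
  rewrite -[LHS]signr_odd -[RHS]signr_odd (_ : odd j = odd k) //.
  by rewrite /j oddB // mul2n odd_double.
have key : z ^ (3 * (k%:Z - m%:Z)) * q ^ (3 * tri (k%:Z - m%:Z) - 2 * (k%:Z - m%:Z))
    * (z ^ (2 * j%:Z) * q ^ (- tri j)) =
    z ^+ m * q ^ (- tri m) * (z ^+ k * q ^ (- (m%:Z * k%:Z))) * q ^+ (k * k).
  transitivity (z ^ (m%:Z + k%:Z) * q ^ (- tri m - m%:Z * k%:Z + (k * k)%N%:Z)).
    rewrite mulrACA -qzD -expfzDr //; congr (_ ^ _ * _ ^ _).
      by rewrite /j; lia.
    apply: (@mulfI _ 2) => //.
    have -> : j%:Z = 2 * m%:Z - k%:Z by rewrite /j; lia.
    have := triE (k%:Z - m%:Z); have := triE m; have := triE (2 * m%:Z - k%:Z).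
    by nia.
  by rewrite !qzD (expfzDr _ _ z0) -!exprnP; set y := q ^+ _; ring.
have zz i : z ^+ i != 0 by rewrite expf_neq0.
have zi i : z ^ i != 0 by rewrite expfz_neq0.
have qq i : q ^+ i != 0 by rewrite expf_neq0.
have s0 : (-1) ^+ k != 0 :> F by rewrite signr_eq0.
have pz' : poch (z ^+ 2) k.+1 != 0 by have := pz 0 k.+1; rewrite expr0z mulr1.
rewrite Ex Ej; move: (1 - z * q ^ (k%:Z - m%:Z)) (rq k * _) => A R.
move: (poch _ _) (poch _ _) (pqz j) pz' => D E D0 E0.
move: (z ^+ m) (z ^+ k) (z ^ (2 * j%:Z)) (zz m) (zz k) (zi (2 * j%:Z)) key.
move=> x1 x2 x3 x1_0 x2_0 x3_0.
move: (q ^ (- tri m)) (q ^ (- (m%:Z * k%:Z))) (q ^ (- tri j)) (q ^+ (k * k))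
  (qz_neq0 (- tri m)) (qz_neq0 (- tri j)) => y1 y2 y3 y4 y1_0 y3_0.
rewrite -[A * _ * _]mulrA; move: (_ * q ^ _) ((-1) ^+ k) s0 => B s s0 key.
have -> : B = x1 * y1 * (x2 * y2) * y4 / (x3 * y3).
  by rewrite -key mulfK // mulf_neq0.
by field; rewrite E0 D0 s0 x3_0 y3_0 x1_0 y1_0.
Qed.
End FiniteQuintuple.

(** * Even and odd factors of q-shifted factorials *)

Section Dissection.
Variables (F : fieldType) (q z : F).

(** The factors of even index split as (1 - z q^t)(1 + z q^t); in [poch_dissect2] those of odd index
    do. The unsplit factors become the two products to the base q^2 in the quintuple product. *)
Lemma poch_dissect1 n : pochhammer q (z ^+ 2) (2 * n) =
  pochhammer q z n * pochhammer q (- z) n * pochhammer (q ^+ 2) (q * z ^+ 2) n.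
Proof.
elim: n => [|n IH]; first by rewrite muln0 !poch0 !mulr1.
rewrite mulnS add2n !pochS IH [q ^+ (2 * n).+1]exprS.
by rewrite -exprM [(2 * n)%N]mulnC exprM; ring.
Qed.

Lemma poch_dissect2 v n : v * q = z ^+ 2 -> pochhammer q v (2 * n) =
  pochhammer (q ^+ 2) v n * (pochhammer q z n * pochhammer q (- z) n).
Proof.
move=> vz; elim: n => [|n IH]; first by rewrite muln0 !poch0 !mulr1.
rewrite mulnS add2n !pochS IH [q ^+ (2 * n).+1]exprS [v * (q * _)]mulrA vz.
by rewrite -exprM [(2 * n)%N]mulnC exprM; ring.
Qed.
End Dissection.

Lemma frac_quint1 (F : fieldType) (p A B l : F) : p != 0 -> A != 0 -> B != 0 ->
  p * p * (A * B) * (l * (p^-1 * p^-1) / (A * B)) = l.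
Proof. by move=> h1 h2 h3; field; rewrite h1 h2 h3. Qed.

Lemma frac_quint2 (F : fieldType) (p zz mz qz mqz d1 d2 : F) :
  p != 0 -> mz != 0 -> mqz != 0 ->
  p * p * ((d2 * (qz * mqz)) * (zz * mz * d1)) * (p^-1 / (mqz * mz)) =
  zz * qz * p * (d2 * d1).
Proof. by move=> h1 h2 h3; field; rewrite h1 h2 h3. Qed.

(** * Iterated Bailey steps *)

Section Nest.
Variable F : fieldType.
Implicit Types (w K : nat -> nat -> F) (h g : nat -> F).

(** [w r] is attached to the r-th index, [K r] to its difference with the next one, and h to the
    innermost index. The dependence on r is needed because the multisums change base, and for i > k
    also direction, at depth i. *)
Fixpoint nest (m : nat) w K h (n : nat) : F :=
  if m is m'.+1 then
    w 1%N n * \sum_(x < n.+1) K 1%N (n - x)%N *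
      nest m' (fun r => w r.+1) (fun r => K r.+1) h x
  else h n.

Lemma eq_nest m w w' K K' h h' n :
    (forall r x, (0 < r <= m)%N -> w r x = w' r x) ->
    (forall r x, (0 < r <= m)%N -> K r x = K' r x) ->
    h =1 h' -> nest m w K h n = nest m w' K' h' n.
Proof.
elim: m w w' K K' n => [|m IH] w w' K K' n ww KK hh //=.
rewrite ww //; congr (_ * _); apply: eq_bigr => x _; rewrite KK //; congr (_ * _).
by apply: IH => // r y /andP[r0 rm]; [apply: ww|apply: KK].
Qed.

Lemma nest_cat m1 m2 w K h n : nest (m1 + m2) w K h n =
  nest m1 w K (nest m2 (fun r => w (m1 + r)%N) (fun r => K (m1 + r)%N) h) n.
Proof.
elim: m1 w K n => [|m1 IH] w K n //=.
by congr (_ * _); apply: eq_bigr => x _; rewrite IH.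
Qed.

Lemma nest_eigen (w K h : nat -> F) (lam : F) m n :
    (forall n, w n * \sum_(x < n.+1) K (n - x)%N * h x = lam * h n) ->
  nest m (fun=> w) (fun=> K) h n = lam ^+ m * h n.
Proof.
move=> eig; elim: m n => [|m IH] n /=; first by rewrite mul1r.
under eq_bigr do rewrite IH mulrCA.
by rewrite -mulr_sumr mulrCA eig exprSr mulrA.
Qed.

(** The innermost weight is absorbed in the eigenvector, so only the outermost weight w' is foreign
    to the steps and survives. For m = 0 outermost and innermost index coincide, which explains the
    conditional in the last argument. *)
Lemma nest_switch (w w' K g : nat -> F) (lam : F) m n :
    (forall n, \sum_(x < n.+1) K (n - x)%N * (w x * g x) = lam * g n) ->
  nest m (fun r => if (r <= 1)%N then w' else w) (fun=> K)
    (fun x => (if m == 0%N then w' else w) x * g x) n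
  = lam ^+ m * (w' n * g n).
Proof.
move=> eig; case: m => [|m] /=; first by rewrite mul1r.
rewrite (_ : \sum_(x < n.+1) _ = lam ^+ m * (lam * g n)).
  by rewrite exprSr; ring.
rewrite -eig mulr_sumr; apply: eq_bigr => x _; rewrite mulrCA; congr (_ * _).
rewrite -(@nest_eigen w K (fun x => w x * g x)) => [|k]; last by rewrite eig mulrCA.
by apply: eq_nest => // r y /andP[r0 _]; rewrite ltnNge r0.
Qed.

Lemma nestZ m w K c h n : nest m w K (fun x => c * h x) n = c * nest m w K h n.
Proof.
elim: m w K n => [|m IH] w K n //=.
by under eq_bigr do rewrite IH mulrCA; rewrite -mulr_sumr mulrCA.
Qed.

Lemma nestB m w K h g n : nest m w K (fun x => h x - g x) n =
  nest m w K h n - nest m w K g n.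
Proof.
elim: m w K n => [|m IH] w K n //=.
by under eq_bigr do rewrite IH mulrBr; rewrite sumrB mulrBr.
Qed.

Lemma nest_zsum m w K (hs : int -> nat -> F) h n :
    (forall x, has_zsum (hs^~ x) (h x)) ->
  has_zsum (fun s => nest m w K (hs s) n) (nest m w K h n).
Proof.
move=> hh; elim: m w K n => [|m IH] w K n /=; first exact: hh.
apply: has_zsumZ.
apply: (@has_zsum_sum _ n.+1 (fun x s => K 1%N (n - x)%N *
  nest m (fun r => w r.+1) (fun r => K r.+1) (hs s) x)
  (fun x => K 1%N (n - x)%N * nest m (fun r => w r.+1) (fun r => K r.+1) h x)).
by move=> x _; apply: has_zsumZ.
Qed.
End Nest.

(** Exponent attached to the r-th index when a = q^e: for r <= i the extra -x turns the weight of
    base a into that of base a/q. *)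
Definition exS (e i r x : nat) : int :=
  x%:Z * x%:Z + e%:Z * x%:Z - (if (r <= i)%N then x%:Z else 0).

(** For i > k: weights of base a/q before depth i, inverted weights of base a after it, none at the
    innermost depth m. At depth i only q^(-x) remains, the quotient of the weights of bases a/q and
    a. *)
Definition exB (e i m r x : nat) : int :=
  (if (r < i)%N then x%:Z * x%:Z + e%:Z * x%:Z else 0)
  - (if (i < r < m)%N then x%:Z * x%:Z + e%:Z * x%:Z else 0)
  - (if (r <= i)%N then x%:Z else 0).
Definition exKB (i r d : nat) : int := if (i <= r)%N then 'C(d, 2)%:Z else 0.
Definition sgB (F : fieldType) (i m r x : nat) : F :=
  if (r == i) || (r == m) then (-1) ^+ x else 1.

Section NestKernels.
Variables (F : fieldType) (q : F).
Hypotheses (q0 : q != 0) (q1 : forall n, q ^+ n.+1 != 1).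
Local Notation qzD := (exprzqD q0).
Local Notation rq := (qfacV q).
Local Notation kerX := (bkerX q).
Local Notation kerY := (bkerY q).

Definition std_weight (e x : nat) : F := q ^ (x%:Z * x%:Z + e%:Z * x%:Z).

Lemma qz_pow (z : int) (n : nat) : (q ^ z) ^+ n = q ^ (n%:Z * z).
Proof. by rewrite exprnP exprz_exp mulrC. Qed.

Lemma wf_kerX e r n : (e <= 2)%N ->
  \sum_(x < n.+1) rq (n - x)%N * (std_weight e x * kerX e r x)
  = q ^ (r * r + e%:Z * r) * kerX e r n.
Proof. exact: kerX_sum. Qed.

Lemma wf_kerY e r n : (e <= 1)%N ->
  \sum_(x < n.+1) rq (n - x)%N * (std_weight e x * kerY e r x)
  = q ^ (r * r + e%:Z * r) * kerY e r n.
Proof. exact: kerY_sum. Qed.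

Lemma nest_exS0 e r k n : (e <= 2)%N ->
  nest k (fun r x => q ^ exS e 0 r x) (fun=> rq \o Posz)
    (fun x => q ^ exS e 0 k.+1 x * kerX e r x) n
  = q ^ (k%:Z * (r * r + e%:Z * r)) * (std_weight e n * kerX e r n).
Proof.
move=> le2; rewrite -qz_pow.
rewrite -(@nest_eigen _ (std_weight e) (rq \o Posz) (fun x => std_weight e x * kerX e r x)).
  apply: eq_nest => // [s x /andP[s0 _]|x]; last by rewrite /exS subr0.
  by rewrite /exS leqNgt s0 subr0.
by move=> m; rewrite wf_kerX // mulrCA.
Qed.

(** Here k+1 and i+1 are the parameters of the multisum. The inner k - i steps have base a and give
    a power of the eigenvalue; the rest has base a/q. The result has the same shape as in
    [nest_exB], where the power is negative. *)
Lemma nest_exS e r k i n : (e <= 1)%N -> (i <= k)%N ->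
  nest k (fun r x => q ^ exS e.+1 i.+1 r x) (fun=> rq \o Posz)
    (fun x => q ^ exS e.+1 i.+1 k.+1 x * kerX e.+1 r x) n
  = q ^ ((k.+1%:Z - i.+1%:Z) * (r * r + e.+1%:Z * r)) *
    nest i (fun=> std_weight e) (fun=> rq \o Posz) (fun x => std_weight e x * kerX e.+1 r x) n.
Proof.
move=> le1 leik; rewrite -nestZ -{1}(subnKC leik) nest_cat.
have ex1 s x : (s <= i.+1)%N -> q ^ exS e.+1 i.+1 s x = std_weight e x.
  by move=> h; rewrite /exS h /std_weight; congr (q ^ _); lia.
have ex2 s x : (i.+1 < s)%N -> q ^ exS e.+1 i.+1 s x = std_weight e.+1 x.
  by rewrite ltnNge /exS => /negPf->; rewrite subr0.
apply: eq_nest => // [s x /andP[_ si]|x]; first by rewrite ex1 // ltnW.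
rewrite (_ : k.+1%:Z - i.+1%:Z = (k - i)%N); last by lia.
rewrite -qz_pow -(@nest_switch _ (std_weight e.+1) (std_weight e) (rq \o Posz) (kerX e.+1 r)).
  apply: eq_nest => // [s y /andP[s0 _]|y]; first case: leqP => h.
  - by rewrite ex1 //; lia.
  - by rewrite ex2 //; lia.
  case: eqP => h; first by rewrite ex1 //; lia.
  by rewrite ex2 //; lia.
by move=> m; rewrite /= wf_kerX.
Qed.

Lemma nest_exB e r k i n : (e <= 1)%N -> (k < i.+1)%N ->
  let m := (2 * i.+1 - k)%N in
  nest m.-1 (fun r x => sgB F i.+1 m r x * q ^ exB e.+1 i.+1 m r x)
    (fun r d => q ^ exKB i.+1 r d * rq d)
    (fun x => sgB F i.+1 m m x * q ^ exB e.+1 i.+1 m m x * kerX e.+1 r x) n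
  = q ^ ((k%:Z - i.+1%:Z) * (r * r + e.+1%:Z * r)) *
    nest i (fun=> std_weight e) (fun=> rq \o Posz) (fun x => std_weight e x * kerX e.+1 r x) n.
Proof.
move=> le1 ltki m; rewrite -nestZ.
rewrite (_ : m.-1 = i + (i.+1 - k))%N ?nest_cat; last by rewrite /m; lia.
have sg1 s x : s <> i.+1 -> s <> m -> sgB F i.+1 m s x = 1.
  by rewrite /sgB => /eqP/negPf-> /eqP/negPf->.
have im : (i.+1 < m)%N by rewrite /m; lia.
apply: eq_nest => [s x /andP[_ si]|s x /andP[_ si]|x].
- rewrite sg1 ?mul1r; try by lia.
  rewrite /exB /std_weight; congr (q ^ _).
  rewrite (_ : (s < i.+1)%N) 1?(_ : (i.+1 < s < m)%N = false) 1?(_ : (s <= i.+1)%N); lia.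
- by rewrite /exKB leqNgt ltnS si /= mul1r.
(* g is the eigenvector of the inverse step: v g = (-1)^y X_r is what the innermost depth supplies,
   and at the depth of the switch (-1)^y q^(-y) turns g into the weight of base a/q times X_r. *)
pose g (y : nat) := (-1) ^+ y * (std_weight e.+1 y * kerX e.+1 r y).
pose v (y : nat) : F := q ^ (- (y%:Z * y%:Z + e.+1%:Z * y%:Z)).
pose lam := q ^ (r * r + e.+1%:Z * r).
have vg y : v y * g y = (-1) ^+ y * kerX e.+1 r y.
  rewrite /v /g /std_weight mulrCA; congr (_ * _).
  by rewrite mulrA -qzD addNr expr0z mul1r.
transitivity (lam^-1 ^+ (i.+1 - k) * ((-1) ^+ x * q ^ (- x%:Z) * g x)).
  rewrite -(@nest_switch _ v (fun x => (-1) ^+ x * q ^ (- x%:Z))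
    (fun d => q ^+ 'C(d, 2) * rq d) g lam^-1).
    apply: eq_nest => [s y /andP[s0 si]|s y /andP[s0 si]|y].
    + rewrite /exB; case: (leqP s 1) => h.
        have -> : (i + s = i.+1)%N by lia.
        by rewrite /sgB eqxx orTb ltnn leqnn andFb subr0 sub0r.
      rewrite sg1 ?mul1r; try by lia.
      rewrite (_ : (i + s < i.+1)%N = false); last by lia.
      rewrite (_ : i.+1 < i + s < m)%N; last by rewrite /m; lia.
      rewrite (_ : (i + s <= i.+1)%N = false); last by lia.
      by rewrite subr0 sub0r.
    + by rewrite /exKB (_ : i < i + s)%N //; lia.
    rewrite (_ : (i.+1 - k == 0)%N = false); last by lia.
    rewrite vg /sgB eqxx orbT /exB ltnn andbF.
    rewrite (_ : (m < i.+1)%N = false); last by lia.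
    rewrite (_ : (m <= i.+1)%N = false); last by lia.
    by rewrite !subr0 expr0z mulr1.
  move=> N.
  under eq_bigr do rewrite vg.
  apply: (@inverse_eigen _ q q0 q1 (std_weight e.+1) (kerX e.+1 r) lam) => [|M].
    by rewrite expfz_neq0.
  exact: wf_kerX.
rewrite /lam invr_expz qz_pow /g; congr (q ^ _ * _); first by lia.
rewrite mulrACA -expr2 sqrr_sign mul1r mulrA /std_weight -qzD; congr (q ^ _ * _); lia.
Qed.

(** The base change gives one factor q^(2r+e+1), and each of the i steps gives another as the
    quotient of the eigenvalues at r+1 and r: hence i+1. *)
Lemma nest_wf_kerX e r i n c : (e <= 1)%N ->
  q ^ c * nest i (fun=> std_weight e) (fun=> rq \o Posz) (fun x => std_weight e x * kerX e.+1 r x) n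
  = q ^ (c + i%:Z * (r * r + e%:Z * r)) * (std_weight e n * kerY e r n)
  - q ^ (c + i%:Z * (r * r + e%:Z * r) + i.+1%:Z * (2 * r + e.+1%:Z))
      * (std_weight e n * kerY e (r + 1) n).
Proof.
move=> le1.
rewrite (@eq_nest _ i _ (fun=> std_weight e) _ (fun=> rq \o Posz) _
  (fun x => std_weight e x * kerY e r x -
     q ^ (2 * r + e.+1%:Z) * (std_weight e x * kerY e (r + 1) x))) // => [|x]; last first.
  by rewrite kerXY // mulrBr; congr (_ - _); rewrite mulrCA.
have eig s : nest i (fun=> std_weight e) (fun=> rq \o Posz) (fun x => std_weight e x * kerY e s x) n
    = q ^ (i%:Z * (s * s + e%:Z * s)) * (std_weight e n * kerY e s n).
  rewrite -qz_pow; apply: (@nest_eigen _ (std_weight e) (rq \o Posz)) => m.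
  by rewrite wf_kerY // mulrCA.
rewrite nestB nestZ !eig mulrBr !mulrA -!qzD.
by congr (_ - q ^ _ * _ * _); ring.
Qed.
End NestKernels.

(** * The q-adic topology *)

Local Notation "f %:L" := (FracField.tofrac f) (at level 2, format "f %:L").
Local Notation fX := (fps_of_poly 'X).

Lemma fps_dvdX (n : nat) (f : fps) : (forall i, (i < n)%N -> fps_coef f i = 0) ->
  exists g, f = fX ^+ n * g.
Proof.
move=> f0; exists (Fps (fun i => fps_coef f (i + n)%N)).
apply: fpsP => i; rewrite coef_fpsXM; case: ltnP => [/f0 //|leni] /=.
by rewrite subnK.
Qed.

Lemma fps_eq0 (f : fps) : (forall n, exists g, f = fX ^+ n * g) -> f = 0.
Proof.
move=> fd; apply: fpsP => n; have [g ->] := fd n.+1.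
by rewrite coef_fpsXM ltnSn /= coef0.
Qed.

Lemma fps_complete (u : nat -> fps) :
    (forall n, exists g, u n.+1 - u n = fX ^+ n * g) ->
  exists l, forall n, exists g, l - u n = fX ^+ n * g.
Proof.
move=> du; pose l := Fps (fun i => fps_coef (u i.+1) i); exists l => n.
apply: fps_dvdX => i ltin.
have stable m : fps_coef (u (m + i.+1)%N) i = fps_coef (u i.+1) i.
  elim: m => // m IH; rewrite addSn -[u _.+1](subrK (u (m + i.+1)%N)) fps_coefD IH.
  have [g ->] := du (m + i.+1)%N.
  by rewrite coef_fpsXM (leq_trans (ltnSn i)) ?leq_addl // add0r.
by rewrite fps_coefD /= -(stable (n - i.+1)%N) subnK // subrr.
Qed.

Lemma fps_geometric (f : fps) : exists h, (1 - fX * f) * h = 1.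
Proof.
have [n|l ul] := @fps_complete (fun n => \sum_(m < n) (fX * f) ^+ m).
  by rewrite big_ord_recr /= addrC addrK exprMn; exists (f ^+ n).
exists l; apply/eqP; rewrite -subr_eq0; apply/eqP; apply: fps_eq0 => n.
have [g E] := ul n; exists ((1 - fX * f) * g - f ^+ n).
have G : 1 - (fX * f) ^+ n = (1 - fX * f) * \sum_(m < n) (fX * f) ^+ m.
  by rewrite -[1 in LHS](expr1n _ n) subrXX; congr (_ * _); apply: eq_bigr => i _;
     rewrite expr1n mul1r.
rewrite mulrBr mulrCA -E mulrBr -G exprMn; ring.
Qed.

Lemma q_neq0 : q != 0.
Proof.
rewrite tofrac_eq0; apply/eqP => /(congr1 (fun f => fps_coef f 1)) /=.
by rewrite coefX coef0 => /eqP; rewrite oner_eq0.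
Qed.

Lemma qXn n : q ^+ n = (fX ^+ n)%:L.
Proof. by rewrite tofracXn. Qed.

Lemma q_order n : q ^+ n.+1 != 1.
Proof.
rewrite qXn -tofrac1 tofrac_eq.
apply/eqP => /(congr1 (fun f => fps_coef f 0)).
rewrite -[X in fps_coef X 0]mulr1 coef_fpsXM /= coef1 => /eqP.
by rewrite eq_sym oner_eq0.
Qed.

Local Notation qzD := (exprzqD q_neq0).
Local Notation qz_neq0 := (exprzq_neq0 q_neq0).

(** The q-adic valuation is at least M; M may be negative. *)
Definition vge (M : int) (x : laurent) : Prop := exists f : fps, x = q ^ M * f%:L.

Lemma vge_fps f : vge 0 f%:L.
Proof. by exists f; rewrite expr0z mul1r. Qed.

Lemma vge0 M : vge M 0.
Proof. by exists 0; rewrite tofrac0 mulr0. Qed.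

Lemma vge1 : vge 0 1.
Proof. by rewrite -tofrac1; apply: vge_fps. Qed.

Lemma vge_q M : vge M (q ^ M).
Proof. by exists 1; rewrite tofrac1 mulr1. Qed.

Lemma vgeD M x y : vge M x -> vge M y -> vge M (x + y).
Proof. by move=> [f ->] [g ->]; exists (f + g); rewrite tofracD mulrDr. Qed.

Lemma vgeN M x : vge M x -> vge M (- x).
Proof. by move=> [f ->]; exists (- f); rewrite tofracN mulrN. Qed.

Lemma vgeB M x y : vge M x -> vge M y -> vge M (x - y).
Proof. by move=> hx /vgeN; apply: vgeD. Qed.

Lemma vgeM M N x y : vge M x -> vge N y -> vge (M + N) (x * y).
Proof.
by move=> [f ->] [g ->]; exists (f * g); rewrite tofracM qzD mulrACA.
Qed.

Lemma vgeW M N x : (M <= N)%R -> vge N x -> vge M x.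
Proof.
move=> leMN [f ->]; exists (fX ^+ `|(N - M)%R|%N * f).
rewrite tofracM -qXn mulrA (exprnP q) -qzD; congr (q ^ _ * _); lia.
Qed.

Lemma vgeM0 M x y : vge M x -> vge 0 y -> vge M (x * y).
Proof. by move=> hx hy; rewrite -[M]addr0; apply: vgeM. Qed.

Lemma vge0M M x y : vge 0 x -> vge M y -> vge M (x * y).
Proof. by move=> hx hy; rewrite mulrC; apply: vgeM0. Qed.

Lemma vge_sum M n (F : nat -> laurent) :
  (forall i, (i < n)%N -> vge M (F i)) -> vge M (\sum_(i < n) F i).
Proof.
move=> hF; elim: n hF => [|n IH] hF; first by rewrite big_ord0; apply: vge0.
rewrite big_ord_recr; apply: vgeD; last exact: hF.
by apply: IH => i /ltnW; apply: hF.
Qed.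

(** The group 1 + q Q[[q]] contains all the infinite products that occur, and inverses of its
    elements are power series, so limits pass to inverses. *)
Definition unit1 (x : laurent) : Prop := vge 1 (x - 1).

Lemma unit1_inv x : unit1 x -> x != 0 /\ vge 0 x^-1.
Proof.
move=> [f E]; have [h hh] := fps_geometric (- f).
have xE : x = (1 - fX * - f)%:L.
  rewrite mulrN opprK tofracD tofrac1 tofracM -/q.
  by move: E; rewrite expr1z => <-; rewrite addrC subrK.
have xh : x * h%:L = 1 by rewrite xE -tofracM hh tofrac1.
have x0 : x != 0.
  by apply/eqP => x0; move/eqP: xh; rewrite x0 mul0r eq_sym oner_eq0.
split=> //; rewrite (_ : x^-1 = h%:L); first exact: vge_fps.
by apply: (mulfI x0); rewrite mulfV.
Qed.

Lemma unit1_neq0 x : unit1 x -> x != 0.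
Proof. by case/unit1_inv. Qed.

Lemma unit1_vgeV x : unit1 x -> vge 0 x^-1.
Proof. by case/unit1_inv. Qed.

Lemma unit1_vge x : unit1 x -> vge 0 x.
Proof. by move=> h; rewrite -[x](subrK 1); apply: vgeD vge1; apply: vgeW h. Qed.

Lemma unit1M x y : unit1 x -> unit1 y -> unit1 (x * y).
Proof.
move=> hx hy; rewrite /unit1 (_ : x * y - 1 = (x - 1) * y + (y - 1)).
  by apply: vgeD => //; apply: vgeM0 => //; apply: unit1_vge.
by rewrite mulrBl mul1r addrA subrK.
Qed.

Lemma unit1_1 : unit1 1.
Proof. by rewrite /unit1 subrr; apply: vge0. Qed.

Lemma unit1B x : vge 1 x -> unit1 (1 - x).
Proof. by move=> hx; rewrite /unit1 addrC addKr; apply: vgeN. Qed.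

Lemma vgeX x n : vge 0 x -> vge 0 (x ^+ n).
Proof.
move=> hx; elim: n => [|n IH]; first by rewrite expr0; apply: vge1.
by rewrite exprS; apply: vgeM0.
Qed.

Lemma unit1_poch (b x : laurent) n : vge 0 b -> vge 1 x -> unit1 (pochhammer b x n).
Proof.
move=> hb hx; elim: n => [|n IH]; first by rewrite poch0; apply: unit1_1.
by rewrite pochS; apply: unit1M IH _; apply/unit1B/vgeM0/vgeX.
Qed.

(** A nonzero denominator is q^m times a series with nonzero constant term, which becomes invertible
    by the geometric series after scaling that term to 1. *)
Lemma vge_exists x : exists M, vge M x.
Proof.
have [f [g [g0 E]]] := laurent_frac x.
have [m gm gl] := fps_neq0 g0.
have [h gE] := fps_dvdX gl.
have h0 : fps_coef h 0 != 0 by move: gm; rewrite gE coef_fpsXM ltnn subnn.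
pose c := fps_of_poly (fps_coef h 0)^-1%:P.
have cc : c * fps_of_poly (fps_coef h 0)%:P = 1.
  apply: fpsP => n; rewrite (@fps_coefM_poly _ _ (fps_coef h 0)^-1%:P (fps_coef h 0)%:P) //.
  by rewrite -polyCM mulVf.
have [k hk] : exists k, c * h = 1 - fX * k.
  have [|k Ek] := @fps_dvdX 1 (1 - c * h).
    case=> // _; rewrite fps_coefD /= big_ord_recl big_ord0 /= coef1 !coefC /=.
    by rewrite addr0 mulVf // subrr.
  by exists k; rewrite -[fX]expr1 -Ek; ring.
have [r hr] := fps_geometric k.
exists (- m%:Z), (f * (c * r)).
have g0' : g%:L != 0 by rewrite tofrac_eq0.
apply: (mulIf g0'); rewrite E tofracM -!mulrA -tofracM.
have -> : (c * r) * g = fX ^+ m by rewrite gE -[RHS]mulr1 -hr -hk; ring.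
by rewrite mulrCA -qXn (exprnP q) -qzD addNr expr0z mulr1.
Qed.

(** * Limits and infinite products *)

Local Notation P := (qpochoo q q).
Lemma q_cvgP u l : q_cvg u l <->
  forall M : int, exists N, forall n, (N <= n)%N -> vge M (u n - l).
Proof.
split=> ul M; last exact: ul M%:Z.
have [N HN] := ul `|M|%N; exists N => n /HN.
by apply: (@vgeW M `|M|%N); lia.
Qed.

Lemma q_cvg_cst l : q_cvg (fun=> l) l.
Proof. by apply/q_cvgP => M; exists 0%N => n _; rewrite subrr; apply: vge0. Qed.

Lemma q_cvg_ev u v l N : (forall n, (N <= n)%N -> u n = v n) -> q_cvg u l -> q_cvg v l.
Proof.
move=> uv /q_cvgP ul; apply/q_cvgP => M; have [N' HN] := ul M.
exists (maxn N N') => n; rewrite geq_max => /andP[h1 h2].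
by rewrite -uv //; apply: HN.
Qed.

Lemma eq_q_cvg u v l : u =1 v -> q_cvg u l -> q_cvg v l.
Proof. by move=> uv; apply: (@q_cvg_ev _ _ _ 0%N) => n _; apply: uv. Qed.

Lemma q_cvgD u v l m : q_cvg u l -> q_cvg v m -> q_cvg (fun n => u n + v n) (l + m).
Proof.
move=> /q_cvgP ul /q_cvgP vm; apply/q_cvgP => M.
have [N HN] := ul M; have [N' HN'] := vm M.
exists (maxn N N') => n; rewrite geq_max => /andP[h1 h2].
by rewrite opprD addrACA; apply: vgeD; [apply: HN|apply: HN'].
Qed.

Lemma q_cvgM u v l m : q_cvg u l -> q_cvg v m -> q_cvg (fun n => u n * v n) (l * m).
Proof.
move=> /q_cvgP ul /q_cvgP vm; apply/q_cvgP => M.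
have [A hA] := vge_exists l; have [B hB] := vge_exists m.
have [N HN] := ul (M - B); have [N1 HN1] := ul A; have [N' HN'] := vm (M - A).
exists (maxn N1 (maxn N N')) => n; rewrite !geq_max => /and3P[h0 h1 h2].
have -> : u n * v n - l * m = u n * (v n - m) + (u n - l) * m.
  by rewrite mulrBr mulrBl addrA subrK.
apply: vgeD; last by rewrite -[M](subrK B); apply: vgeM hB; apply: HN.
rewrite -[M](subrK A) addrC; apply: vgeM; last exact: HN'.
by rewrite -[u n](subrK l); apply: vgeD hA; apply: HN1.
Qed.

Lemma q_cvgZ c u l : q_cvg u l -> q_cvg (fun n => c * u n) (c * l).
Proof. exact: q_cvgM (q_cvg_cst c). Qed.

Lemma q_cvgN u l : q_cvg u l -> q_cvg (fun n => - u n) (- l).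
Proof.
by move=> /(q_cvgZ (-1)); rewrite mulN1r; apply: eq_q_cvg => n; rewrite mulN1r.
Qed.

Lemma q_cvgB u v l m : q_cvg u l -> q_cvg v m -> q_cvg (fun n => u n - v n) (l - m).
Proof. by move=> ul /q_cvgN vm; apply: q_cvgD ul vm. Qed.

Lemma q_cvg_sub u l (phi : nat -> nat) : (forall n, (n <= phi n)%N) ->
  q_cvg u l -> q_cvg (fun n => u (phi n)) l.
Proof.
move=> hphi ul M; have [N HN] := ul M; exists N => n leNn.
by apply: HN; apply: leq_trans (hphi n).
Qed.

Lemma q_cvg_comp u l (phi : nat -> nat) :
    (forall A, exists N, forall n, (N <= n)%N -> (A <= phi n)%N) ->
  q_cvg u l -> q_cvg (fun n => u (phi n)) l.
Proof.
move=> hphi ul M; have [A HA] := ul M; have [N HN] := hphi A.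
by exists N => n /HN; apply: HA.
Qed.

Lemma q_cvg_unsub u l (N : nat) : q_cvg (fun n => u (n + N)%N) l -> q_cvg u l.
Proof.
move=> ul M; have [N' HN] := ul M; exists (N' + N)%N => n le.
have := HN (n - N)%N; rewrite subnK; last by lia.
by apply; lia.
Qed.

Lemma invB_prod (F : fieldType) (x y : F) : x != 0 -> y != 0 ->
  x^-1 - y^-1 = - ((x - y) * (x^-1 * y^-1)).
Proof. by move=> x0 y0; field; rewrite x0 y0. Qed.

Lemma q_cvgV u l : (forall n, unit1 (u n)) -> unit1 l -> q_cvg u l ->
  q_cvg (fun n => (u n)^-1) l^-1.
Proof.
move=> hu hl /q_cvgP ul; apply/q_cvgP => M; have [N HN] := ul M.
exists N => n /HN h.
have [u0 l0] := (unit1_neq0 (hu n), unit1_neq0 hl).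
have -> : (u n)^-1 - l^-1 = - ((u n - l) * ((u n)^-1 * l^-1)).
  exact: invB_prod.
by apply/vgeN/vgeM0 => //; apply: vgeM0; apply: unit1_vgeV.
Qed.

Lemma q_cvg_vge u l M : (forall n, vge M (u n)) -> q_cvg u l -> vge M l.
Proof.
move=> hu /q_cvgP /(_ M)[N HN]; rewrite -[l](subKr (u N)).
by apply: vgeB => //; apply: HN.
Qed.

Lemma qpochE x b n : qpoch x b n = pochhammer b x n.
Proof. by []. Qed.

Lemma vge1_q (x : laurent) : vge 1 x -> exists g : fps, x = q * g%:L.
Proof. by move=> [f ->]; exists f; rewrite expr1z. Qed.

Lemma qpochoo_cvg x b : vge 1 x -> vge 1 b -> q_cvg (pochhammer b x) (qpochoo x b).
Proof.
move=> /(@vgeW 0 1 _ isT)[f ->] /vge1_q[g ->]; rewrite expr0z mul1r.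
have [l hl] := qpoch_cvg f g; rewrite /qpochoo (q_limE hl); exact: hl.
Qed.

Lemma unit1_qpochoo x b : vge 1 x -> vge 1 b -> unit1 (qpochoo x b).
Proof.
move=> hx hb; apply: q_cvg_vge (q_cvgB (qpochoo_cvg hx hb) (q_cvg_cst 1)) => n.
by apply: unit1_poch => //; apply: vgeW hb.
Qed.

Lemma vge1_qX n : (0 < n)%N -> vge 1 (q ^+ n).
Proof. by move=> n0; apply: vgeW (vge_q n); lia. Qed.

Lemma vge1_self : vge 1 q.
Proof. by rewrite -[q]expr1; apply: vge1_qX. Qed.

Lemma vge_rq b z : vge 1 b -> vge 0 (qfacV b z).
Proof.
move=> hb; case: z => n; last exact: vge0.
by apply: unit1_vgeV; apply: unit1_poch => //; apply: vgeW hb.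
Qed.

Lemma rq_cvg b (u : nat -> int) : vge 1 b ->
    (forall A : nat, exists N, forall n, (N <= n)%N -> (A%:Z <= u n)%R) ->
  q_cvg (fun n => qfacV b (u n)) (qpochoo b b)^-1.
Proof.
move=> hb hu; have hb0 : vge 0 b by apply: vgeW hb.
have h : q_cvg (fun n => (pochhammer b b n)^-1) (qpochoo b b)^-1.
  apply: q_cvgV (qpochoo_cvg hb hb) => [n|]; first exact: unit1_poch.
  exact: unit1_qpochoo.
move=> M; have [A HA] := h M; have [N HN] := hu A; exists N => n /HN leA.
have -> : u n = `|u n|%N by lia.
by apply: HA; lia.
Qed.

Lemma vge_kerY e r n : vge 0 (bkerY q e r n).
Proof. by apply: vgeM0; apply: vge_rq vge1_self. Qed.

Lemma kerY_cvg e r : q_cvg (bkerY q e r) (P^-1 * P^-1).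
Proof.
apply: q_cvgM; apply: rq_cvg vge1_self _ => A.
  by exists (A + `|r|)%N => n; lia.
by exists (A + `|r|)%N => n; lia.
Qed.

(** * Dominated convergence for finite and bilateral sums *)

Lemma uniform_cvg (v : nat -> nat -> laurent) (l : nat -> laurent) R M :
    (forall t, q_cvg (fun N => v N t) (l t)) ->
  exists N0, forall N t, (N0 <= N)%N -> (t < R)%N -> vge M (v N t - l t).
Proof.
move=> vl; elim: R => [|R [N0 IH]]; first by exists 0%N.
have /q_cvgP/(_ M)[N1 HN1] := vl R; exists (maxn N0 N1) => N t.
rewrite geq_max => /andP[h0 h1]; rewrite ltnS leq_eqVlt => /orP[/eqP->|ltt].
  exact: HN1.
exact: IH.
Qed.

(** In an ultrametric setting a tail bound uniform in N suffices. The statement concerns the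
    difference of the two sums, so convergence of the limiting series need not be known
    beforehand. *)
Lemma tannery (v : nat -> nat -> laurent) (l : nat -> laurent) (V : nat -> nat) :
    (forall t, q_cvg (fun N => v N t) (l t)) ->
    (forall M : int, exists R, forall N t, (R <= t)%N -> vge M (v N t)) ->
  q_cvg (fun N => \sum_(t < V N) v N t - \sum_(t < V N) l t) 0.
Proof.
move=> vl dom; apply/q_cvgP => M; have [R HR] := dom M.
have [N0 HN0] := uniform_cvg R M vl.
exists N0 => N leN; rewrite subr0 -sumrB.
apply: (@vge_sum M (V N) (fun t => v N t - l t)) => t _.
have [ltR|leR] := ltnP t R; first by apply: HN0.
apply: vgeB; first exact: HR.
by apply: (@q_cvg_vge (fun N => v N t) _ _ _ (vl t)) => n; exact: HR.
Qed.

Definition zcvg (f : int -> laurent) (L : laurent) := q_cvg (fun W => bsum W f) L.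

Lemma bsumE_nat (W : nat) (f : int -> laurent) :
  bsum W f = \sum_(t < W.+1) (if t == 0 :> nat then f 0 else f t%:Z + f (- t%:Z)).
Proof. by rewrite /bsum big_ord_recl. Qed.

Lemma tannery_z (u : nat -> int -> laurent) (l : int -> laurent) (V : nat -> nat) :
    (forall s, q_cvg (fun N => u N s) (l s)) ->
    (forall M : int, exists R : nat, forall N s, (R%:Z <= `|s|)%R -> vge M (u N s)) ->
  q_cvg (fun N => bsum (V N) (u N) - bsum (V N) l) 0.
Proof.
move=> ul dom.
pose w (f : int -> laurent) (t : nat) := if t == 0%N then f 0 else f t%:Z + f (- t%:Z).
apply: eq_q_cvg (@tannery (fun N => w (u N)) (w l) (fun N => (V N).+1) _ _) => [N|t|M].
- by rewrite !bsumE_nat.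
- by rewrite /w; case: t => [|t] /=; [apply: ul|apply: q_cvgD; apply: ul].
have [R HR] := dom M; exists R.+1 => N [//|t] leR; rewrite /w /=.
by apply: vgeD; apply: HR; lia.
Qed.

(** The window V N covers the supports of the first N blocks; demanding V N >= N as well makes it
    exhaust the limiting bilateral series. *)
Lemma zsum_limit (cs : nat -> int -> laurent) (l : int -> laurent)
    (Bl : nat -> laurent) (L : laurent) :
    (forall n, has_zsum (cs n) (Bl n)) ->
    (forall s, q_cvg (fun N => \sum_(n < N) cs n s) (l s)) ->
    (exists c : int, forall n s, vge (`|s| - c) (cs n s)) ->
    zcvg l L ->
  q_cvg (fun N => \sum_(n < N) Bl n) L.
Proof.
move=> hB csl [c dom] lL.
have hT N : has_zsum (fun s => \sum_(n < N) cs n s) (\sum_(n < N) Bl n).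
  exact: (@has_zsum_sum _ N cs Bl (fun n _ => hB n)).
have /choice[V HV] : forall N, exists V, (N <= V)%N /\
    bsum V (fun s => \sum_(n < N) cs n s) = \sum_(n < N) Bl n.
  move=> N; have [W HW] := has_zsumP (hT N).
  by exists (maxn N W); split; [exact: leq_maxl|apply: HW; exact: leq_maxr].
have H : q_cvg (fun N => bsum (V N) (fun s => \sum_(n < N) cs n s) - bsum (V N) l) 0.
  apply: (@tannery_z (fun N s => \sum_(n < N) cs n s) l V csl) => M.
  exists `|(M + c)%R|%N => N s leR; apply: (@vge_sum M N (cs^~ s)) => n _.
  by apply: vgeW (dom n s); lia.
have VN N : (N <= V N)%N by case: (HV N).
have := q_cvgD H (q_cvg_sub VN lL); rewrite add0r; apply: eq_q_cvg => N.
by rewrite subrK; case: (HV N).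
Qed.

(* Dividing the eigenvalue equation of a kernel by (q)_oo turns it into the value of
   the infinite sum: this is the limiting case N -> oo of a Bailey step. *)
Lemma kernel_series (w k k' : nat -> laurent) (om : nat -> laurent)
    (kap kl oml : laurent) :
    (forall M : int, exists R, forall n, (R <= n)%N -> vge M (w n * k n)) ->
    q_cvg k' kl -> q_cvg om oml ->
    (forall N, \sum_(n < N.+1) qfacV q (N - n)%N * (w n * k n) = kap * (om N * k' N)) ->
  q_cvg (fun N => \sum_(n < N) w n * k n) (P * (kap * (oml * kl))).
Proof.
move=> hwk kkl omoml eig.
have uP : unit1 P by apply: unit1_qpochoo; exact: vge1_self.
have P0 := unit1_neq0 uP.
apply: (@q_cvg_unsub _ _ 1%N).
have H := @tannery (fun N n => qfacV q (N - n)%N * (w n * k n))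
  (fun n => P^-1 * (w n * k n)) (fun N => N.+1).
have {}H : q_cvg (fun N => kap * (om N * k' N) - P^-1 * \sum_(n < N.+1) w n * k n) 0.
  apply: eq_q_cvg (H _ _) => [N|t|M]; first by rewrite eig mulr_sumr.
    apply: q_cvgM (q_cvg_cst _); apply: rq_cvg vge1_self _ => A.
    by exists (A + t)%N => n; lia.
  have [R hR] := hwk M; exists R => N t leR.
  by apply: vge0M; [exact: vge_rq vge1_self|exact: hR].
have := q_cvgZ P (q_cvgB (q_cvgZ kap (q_cvgM omoml kkl)) H).
rewrite subr0; apply: eq_q_cvg => N.
by rewrite subKr mulVKf // addn1.
Qed.

(** * The quintuple product *)

Lemma qz_eq1 (i : int) : q ^ i = 1 -> i = 0.
Proof.
case: i => [[|n]|n] // E.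
  by case/eqP: (q_order n).
case/eqP: (q_order n); rewrite NegzE in E.
by rewrite -[LHS]mulr1 -E (exprnP q) -qzD addrN expr0z.
Qed.

Lemma quad_bound (e : int -> int) (A B C : int) : (0 < A)%R ->
    (forall s, 2 * e s = A * (s * s) + B * s + C) ->
  exists c : int, forall s, (`|s| - c <= e s)%R.
Proof.
(* With b = |B| + 2 and x = |s| the bound follows from 2 (x^2 - b x + 2 b^2) = (x - b)^2 + x^2 + 3
   b^2; the 2 in b pays for the term 2|s|. *)
move=> A0 he; exists (`|C| + (`|B| + 2) * (`|B| + 2)) => s.
rewrite -(@ler_pM2l _ 2) // he.
have h1 : (s * s <= A * (s * s))%R by nia.
have h2 : (- (`|B| * `|s|) <= B * s)%R by rewrite -normrM; lia.
have h3 : (`|s| * `|s| = s * s)%R by rewrite -normrM; nia.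
have h4 : (0 <= `|s|)%R by []; have h5 : (0 <= `|B|)%R by [].
move: h1 h2 h3 h4 h5; move: (`|s|) (`|B|) => x b h1 h2 h3 h4 h5.
have : (- C <= `|C|)%R by lia.
have : (0 <= `|C|)%R by [].
move: (`|C|) => c c0 hc.
have h6 : (0 <= (x - (b + 2)) * (x - (b + 2)))%R by rewrite -expr2 sqr_ge0.
have h7 : (0 <= x * x)%R by nia.
have h8 : (0 <= (b + 2) * (b + 2))%R by nia.
have : 2 * (x * x - (b + 2) * x + 2 * ((b + 2) * (b + 2))) =
  (x - (b + 2)) * (x - (b + 2)) + x * x + 3 * ((b + 2) * (b + 2)) by ring.
have : (b + 2) * x = b * x + 2 * x by ring.
lia.
Qed.

Section Quintuple.
Variables M t : nat.
Hypotheses (t0 : (0 < t)%N) (tM : (2 * t < M)%N).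
Let Q := q ^+ M.
Let z := q ^+ t.

(** The quintuple product of base q^M at z = q^t; for M = s0 + 2 s1 + 3 and t = s1 + 1 it is the
    numerator of the character of (s0, s1), and then 2t < M holds. *)
Definition quint_product : laurent :=
  qpochoo (q ^+ t) (q ^+ M) * qpochoo (q ^+ (M - t)) (q ^+ M)
  * qpochoo (q ^+ M) (q ^+ M)
  * (qpochoo (q ^+ (M - 2 * t)) (q ^+ (2 * M))
     * qpochoo (q ^+ (M + 2 * t)) (q ^+ (2 * M))).

Definition quint_exp1 (s : int) : int := M%:Z * (3 * tri s - 2 * s) + 3 * t%:Z * s.
Definition quint_exp2 (s : int) : int := quint_exp1 s + t%:Z + M%:Z * s.

Lemma quint_exp1E s :
  2 * quint_exp1 s = (3 * M%:Z) * (s * s) + (6 * t%:Z - M%:Z) * s + 0.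
Proof.
rewrite /quint_exp1 (_ : 2 * _ = M%:Z * (3 * (2 * tri s) - 4 * s) + 6 * t%:Z * s); last by ring.
by rewrite triE; ring.
Qed.

Lemma quint_exp2E s :
  2 * quint_exp2 s = (3 * M%:Z) * (s * s) + (6 * t%:Z + M%:Z) * s + 2 * t%:Z.
Proof. by rewrite /quint_exp2 2!mulrDr quint_exp1E; ring. Qed.

Lemma quint_exp1_bound : exists c : int, forall s, (`|s| - c <= quint_exp1 s)%R.
Proof. by apply: quad_bound quint_exp1E; lia. Qed.

Lemma quint_exp2_bound : exists c : int, forall s, (`|s| - c <= quint_exp2 s)%R.
Proof.
by apply: quad_bound quint_exp2E; lia.
Qed.

Lemma quint_limit :
  zcvg (fun s => q ^ quint_exp1 s - q ^ quint_exp2 s) quint_product.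
Proof.
have Q0 : Q != 0 by rewrite expf_neq0 // q_neq0.
have z0 : z != 0 by rewrite expf_neq0 // q_neq0.
have Q1 n : Q ^+ n.+1 != 1.
  rewrite -exprM; case E : (M * n.+1)%N => [|m]; last exact: q_order.
  by move: E; lia.
have hQ : vge 1 Q by apply: vge1_qX; lia.
have hQ0 : vge 0 Q by apply: vgeW hQ.
have Qz j : Q ^ j = q ^ (M%:Z * j) by rewrite /Q (exprnP q) exprz_exp.
have hz j : z ^+ 2 * Q ^ j != 1.
  rewrite /z -exprM (exprnP q) Qz -qzD; apply/eqP => /qz_eq1 E.
  by have [j0|j0] := leP 0 j; have := t0; have := tM; nia.
have zE : z ^+ 2 = q ^+ (2 * t) by rewrite /z -exprM mulnC.
have QzE : Q / z = q ^+ (M - t).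
  by apply: (mulIf z0); rewrite divfK // /Q /z -exprD subnK //; lia.
have Qz2E : Q / z ^+ 2 = q ^+ (M - 2 * t).
  have z20 : z ^+ 2 != 0 by rewrite expf_neq0.
  by apply: (mulIf z20); rewrite divfK // /Q zE -exprD subnK //; lia.
have h1 : vge 1 (Q / z ^+ 2) by rewrite Qz2E; apply: vge1_qX; lia.
have h2 : vge 1 (z ^+ 2) by rewrite zE; apply: vge1_qX; lia.
have h3 : vge 1 z by apply: vge1_qX.
have h4 : vge 1 (Q / z) by rewrite QzE; apply: vge1_qX; lia.
pose PQ := qpochoo Q Q; pose A := qpochoo (Q / z ^+ 2) Q; pose B := qpochoo (z ^+ 2) Q.
pose A' := qpochoo (- (Q / z)) Q; pose B' := qpochoo (- z) Q.
have PQ0 : PQ != 0 by apply/unit1_neq0/unit1_qpochoo.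
have A0 : A != 0 by apply/unit1_neq0/unit1_qpochoo.
have B0 : B != 0 by apply/unit1_neq0/unit1_qpochoo.
have A'0 : A' != 0 by apply/unit1_neq0/unit1_qpochoo => //; apply: vgeN.
have B'0 : B' != 0 by apply/unit1_neq0/unit1_qpochoo => //; apply: vgeN.
have BE : B = qpochoo z Q * B' * qpochoo (Q * z ^+ 2) (Q ^+ 2).
  apply: (@q_cvg_unique (fun n => pochhammer Q (z ^+ 2) (2 * n))).
    by apply: (@q_cvg_sub _ _ (fun n => 2 * n)%N) (qpochoo_cvg _ _) => // n; lia.
  apply: eq_q_cvg (fun n => esym (poch_dissect1 Q z n)) _.
  apply: q_cvgM; last by apply: qpochoo_cvg;
    [apply: vgeM0 => //; exact: vgeW h2|rewrite expr2; apply: vgeM0].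
  by apply: q_cvgM; apply: qpochoo_cvg => //; apply: vgeN.
have AE : A = qpochoo (Q / z ^+ 2) (Q ^+ 2) * (qpochoo (Q / z) Q * A').
  apply: (@q_cvg_unique (fun n => pochhammer Q (Q / z ^+ 2) (2 * n))).
    by apply: (@q_cvg_sub _ _ (fun n => 2 * n)%N) (qpochoo_cvg _ _) => // n; lia.
  have E : Q / z ^+ 2 * Q = (Q / z) ^+ 2 by rewrite expr_div_n mulrAC expr2.
  apply: eq_q_cvg (fun n => esym (poch_dissect2 n E)) _.
  apply: q_cvgM; first by apply: qpochoo_cvg => //; rewrite expr2; apply: vgeM0.
  by apply: q_cvgM; apply: qpochoo_cvg => //; apply: vgeN.
have E1 s : (1 - z * Q ^ s) * z ^ (3 * s) * Q ^ (3 * tri s - 2 * s)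
    = q ^ quint_exp1 s - q ^ quint_exp2 s.
  rewrite Qz [Q ^ (_ - _)]Qz /quint_exp2 /quint_exp1 /z !(exprnP q) exprz_exp.
  by rewrite -qzD -mulrA -qzD mulrBl mul1r -qzD; congr (q ^ _ - q ^ _); ring.
pose l s := q ^ quint_exp1 s - q ^ quint_exp2 s.
pose u (m : nat) (s : int) := if (`|s| <= m)%N then quint_sterm Q z m s else 0.
have ul s : q_cvg (fun m => u m s) (l s * (PQ^-1 * PQ^-1) / (A * B)).
  apply: (@q_cvg_ev (fun m => quint_sterm Q z m s) _ _ `|s|%N).
    by move=> m le; rewrite /u le.
  rewrite /quint_sterm /l -E1; apply: q_cvgM.
    apply: q_cvgZ; apply: q_cvgM; apply: rq_cvg hQ _ => a.
      by exists (a + `|s|)%N => n; lia.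
    by exists (a + `|s|)%N => n; lia.
  apply: q_cvgV => [n||]; try by apply: unit1M; first [exact: unit1_poch|exact: unit1_qpochoo].
  apply: q_cvgM.
    apply: (@q_cvg_comp (pochhammer Q (Q / z ^+ 2)) _ (fun n => `|(n%:Z - s)%R|%N)).
      by move=> a; exists (a + `|s|)%N => n; lia.
    exact: qpochoo_cvg.
  apply: (@q_cvg_comp (pochhammer Q (z ^+ 2)) _ (fun n => `|(n%:Z + s + 1)%R|%N)).
    by move=> a; exists (a + `|s|)%N => n; lia.
  exact: qpochoo_cvg.
have [c1 hc1] := quint_exp1_bound; have [c2 hc2] := quint_exp2_bound.
have dom (N : int) : exists R : nat, forall m s, (R%:Z <= `|s|)%R -> vge N (u m s).
  exists `|(`|c1| + `|c2| + `|N|)%R|%N => m s leR; rewrite /u.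
  case: ifP => _; last exact: vge0.
  rewrite /quint_sterm E1; apply: vgeM0; last first.
    by apply: unit1_vgeV; apply: unit1M; apply: unit1_poch.
  apply: vgeM0; last by apply: vgeM0; apply: vge_rq.
  by apply: vgeB; apply: vgeW (vge_q _); [have := hc1 s|have := hc2 s]; lia.
(* The finite sums are evaluated in the limit twice: termwise here, giving the theta series over
   PQ^2 A B, and through their closed form in [R]. Comparing the two yields the identity; the
   products at -z and -Q/z cancel by [AE] and [BE]. *)
have T := @tannery_z u _ id ul dom.
have bu m : bsum m (u m) =
    qfacV Q (2 * m)%N / (pochhammer Q (- (Q / z)) m * pochhammer Q (- z) m.+1).
  rewrite -(quint_sfinite Q0 Q1 m z0 hz) /bsum {1}/u absz0 leq0n; congr (_ + _).
  by apply: eq_bigr => i _; rewrite /u !abszN !absz_nat ltn_ord.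
have R : q_cvg (fun m => bsum m (u m)) (PQ^-1 / (A' * B')).
  apply: eq_q_cvg (fun m => esym (bu m)) _; apply: q_cvgM.
    by apply: rq_cvg hQ _ => a; exists a => n; lia.
  apply: q_cvgV => [n||]; try by apply: unit1M; first
    [by apply: unit1_poch => //; apply: vgeN | by apply: unit1_qpochoo => //; apply: vgeN].
  apply: q_cvgM; first by apply: qpochoo_cvg => //; apply: vgeN.
  by apply: (@q_cvg_sub _ _ S) (qpochoo_cvg _ _) => //; apply: vgeN.
have := q_cvgZ (PQ * PQ * (A * B)) (q_cvgB R T); rewrite subr0 => H.
rewrite /zcvg (_ : quint_product = PQ * PQ * (A * B) * (PQ^-1 / (A' * B'))).
  apply: eq_q_cvg H => m /=; rewrite subKr -bsumZ; apply: eq_bsum => s.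
  by rewrite -/(l s); move: (l s) => x; clear -PQ0 A0 B0; clearbody PQ A B; exact: frac_quint1.
have Q2E : Q ^+ 2 = q ^+ (2 * M) by rewrite /Q -exprM mulnC.
have QzzE : Q * z ^+ 2 = q ^+ (M + 2 * t) by rewrite zE /Q -exprD.
rewrite /quint_product -QzE -Qz2E -Q2E -QzzE AE BE -/Q -/z -/PQ.
move: (qpochoo z Q) (qpochoo (Q / z) Q) (qpochoo _ (Q ^+ 2)) (qpochoo _ (Q ^+ 2)).
clear -PQ0 A'0 B'0; clearbody PQ A' B' => *.
by rewrite frac_quint2.
Qed.
End Quintuple.

(** * Multisums as iterated Bailey steps *)

Definition at_seq (s : seq nat) (r : nat) : nat := nth 0%N s r.-1.

(* The weakly decreasing sequences of length [m] starting with [n], for [m > 0]. *)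
Fixpoint dseq (m n : nat) : seq (seq nat) :=
  match m with
  | 0 => [::]
  | 1 => [:: [:: n]]
  | m'.+1 => [seq n :: s | x <- iota 0 n.+1, s <- dseq m' x]
  end.

Lemma dseqS m n :
  dseq m.+2 n = [seq n :: s | x <- iota 0 n.+1, s <- dseq m.+1 x].
Proof. by []. Qed.

Lemma mem_dseq m n s :
  (s \in dseq m.+1 n) = [&& size s == m.+1, sorted geq s & head 0%N s == n].
Proof.
elim: m n s => [|m IH] n s.
  rewrite inE; case: s => [|x [|y s]] //=; first by rewrite eqseq_cons eqxx andbT.
  by rewrite eqseq_cons andbF.
rewrite dseqS; apply/allpairsPdep/and3P => [[x [u [xn us ->]]]|].
  move: us; rewrite IH => /and3P[/eqP us su hu]; split=> //=; first by rewrite us.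
  move: xn us su hu; rewrite mem_iota add0n ltnS.
  by case: u => [|y u] //= xn _ -> /eqP ->; rewrite xn.
case: s => [|y [|x u]] [] //= /eqP[sz] /andP[yx srt] /eqP <-.
exists x, (x :: u); split=> //; first by rewrite -/(iota 0 y.+1) mem_iota add0n ltnS.
by rewrite IH /= sz srt !eqxx.
Qed.

Lemma dseq_uniq m n : uniq (dseq m.+1 n).
Proof.
elim: m n => [|m IH] n //; rewrite dseqS; apply: allpairs_uniq_dep => //.
  exact: iota_uniq.
move=> _ _ /allpairsPdep[x [u [_ hu ->]]] /allpairsPdep[y [v [_ hv ->]]] /= [uv].
by move: hu hv; rewrite !mem_dseq uv => /and3P[_ _ /eqP <-] /and3P[_ _ /eqP <-].
Qed.

(** The tuples with entries bounded by n match the recursively built lists because a weakly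
    decreasing list is bounded by its head. *)
Lemma block_dseq m (F : (nat -> nat) -> laurent) n :
  block m.+1 F n = \sum_(s <- dseq m.+1 n) F (at_seq s).
Proof.
pose h (t : m.+1.-tuple 'I_n.+1) : seq nat := [seq val x | x <- t].
pose A := [seq t <- index_enum _ | sorted geq (h t) && (tuple_index t 1 == n)].
rewrite /block -big_filter -/A.
transitivity (\sum_(s <- map h A) F (at_seq s)); first by rewrite big_map.
apply: perm_big; apply: uniq_perm; last first.
- move=> s; rewrite mem_dseq; apply/mapP/and3P => [[t]|[sz srt hd]].
    rewrite mem_filter => /andP[/andP[srt hd] _] ->; split=> //.
    by rewrite size_map size_tuple.
  have sn : all (fun x => x < n.+1)%N s.
    move: srt hd; case: (s) => //= x u srt /eqP xn; rewrite -xn ltnSn /=.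
    have tr : transitive geq by move=> a b c h1 h2; apply: leq_trans h2 h1.
    by have := order_path_min tr srt; apply: sub_all => y; rewrite /geq ltnS.
  pose u := pmap (insub : nat -> option 'I_n.+1) s.
  have us : [seq val x | x <- u] = s.
    by rewrite (pmap_filter (insubK _)); apply/all_filterP;
       apply: sub_all sn => y; rewrite isSome_insub.
  have su : size u == m.+1 by rewrite -(size_map val) us.
  exists (Tuple su); last by rewrite /h /= us.
  by rewrite mem_filter mem_index_enum /h /tuple_index /= us srt nth0 hd.
- exact: dseq_uniq.
rewrite map_inj_uniq ?filter_uniq ?index_enum_uniq // => t1 t2.
by move=> /(inj_map val_inj) /val_inj.
Qed.

(** Index 0 returns n as well, in agreement with [at_seq], whose predecessor sends both 0 and 1 to
    the head. *)
Definition jcons (n : nat) (j : nat -> nat) (r : nat) : nat :=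
  if r is r'.+2 then j r'.+1 else n.

Lemma block_rec m (F : (nat -> nat) -> laurent) n :
  block m.+2 F n = \sum_(x < n.+1) block m.+1 (fun j => F (jcons n j)) x.
Proof.
rewrite block_dseq dseqS big_allpairs_dep.
transitivity (\sum_(0 <= x < n.+1) \sum_(s <- dseq m.+1 x) F (at_seq (n :: s))).
  by rewrite /index_iota subn0.
rewrite big_mkord; apply: eq_bigr => x _; rewrite block_dseq; apply: eq_bigr => s _.
by congr F; apply/funext => -[|[|r]].
Qed.

Lemma block1 (F : (nat -> nat) -> laurent) n : block 1 F n = F (at_seq [:: n]).
Proof. by rewrite block_dseq big_seq1. Qed.

Lemma block_head m (c : nat -> laurent) (F : (nat -> nat) -> laurent) n :
  block m.+1 (fun j => c (j 1%N) * F j) n = c n * block m.+1 F n.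
Proof.
rewrite !block_dseq mulr_sumr !big_seq; apply: eq_bigr => s.
by rewrite mem_dseq => /and3P[_ _ /eqP <-]; rewrite /at_seq /= nth0.
Qed.

Lemma eq_block m (F G : (nat -> nat) -> laurent) n : (forall j, F j = G j) ->
  block m F n = block m G n.
Proof. by move=> FG; apply: eq_bigr => t _. Qed.

Lemma block_nest m (w K : nat -> nat -> laurent) (h : nat -> laurent)
    (F : (nat -> nat) -> laurent) n :
    (forall j, F j = (\prod_(1 <= r < m.+1) (w r (j r) * K r (j r - j r.+1)%N))
                     * h (j m.+1)) ->
  block m.+1 F n = nest m w K h n.
Proof.
elim: m w K F n => [|m IH] w K F n FE.
  by rewrite block1 FE big_geq // mul1r.
rewrite block_rec /= mulr_sumr; apply: eq_bigr => x _.
rewrite -(IH _ _ (fun j => (\prod_(1 <= r < m.+1) (w r.+1 (j r) * K r.+1 (j r - j r.+1)%N))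
     * h (j m.+1))) //.
rewrite mulrA -(block_head _ (fun x => w 1%N n * K 1%N (n - x)%N)).
apply: eq_block => j; rewrite FE big_ltn // big_add1 /= -!mulrA; congr (_ * (_ * (_ * _))).
by rewrite !big_nat; apply: eq_bigr => -[|r] // _.
Qed.

Lemma prod_denom j m :
  (denom j m.+1)^-1 = \prod_(1 <= r < m.+1) qfacV q (j r - j r.+1)%N.
Proof. by rewrite /denom prodfV. Qed.

Lemma qz_sum (I : Type) (r : seq I) (e : I -> int) :
  q ^ (\sum_(i <- r) e i) = \prod_(i <- r) q ^ (e i).
Proof.
by elim/big_rec2: _ => [|i y x _ <-]; rewrite ?expr0z // qzD.
Qed.

Lemma mul_regroup (F : fieldType) (a b c d e f g : F) :
  a * b * (c * d * e) * f * g = a * c * (e * f) * (b * d * g).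
Proof. by ring. Qed.

Lemma block_exp m (ex exK : nat -> nat -> int) (sg : nat -> nat -> laurent)
    (beta : nat -> laurent) (F : (nat -> nat) -> laurent) n :
    (forall j, F j = (\prod_(1 <= r < m.+2) sg r (j r))
       * q ^ (\sum_(1 <= r < m.+2) ex r (j r)
              + \sum_(1 <= r < m.+1) exK r (j r - j r.+1)%N)
       / denom j m.+1 * beta (j m.+1)) ->
  block m.+1 F n = nest m (fun r x => sg r x * q ^ ex r x)
    (fun r d => q ^ exK r d * qfacV q d)
    (fun x => sg m.+1 x * q ^ ex m.+1 x * beta x) n.
Proof.
move=> FE; apply: block_nest => j; rewrite FE qzD !qz_sum prod_denom.
rewrite ![\prod_(1 <= _ < m.+2) _]big_nat_recr //= !big_split /=.
exact: mul_regroup.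
Qed.

Local Notation rq := (qfacV q).
Lemma mul_regroupU (F : fieldType) (a b c d e f g t u v : F) :
  a * b * (c * d * e) * u / (f * t * v) * g
  = a * c * (e / f) * (b * d / v * t^-1) * (u * g).
Proof. by rewrite !invfM; ring. Qed.

(* The summand of [U] is the one of [S] with [k - 1] in place of [k] and with the
   innermost sum absorbed in [beta]. *)
Lemma block_U m (ex exK : nat -> nat -> int) (sg : nat -> nat -> laurent)
    (u v beta : nat -> laurent) (F : (nat -> nat) -> laurent) n :
    (forall j, F j = (\prod_(1 <= r < m.+2) sg r (j r))
       * q ^ (\sum_(1 <= r < m.+2) ex r (j r)
              + \sum_(1 <= r < m.+1) exK r (j r - j r.+1)%N)
       * u (j m.+2) / (denom j m.+2 * v (j m.+1)) * beta (j m.+2)) ->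
  block m.+2 F n = nest m (fun r x => sg r x * q ^ ex r x)
    (fun r d => q ^ exK r d * rq d)
    (fun x => sg m.+1 x * q ^ ex m.+1 x *
      ((v x)^-1 * \sum_(y < x.+1) rq (x - y)%N * (u y * beta y))) n.
Proof.
move=> FE.
pose w (r x : nat) := if r == m.+1 then sg r x * q ^ ex r x / v x else sg r x * q ^ ex r x.
pose K (r d : nat) := if r == m.+1 then rq d else q ^ exK r d * rq d.
rewrite (@block_nest m.+1 w K (fun x => u x * beta x)) => [|j].
  rewrite -addn1 nest_cat; apply: eq_nest => [r x|r x|x].
  - by rewrite /w => /andP[_ rm]; rewrite ltn_eqF.
  - by rewrite /K => /andP[_ rm]; rewrite ltn_eqF.
  by rewrite /= /w /K addn1 eqxx -mulrA.
rewrite FE qzD !qz_sum -/(denom j m.+2).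
rewrite {1}/denom big_nat_recr //= -/(denom j m.+1).
rewrite ![\prod_(1 <= _ < m.+2) _]big_nat_recr //= /w /K eqxx.
rewrite mul_regroupU; congr (_ * _ * _).
rewrite prod_denom -!big_split big_nat [RHS]big_nat; apply: eq_bigr => r /andP[_ rm].
by rewrite ltn_eqF.
Qed.

(** * Reduction of the families S, U and T to one chain *)

Lemma sum_window (f : nat -> int) (a b m : nat) :
    (0 < a)%N -> (b <= m)%N ->
  \sum_(a <= r < b.+1) f r = \sum_(1 <= r < m.+1) (if (a <= r <= b)%N then f r else 0).
Proof.
move=> a0 bm; rewrite (@big_nat_widen _ _ _ a b.+1 m.+1) //.
rewrite [LHS](@big_nat_widenl _ _ _ a 1) // [LHS]big_mkcond.
by apply: eq_bigr => r _; rewrite ltnS [(a <= r)%N && _]andbC.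
Qed.

Lemma exS_sum (j : nat -> nat) e k i : (i <= k)%N ->
  e%:Z * sum1 j 1 k + (sum2 j 1 k - sum1 j 1 i) = \sum_(1 <= r < k.+1) exS e i r (j r).
Proof.
move=> leik; rewrite /exS sumrB big_split /= /sum1 /sum2 mulr_sumr.
rewrite (@sum_window _ 1 i k) // addrA [X in X - _]addrC.
congr (_ + _ - _).
by rewrite !big_nat; apply: eq_bigr => r /andP[-> _].
Qed.

Lemma exB_sum (j : nat -> nat) e i m : (0 < i < m)%N ->
  e%:Z * (sum1 j 1 (i - 1) - sum1 j (i + 1) (m - 1))
    + (sum2 j 1 (i - 1) - sum2 j (i + 1) (m - 1) - sum1 j 1 i + sumbin j i (m - 1))
  = \sum_(1 <= r < m.+1) exB e i m r (j r)
    + \sum_(1 <= r < m) exKB i r (j r - j r.+1)%N.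
Proof.
move=> /andP[i0 im]; rewrite /exB !sumrB.
have E1 : \sum_(1 <= r < m.+1) (if (r < i)%N then (j r)%:Z * (j r)%:Z + e%:Z * (j r)%:Z else 0)
    = sum2 j 1 (i - 1) + e%:Z * sum1 j 1 (i - 1).
  rewrite /sum1 /sum2 mulr_sumr -big_split /= [RHS](@sum_window _ 1 _ m) //; last by lia.
  rewrite !big_nat; apply: eq_bigr => r /andP[r1 _].
  by rewrite r1 (_ : (r <= i - 1)%N = (r < i)%N); [by case: ifP|apply/idP/idP; lia].
have E2 : \sum_(1 <= r < m.+1) (if (i < r < m)%N then (j r)%:Z * (j r)%:Z + e%:Z * (j r)%:Z else 0)
    = sum2 j (i + 1) (m - 1) + e%:Z * sum1 j (i + 1) (m - 1).
  rewrite /sum1 /sum2 mulr_sumr -big_split /= [RHS](@sum_window _ (i + 1) _ m) //; try lia.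
  rewrite !big_nat; apply: eq_bigr => r /andP[r1 _].
  by rewrite addn1 (_ : (r <= m - 1)%N = (r < m)%N); [by case: ifP|apply/idP/idP; lia].
have E3 : \sum_(1 <= r < m.+1) (if (r <= i)%N then (j r)%:Z else 0) = sum1 j 1 i.
  rewrite /sum1 [RHS](@sum_window _ 1 _ m) //; last by lia.
  by rewrite !big_nat; apply: eq_bigr => r /andP[-> _].
have E4 : \sum_(1 <= r < m) exKB i r (j r - j r.+1)%N = sumbin j i (m - 1).
  case: (m) im => // p ip; rewrite subn1 /= /sumbin [RHS](@sum_window _ i _ p) //.
  rewrite !big_nat; apply: eq_bigr => r /andP[_ rp].
  by rewrite /exKB -[(r <= p)%N]ltnS rp andbT.
by rewrite E1 E2 E3 E4; ring.
Qed.

Lemma sgB_prod (j : nat -> nat) i m : (0 < i < m)%N ->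
  (-1) ^+ (j i + j m)%N = \prod_(1 <= r < m.+1) sgB laurent i m r (j r).
Proof.
case: m => [|m] /andP[i0 im]; first by [].
rewrite big_nat_recr //= {2}/sgB eqxx orbT exprD; congr (_ * _).
transitivity (\prod_(1 <= r < m.+1 | r == i) ((-1) ^+ j r : laurent)).
  by rewrite big_nat1_eq i0 im.
rewrite big_mkcond !big_nat; apply: eq_bigr => r /andP[_ rm].
by rewrite /sgB (ltn_eqF rm) orbF.
Qed.

(** [S_block] with a and β left free, so that β can be a single kernel or the transformed sequence
    [ubeta]. *)
Definition gS (a : laurent) (beta : nat -> laurent) (k i : nat) : nat -> laurent :=
  if (i <= k)%N then
    block k (fun j =>
      a ^ sum1 j 1 k * q ^ (sum2 j 1 k - sum1 j 1 i)
      / denom j k * beta (j k))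
  else
    let m := (2 * i - k)%N in
    block m (fun j =>
      (-1) ^+ (j i + j m)
      * (a ^ (sum1 j 1 (i - 1) - sum1 j (i + 1) (m - 1))
         * q ^ (sum2 j 1 (i - 1) - sum2 j (i + 1) (m - 1) - sum1 j 1 i
                + sumbin j i (m - 1)))
      / denom j m * beta (j m)).

Lemma S_blockE p k i : S_block p k i = gS (bailey_a p) (bailey_beta p) k i.
Proof. by []. Qed.

Lemma qXz (e : nat) (z : int) : (q ^+ e) ^ z = q ^ (e%:Z * z).
Proof. by rewrite (exprnP q) exprz_exp. Qed.

Lemma gS_small e beta k i n : (i <= k.+1)%N -> gS (q ^+ e) beta k.+1 i n =
  nest k (fun r x => q ^ exS e i r x) (fun=> rq \o Posz)
    (fun x => q ^ exS e i k.+1 x * beta x) n.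
Proof.
move=> leik; rewrite /gS leik.
rewrite (@block_exp k (exS e i) (fun _ _ => 0) (fun _ _ => 1) beta) => [|j].
  apply: eq_nest => [r x _|r x _|x]; [by rewrite mul1r|by rewrite expr0z mul1r|by rewrite mul1r].
by rewrite big1_eq mul1r big1_eq addr0 -exS_sum // qXz -qzD.
Qed.

Lemma gS_big e beta k i n : (k < i)%N -> gS (q ^+ e) beta k i n =
  let m := (2 * i - k)%N in
  nest m.-1 (fun r x => sgB _ i m r x * q ^ exB e i m r x)
    (fun r d => q ^ exKB i r d * rq d)
    (fun x => sgB _ i m m x * q ^ exB e i m m x * beta x) n.
Proof.
move=> ltki /=; rewrite /gS leqNgt ltki /=.
case E : (2 * i - k)%N => [|m] /=; first by lia.
apply: block_exp => j; rewrite -sgB_prod; last by lia.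
by rewrite -exB_sum; [rewrite qXz -qzD|lia].
Qed.

(* The innermost sum of [U], a Bailey step with parameters [oo] and [-q]. *)
Definition ubeta (e : nat) (beta : nat -> laurent) (n : nat) : laurent :=
  (pochhammer q (- q ^+ e) n)^-1 * \sum_(y < n.+1) rq (n - y)%N * (half_weight q e y * beta y).

Lemma qz_merge (c : laurent) (x y z : int) (w : nat) :
  x + y = z + w%:Z -> c * q ^ x * q ^ y = q ^ z * (c * q ^+ w).
Proof. by move=> E; rewrite -mulrA -qzD E qzD mulrCA. Qed.

(** The excluded case is U with k = 1, i = 0: a single index, no outer chain, and (-a)_oo in place
    of a finite product. *)
Lemma U_block_gS p0 k i n e : bailey_a p0 = q ^+ e -> (0 < k)%N || (0 < i)%N ->
  U_block p0 k.+1 i n = gS (q ^+ e) (ubeta e (bailey_beta p0)) k i n.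
Proof.
move=> aE ki; rewrite /U_block aE ltnS.
have [leik|ltki] := leqP i k.
  case: k ki leik => [|k] ki leik; first by move: ki leik; case: (i).
  rewrite gS_small //.
  rewrite (@block_U k (exS e i) (fun _ _ => 0) (fun _ _ => 1) (half_weight q e)
    (pochhammer q (- q ^+ e)) (bailey_beta p0)) => [|j].
    apply: eq_nest => [r x _|r x _|x]; [by rewrite mul1r|by rewrite expr0z mul1r|by rewrite mul1r].
  rewrite big1_eq mul1r big1_eq addr0 -exS_sum // subn1 /= /half_weight qpochE.
  have -> : sum1 j 1 k.+2 = sum1 j 1 k.+1 + (j k.+2)%:Z by rewrite /sum1 big_nat_recr.
  congr (_ / _ * _); rewrite qXz.
  by apply: qz_merge; rewrite mulrDr PoszD PoszM; ring.
rewrite gS_big //=; case E : (2 * i - k)%N => [|p] /=; first by lia.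
rewrite (_ : 2 * i - k.+1 + 2 = p.+2)%N; last by lia.
rewrite (@block_U p (exB e i p.+1) (exKB i) (@sgB _ i p.+1) (half_weight q e)
    (pochhammer q (- q ^+ e)) (bailey_beta p0)) => [//|j].
rewrite !subSS !subn0 -sgB_prod; last by lia.
rewrite -exB_sum; last by lia.
rewrite subSS subn0 /half_weight qpochE mulrA; congr (_ / _ * _).
rewrite -!mulrA; congr (_ * _); rewrite !mulrA qXz -[RHS]mulrA.
by apply: qz_merge; rewrite mulrDr PoszD PoszM; ring.
Qed.

Lemma mul_regroupT (F : fieldType) (s c a x t y d b : F) : x = t * y ->
  s * (c * a * x) / d * b = c * t * (s * (a * y) / d * b).
Proof. by move->; ring. Qed.

Lemma mul_regroupT1 (F : fieldType) (c a x t y d b : F) : x = t * y ->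
  c * a * x / d * b = c * t * (a * y / d * b).
Proof. by move->; ring. Qed.

(** Within a block j_1 = n is fixed, so the factor distinguishing T from S comes out. For i > k >= 1
    one has i >= 2, hence j_1^2 does occur in the exponent of S. *)
Lemma T_blockE p k i n : (0 < k)%N ->
  T_block p k i n = pochhammer q (- q) n * q ^ ('C(n, 2)%:Z - n%:Z * n%:Z) * S_block p k i n.
Proof.
move=> k0; have sum2S (j : nat -> nat) b : (0 < b)%N ->
    sum2 j 1 b = (j 1%N)%:Z * (j 1%N)%:Z + sum2 j 2 b.
  by move=> b0; rewrite /sum2 big_ltn.
rewrite /T_block /S_block; have [leik|ltki] := leqP i k.
  case: k k0 leik => // k _ leik.
  rewrite -(block_head _ (fun n => pochhammer q (- q) n * q ^ ('C(n, 2)%:Z - n%:Z * n%:Z))).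
  apply: eq_block => j; rewrite sum2S //.
  by apply: mul_regroupT1; rewrite -qzD; congr (q ^ _); ring.
case E : (2 * i - k)%N => [|m]; first by lia.
rewrite -(block_head _ (fun n => pochhammer q (- q) n * q ^ ('C(n, 2)%:Z - n%:Z * n%:Z))).
apply: eq_block => j; rewrite sum2S; last by lia.
by apply: mul_regroupT; rewrite -qzD; congr (q ^ _); ring.
Qed.

(** * The limits of the multisums *)

Local Notation kerX := (bkerX q).
Local Notation kerY := (bkerY q).
Local Notation poch := (pochhammer q).
Local Notation whalf := (half_weight q).
Local Notation wf := (std_weight q).
Local Notation H := (qpochoo (- q) q).

Lemma gS_linear e k i : (0 < k)%N || (0 < i)%N ->
  exists m w K h, forall beta n,
    gS (q ^+ e) beta k i n = nest m w K (fun x => h x * beta x) n.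
Proof.
move=> ki; have [leik|ltki] := leqP i k.
  case: k ki leik => [|k] ki leik; first by move: ki leik; case: (i).
  exists k, (fun r x => q ^ exS e i r x), (fun=> rq \o Posz).
  by exists (fun x => q ^ exS e i k.+1 x) => beta n; rewrite gS_small.
pose m := (2 * i - k)%N.
exists m.-1, (fun r x => sgB _ i m r x * q ^ exB e i m r x).
exists (fun r d => q ^ exKB i r d * rq d).
by exists (fun x => sgB _ i m m x * q ^ exB e i m m x) => beta n; rewrite gS_big.
Qed.

Lemma gS_zsum e k i (bs : int -> nat -> laurent) beta n : (0 < k)%N || (0 < i)%N ->
    (forall x, has_zsum (bs^~ x) (beta x)) ->
  has_zsum (fun s => gS (q ^+ e) (bs s) k i n) (gS (q ^+ e) beta k i n).
Proof.
move=> /(gS_linear e)[m [w [K [h E]]]] hb; rewrite E.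
apply: eq_has_zsum (fun s => esym (E (bs s) n)) _.
by apply: (@nest_zsum _ m w K (fun s x => h x * bs s x)) => x; apply: has_zsumZ.
Qed.

Lemma gSZ e k i c beta n : (0 < k)%N || (0 < i)%N ->
  gS (q ^+ e) (fun x => c * beta x) k i n = c * gS (q ^+ e) beta k i n.
Proof.
move=> /(gS_linear e)[m [w [K [h E]]]]; rewrite !E -nestZ.
by apply: eq_nest => // x; rewrite mulrCA.
Qed.

Lemma kerY_eq0 e r (n : nat) : (n%:Z < r)%R \/ (n%:Z + r + e%:Z < 0)%R ->
  kerY e r n = 0.
Proof.
by rewrite /bkerY => -[h|h]; [rewrite rq_neg ?mul0r //; lia|rewrite mulrC rq_neg ?mul0r //; lia].
Qed.

Lemma vge_weight_kerY e r (n : nat) (w : laurent) (z : int) :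
    ((r <= n%:Z)%R -> (0 <= n%:Z + r + e%:Z)%R -> vge z w) ->
  vge z (w * kerY e r n).
Proof.
move=> hw; have [h1|h1] := leP r n; last first.
  by rewrite kerY_eq0 ?mulr0; [exact: vge0|left].
have [h2|h2] := leP 0 (n%:Z + r + e%:Z); last first.
  by rewrite kerY_eq0 ?mulr0; [exact: vge0|right].
by apply: vgeM0 (vge_kerY _ _ _); apply: hw.
Qed.

(** On the support of the kernel n^2 + en >= r^2 + er. The bound is uniform in n and equals the
    exponent of the limit, so growth of the limiting exponents in s also gives the domination. *)
Lemma vge_wf_kerY e r n : vge (r * r + e%:Z * r) (wf e n * kerY e r n).
Proof.
by apply: vge_weight_kerY => h1 h2; apply: vgeW (vge_q _); nia.
Qed.

Lemma wf_dominated e r (M : int) :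
  exists R, forall n, (R <= n)%N -> vge M (wf e n * kerY e r n).
Proof.
exists `|M|%N => n leR; apply: vge_weight_kerY => _ _; apply: vgeW (vge_q _); nia.
Qed.

Lemma vge_whalf e n : vge ('C(n, 2) + e * n)%N (whalf e n).
Proof.
apply: vge0M; last exact: vge_q.
apply/unit1_vge/unit1_poch; last exact/vgeN/vge1_self.
by apply: vgeW vge1_self.
Qed.

Lemma whalf_dominated e r : (0 < e)%N -> forall M : int,
  exists R, forall n, (R <= n)%N -> vge M (whalf e n * kerY e r n).
Proof.
move=> e0 M; exists `|M|%N => n leR; apply: vge_weight_kerY => _ _.
by apply: vgeW (vge_whalf _ _); nia.
Qed.

Lemma kerX_dominated e r (w : nat -> laurent) :
    (forall M : int, exists R, forall n, (R <= n)%N -> vge M (w n * kerY e r n)) ->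
  forall M : int, exists R, forall n, (R <= n)%N -> vge M (w n * kerX e r n).
Proof.
move=> hw M; have [R HR] := hw (M + `|2 * r + e%:Z|); exists R => n /HR h.
rewrite /bkerX mulrCA mulrBl mul1r; apply: vgeB; first by apply: vgeW h; lia.
by apply: vgeW (vgeM (vge_q _) h); lia.
Qed.

Lemma frac_series (F : fieldType) (p a o : F) : p != 0 ->
  p * (a * (o * (p^-1 * p^-1))) = a * (p^-1 * o).
Proof. by move=> h; field. Qed.

Lemma frac_series2 (F : fieldType) (p a o b : F) : p != 0 ->
  p * (a * (o * (b * (p^-1 * p^-1)))) = a * b * (p^-1 * o).
Proof. by move=> h; field. Qed.

Lemma P_neq0 : P != 0.
Proof. by apply/unit1_neq0/unit1_qpochoo; exact: vge1_self. Qed.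

Lemma wf_kerY_series e r : (e <= 1)%N ->
  q_cvg (fun N => \sum_(n < N) wf e n * kerY e r n) (q ^ (r * r + e%:Z * r) * P^-1).
Proof.
move=> le1; rewrite -[P^-1]mulr1 -(frac_series _ _ P_neq0).
apply: (kernel_series (wf_dominated e r) (kerY_cvg e r) (q_cvg_cst 1)) => N.
by rewrite mul1r (wf_kerY q_neq0 q_order).
Qed.

Lemma wf_kerX_series e r : (e <= 2)%N ->
  q_cvg (fun N => \sum_(n < N) wf e n * kerX e r n)
    (q ^ (r * r + e%:Z * r) * (1 - q ^ (2 * r + e%:Z)) * P^-1).
Proof.
move=> le2; rewrite -[P^-1]mulr1 -(frac_series2 _ _ _ P_neq0).
apply: (kernel_series (kerX_dominated (wf_dominated e r)) _ (q_cvg_cst 1)) => [|N].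
  exact: q_cvgZ (kerY_cvg e r).
by rewrite mul1r (wf_kerX q_neq0 q_order).
Qed.

Lemma pochN_cvg : q_cvg (poch (- q)) H.
Proof. by apply: qpochoo_cvg; [apply: vgeN|]; exact: vge1_self. Qed.

Lemma whalf1_kerY_series r :
  q_cvg (fun N => \sum_(n < N) whalf 1 n * kerY 1 r n) (q ^ tri r * (P^-1 * H)).
Proof.
rewrite -(frac_series _ _ P_neq0).
apply: (kernel_series (@whalf_dominated 1 r isT) (kerY_cvg 1 r) pochN_cvg) => N.
exact: (kerY1_half q_neq0 q_order).
Qed.

Lemma whalf1_kerX_series r :
  q_cvg (fun N => \sum_(n < N) whalf 1 n * kerX 1 r n)
    (q ^ tri r * (1 - q ^ (2 * r + 1)) * (P^-1 * H)).
Proof.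
rewrite -(frac_series2 _ _ _ P_neq0).
apply: (kernel_series (kerX_dominated (@whalf_dominated 1 r isT)) _ pochN_cvg) => [|N].
  exact: q_cvgZ (kerY_cvg 1 r).
exact: (kerX1_half q_neq0 q_order).
Qed.

Lemma whalf2_kerX_series r :
  q_cvg (fun N => \sum_(n < N) whalf 2 n * kerX 2 r n)
    ((1 - q ^ (r + 1)) * q ^ (tri r + r) * (P^-1 * H)).
Proof.
rewrite -(frac_series _ _ P_neq0).
apply: (kernel_series (kerX_dominated (@whalf_dominated 2 r isT)) (kerY_cvg 2 r)
  (q_cvg_sub (phi := S) leqnSn pochN_cvg)) => N.
exact: (kerX2_half q_neq0 q_order).
Qed.

Lemma two_term_limit (c kap L : laurent) (T : nat -> int -> laurent)
    (A1 A2 : int -> int) (Bl : nat -> laurent) :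
    (forall n, has_zsum (fun s => c * T n s) (Bl n)) ->
    (forall s, q_cvg (fun N => \sum_(n < N) T n s) ((q ^ A1 s - q ^ A2 s) * kap)) ->
    (exists b : int, forall n s, vge (`|s| - b) (T n s)) ->
    zcvg (fun s => q ^ A1 s - q ^ A2 s) L ->
  q_cvg (fun N => \sum_(n < N) Bl n) (c * kap * L).
Proof.
move=> hB hT [b hb] hL; have [C hC] := vge_exists c.
apply: (zsum_limit (l := fun s => c * kap * (q ^ A1 s - q ^ A2 s)) hB) => [s||].
- rewrite -mulrA [kap * _]mulrC; apply: eq_q_cvg (q_cvgZ c (hT s)) => N.
  by rewrite mulr_sumr.
- exists (b - C) => n s; apply: vgeW (vgeM hC (hb n s)); lia.
by apply: eq_q_cvg (q_cvgZ (c * kap) hL) => W; rewrite -bsumZ.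
Qed.

Lemma vge_two (x y : laurent) (a b : int) : vge a x -> vge b y ->
  forall z, (z <= a)%R -> (z <= b)%R -> vge z (x - y).
Proof. by move=> hx hy z za zb; apply: vgeB; [apply: vgeW hx|apply: vgeW hy]. Qed.

Lemma gS_kerX e r k i n : (e <= 1)%N -> gS (q ^+ e.+1) (kerX e.+1 r) k i.+1 n =
  q ^ ((k%:Z - i.+1%:Z) * (r * r + e.+1%:Z * r) + i%:Z * (r * r + e%:Z * r))
    * (wf e n * kerY e r n)
  - q ^ ((k%:Z - i.+1%:Z) * (r * r + e.+1%:Z * r) + i%:Z * (r * r + e%:Z * r)
      + i.+1%:Z * (2 * r + e.+1%:Z)) * (wf e n * kerY e (r + 1) n).
Proof.
move=> le1; rewrite -(nest_wf_kerX q_neq0 q_order) //.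
have [leik|ltki] := leqP i.+1 k.
  case: k leik => // k leik; rewrite gS_small //.
  exact: (nest_exS q_neq0 q_order).
rewrite gS_big //; exact: (nest_exB q_neq0 q_order).
Qed.

Lemma mul_kerX (F : fieldType) (b x w : F) e r n : x * (w * bkerX b e r n) =
  x * (w * bkerY b e r n) - x * b ^ (2 * r + e%:Z) * (w * bkerY b e r n).
Proof. by rewrite /bkerX; ring. Qed.

(** D is the exponent of the Bailey pair; [A1] adds k eigenvalue exponents of base a and corrects
    each of the i indices of base a/q by -3s. The case i = 0 is separate: there is no base change,
    and X itself is summed at base a. *)
Lemma gS_limit e k i (D A1 A2 : int -> int) (c L : laurent) (beta : nat -> laurent) :
    (e <= 1)%N -> (0 < k)%N || (0 < i)%N ->
    (forall n, has_zsum (fun s => c * q ^ D s * kerX e.+1 (3 * s) n) (beta n)) ->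
    (forall s, A1 s = D s + k%:Z * (3 * s * (3 * s) + e.+1%:Z * (3 * s)) - i%:Z * (3 * s)) ->
    (forall s, A2 s = A1 s + i.+1%:Z * (2 * (3 * s) + e.+1%:Z)) ->
    (exists b : int, forall s, (`|s| - b <= A1 s)%R) ->
    (exists b : int, forall s, (`|s| - b <= A2 s)%R) ->
    zcvg (fun s => q ^ A1 s - q ^ A2 s) L ->
  q_cvg (fun N => \sum_(n < N) gS (q ^+ e.+1) beta k i n) (c * P^-1 * L).
Proof.
move=> le1 ki hbeta hA1 hA2 [b1 hb1] [b2 hb2] hL.
pose T n s := q ^ D s * gS (q ^+ e.+1) (kerX e.+1 (3 * s)) k i n.
have dom (x y : laurent) (s : int) : vge (A1 s) x -> vge (A2 s) y ->
    vge (`|s| - (`|b1| + `|b2|)) (x - y).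
  move=> hx hy; apply: (vge_two hx hy); [have := hb1 s|have := hb2 s]; lia.
apply: (@two_term_limit c P^-1 L T A1 A2) => // [n|s|].
- apply: eq_has_zsum (gS_zsum e.+1 n ki hbeta) => s.
  by rewrite gSZ // mulrA.
- rewrite {}/T; case: i ki hbeta hA1 hA2 dom => [|i] ki _ hA1 hA2 _.
    case: k ki hA1 => // k _ hA1.
    have := q_cvgZ (q ^ (D s + k%:Z * (3 * s * (3 * s) + e.+1%:Z * (3 * s))))
      (wf_kerX_series (3 * s) (le1 : (e.+1 <= 2)%N)).
    rewrite [q ^ _ * (_ * _ * _)]mulrA [q ^ _ * (q ^ _ * _)]mulrA -qzD mulrBr mulr1 -qzD.
    rewrite (_ : D s + _ + _ = A1 s); last by rewrite hA1; lia.
    rewrite (_ : A1 s + _ = A2 s); last by rewrite hA2; lia.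
    apply: eq_q_cvg => N; rewrite mulr_sumr; apply: eq_bigr => n _.
    by rewrite gS_small // (nest_exS0 q_neq0 q_order) // qzD -!mulrA.
  pose a := (k%:Z - i.+1%:Z) * (3 * s * (3 * s) + e.+1%:Z * (3 * s))
    + i%:Z * (3 * s * (3 * s) + e%:Z * (3 * s)).
  have := q_cvgB (q_cvgZ (q ^ (D s + a)) (wf_kerY_series (3 * s) le1))
    (q_cvgZ (q ^ (D s + (a + i.+1%:Z * (2 * (3 * s) + e.+1%:Z))))
      (wf_kerY_series (3 * s + 1) le1)).
  rewrite ![q ^ _ * (q ^ _ * _)]mulrA -!qzD -mulrBl.
  rewrite (_ : D s + a + _ = A1 s); last by rewrite hA1 /a; ring.
  rewrite (_ : D s + (a + _) + _ = A2 s); last by rewrite hA2 hA1 /a; ring.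
  apply: eq_q_cvg => N; rewrite !mulr_sumr -sumrB; apply: eq_bigr => n _.
  by rewrite gS_kerX // -/a mulrBr; congr (_ - _); rewrite [RHS]mulrA -qzD.
exists (`|b1| + `|b2|) => n s.
rewrite {}/T; case: i ki hbeta hA1 hA2 => [|i] ki _ hA1 hA2.
  case: k ki hA1 => // k _ hA1.
  rewrite gS_small // (nest_exS0 q_neq0 q_order) // [q ^ _ * (q ^ _ * _)]mulrA -qzD.
  rewrite mul_kerX -qzD; apply: dom.
    apply: vgeW (vgeM (vge_q _) (vge_wf_kerY _ _ _)); rewrite hA1; lia.
  apply: vgeW (vgeM (vge_q _) (vge_wf_kerY _ _ _)); rewrite hA2 hA1; lia.
rewrite gS_kerX // mulrBr ![q ^ _ * (q ^ _ * _)]mulrA -!qzD; apply: dom.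
  by apply: vgeW (vgeM (vge_q _) (vge_wf_kerY _ _ _)); rewrite hA1; lia.
by apply: vgeW (vgeM (vge_q _) (vge_wf_kerY _ _ _)); rewrite hA2 hA1; lia.
Qed.

Lemma vge_whalf1_kerY r n : vge (tri r) (whalf 1 n * kerY 1 r n).
Proof.
apply: vge_weight_kerY => h1 h2; apply: vgeW (vge_whalf 1 n).
rewrite mul1n (_ : ('C(n, 2) + n)%N = tri n :> int); last by rewrite /tri binS bin1.
have := triE r; have := triE n; nia.
Qed.

(** For negative r the support reaches down to n = -r-2, below |r|; this is what the correction pays
    for. *)
Lemma vge_whalf2_kerY r n : vge (tri r - `|r|) (whalf 2 n * kerY 2 r n).
Proof.
apply: vge_weight_kerY => h1 h2; apply: vgeW (vge_whalf 2 n).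
rewrite (_ : ('C(n, 2) + 2 * n)%N = tri n + n%:Z :> int); last first.
  by rewrite /tri binS bin1; lia.
have := triE r; have := triE n; nia.
Qed.

Definition tfac (n : nat) : laurent := poch (- q) n * q ^ ('C(n, 2)%:Z - n%:Z * n%:Z).

Lemma tfac_wf e n : tfac n * wf e n = whalf e n.
Proof.
rewrite /tfac /std_weight -mulrA -qzD /half_weight (exprnP q); congr (_ * q ^ _).
by rewrite PoszD PoszM; ring.
Qed.

Lemma mul_regroup5 (F : fieldType) (x y t w k : F) :
  x * y * (t * w * k) = x * (t * (y * (w * k))).
Proof. by ring. Qed.

(** The sum over n carries the half weight, so its eigenvalue exponent is a triangular number. For i
    >= 1 it is taken after the base change, relative to q; for i = 0 still relative to q^2, where
    [kerX2_half] applies. *)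
Lemma T_limit k i (D A1 A2 : int -> int) (c L : laurent) (beta : nat -> laurent) :
    (0 < k)%N -> (forall s, 0 <= D s)%R ->
    (forall n, has_zsum (fun s => c * q ^ D s * kerX 2 (3 * s) n) (beta n)) ->
    (forall s, A1 s = D s + (k%:Z - 1) * (3 * s * (3 * s) + 2 * (3 * s))
       - (i%:Z - 1) * (3 * s) + tri (3 * s)) ->
    (forall s, A2 s = A1 s + (2 * i%:Z + 1) * (3 * s + 1)) ->
    (exists b : int, forall s, (`|s| - b <= A1 s)%R) ->
    (exists b : int, forall s, (`|s| - b <= A2 s)%R) ->
    zcvg (fun s => q ^ A1 s - q ^ A2 s) L ->
  q_cvg (fun N => \sum_(n < N) tfac n * gS (q ^+ 2) beta k i n) (c * (P^-1 * H) * L).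
Proof.
move=> k0 D0 hbeta hA1 hA2 [b1 hb1] [b2 hb2] hL.
have ki : (0 < k)%N || (0 < i)%N by rewrite k0.
pose T n s := q ^ D s * (tfac n * gS (q ^+ 2) (kerX 2 (3 * s)) k i n).
apply: (@two_term_limit c (P^-1 * H) L T A1 A2
  (fun n => tfac n * gS (q ^+ 2) beta k i n)) => // [n|s|].
- apply: eq_has_zsum (has_zsumZ (tfac n) (gS_zsum 2 n ki hbeta)) => s.
  by rewrite gSZ // /T -mulrA mulrCA; congr (_ * _); rewrite mulrCA.
- rewrite {}/T; case: i ki hbeta hA1 hA2 => [|i] ki _ hA1 hA2.
    case: k k0 {ki} hA1 => // k _ hA1.
    have := q_cvgZ (q ^ (D s + k%:Z * (3 * s * (3 * s) + 2%N%:Z * (3 * s))))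
      (whalf2_kerX_series (3 * s)).
    rewrite [q ^ _ * (_ * _ * _)]mulrA [(1 - _) * _]mulrC [q ^ _ * (q ^ _ * _)]mulrA.
    rewrite -qzD mulrBr mulr1 -qzD.
    rewrite (_ : D s + _ + _ = A1 s); last by rewrite hA1; lia.
    rewrite (_ : A1 s + _ = A2 s); last by rewrite hA2; lia.
    apply: eq_q_cvg => N; rewrite mulr_sumr; apply: eq_bigr => n _.
    by rewrite gS_small // (nest_exS0 q_neq0 q_order) // qzD -tfac_wf mul_regroup5.
  pose a := (k%:Z - i.+1%:Z) * (3 * s * (3 * s) + 2%N%:Z * (3 * s))
    + i%:Z * (3 * s * (3 * s) + 1%N%:Z * (3 * s)).
  have := q_cvgB (q_cvgZ (q ^ (D s + a)) (whalf1_kerY_series (3 * s)))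
    (q_cvgZ (q ^ (D s + (a + i.+1%:Z * (2 * (3 * s) + 2%N%:Z))))
      (whalf1_kerY_series (3 * s + 1))).
  rewrite ![q ^ _ * (q ^ _ * _)]mulrA -!qzD -mulrBl.
  have tS : tri (3 * s + 1) = tri (3 * s) + (3 * s + 1).
    by have := triE (3 * s); have := triE (3 * s + 1); nia.
  rewrite (_ : D s + a + _ = A1 s); last by rewrite hA1 /a; lia.
  rewrite (_ : D s + (a + _) + _ = A2 s); last by rewrite hA2 hA1 /a tS; lia.
  apply: eq_q_cvg => N; rewrite !mulr_sumr -sumrB; apply: eq_bigr => n _.
  rewrite gS_kerX // -/a [tfac n * _]mulrBr mulrBr -tfac_wf.
  by congr (_ - _); rewrite qzD mul_regroup5.
(* For i = 0 the valuation is bounded through D >= 0 and the quadratic tri(3s), which outgrows the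
   linear losses; 100 is ample room for its small values. *)
exists (`|b1| + `|b2| + 100) => n s.
rewrite {}/T; case: i ki hbeta hA1 hA2 => [|i] ki _ hA1 hA2.
  case: k k0 {ki} hA1 => // k _ hA1.
  rewrite gS_small // (nest_exS0 q_neq0 q_order) // -mul_regroup5 tfac_wf -qzD.
  rewrite mul_kerX -qzD.
  have := D0 s; have := triE (3 * s) => t3 d0.
  have kk : (0 <= k%:Z * (3 * s * (3 * s) + 2%N%:Z * (3 * s)))%R.
    by apply: mulr_ge0 => //; nia.
  apply: (vge_two (vgeM (vge_q _) (vge_whalf2_kerY _ _))
                  (vgeM (vge_q _) (vge_whalf2_kerY _ _))); nia.
rewrite gS_kerX // [tfac n * _]mulrBr mulrBr -!mul_regroup5 tfac_wf -!qzD.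
have tS : tri (3 * s + 1) = tri (3 * s) + (3 * s + 1).
  by have := triE (3 * s); have := triE (3 * s + 1); nia.
apply: (vge_two (vgeM (vge_q _) (vge_whalf1_kerY _ _))
                (vgeM (vge_q _) (vge_whalf1_kerY _ _))).
  by have := hb1 s; rewrite hA1; lia.
by have := hb2 s; rewrite hA2 hA1 tS; lia.
Qed.

Lemma ubeta_kerX r n : ubeta 1 (kerX 1 r) n = q ^ tri r * kerX 1 r n.
Proof.
have p0 : poch (- q) n != 0.
  apply/unit1_neq0/unit1_poch; last exact/vgeN/vge1_self.
  by apply: vgeW vge1_self.
by rewrite /ubeta expr1 (kerX1_half q_neq0 q_order) mulrCA mulKf.
Qed.

Lemma ubeta_zsum (D : int -> int) (c : laurent) (beta : nat -> laurent) n :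
    (forall n, has_zsum (fun s => c * q ^ D s * kerX 1 (3 * s) n) (beta n)) ->
  has_zsum (fun s => c * q ^ (D s + tri (3 * s)) * kerX 1 (3 * s) n) (ubeta 1 beta n).
Proof.
move=> hbeta; pose u s m := c * q ^ D s * kerX 1 (3 * s) m.
have : has_zsum (fun s => ubeta 1 (u s) n) (ubeta 1 beta n).
  apply: has_zsumZ.
  apply: (@has_zsum_sum _ n.+1 (fun y s => rq (n - y)%N * (whalf 1 y * u s y))
    (fun y => rq (n - y)%N * (whalf 1 y * beta y))) => y _.
  by apply/has_zsumZ/has_zsumZ/hbeta.
apply: eq_has_zsum => s; transitivity (c * q ^ D s * ubeta 1 (kerX 1 (3 * s)) n).
  rewrite /ubeta [RHS]mulrCA [in RHS]mulr_sumr; congr (_ * _); apply: eq_bigr => y _.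
  by rewrite [RHS]mulrCA; congr (_ * _); rewrite mulrCA.
by rewrite ubeta_kerX qzD !mulrA.
Qed.

Lemma mul_regroupE (F : fieldType) (h a x y b : F) :
  h^-1 * (a * (x * y) * b) = a * x * y / h * b.
Proof. by ring. Qed.

Lemma U_limit p k i (D A1 A2 : int -> int) (c L : laurent) :
    bailey_a p = q -> (0 < k)%N ->
    (forall n, has_zsum (fun s => c * q ^ D s * kerX 1 (3 * s) n) (bailey_beta p n)) ->
    (forall s, A1 s = D s + tri (3 * s) + (k%:Z - 1) * (3 * s * (3 * s) + 3 * s)
       - i%:Z * (3 * s)) ->
    (forall s, A2 s = A1 s + i.+1%:Z * (2 * (3 * s) + 1)) ->
    (exists b : int, forall s, (`|s| - b <= A1 s)%R) ->
    (exists b : int, forall s, (`|s| - b <= A2 s)%R) ->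
    zcvg (fun s => q ^ A1 s - q ^ A2 s) L ->
  q_cvg (fun N => \sum_(n < N) U_block p k i n) (c * P^-1 * L).
Proof.
move=> aq k0 hbeta hA1 hA2 hb1 hb2 hL.
case: k k0 hA1 => // k _ hA1; case ki: ((0 < k)%N || (0 < i)%N).
  apply: (@eq_q_cvg (fun N => \sum_(n < N) gS (q ^+ 1) (ubeta 1 (bailey_beta p)) k i n)).
    by move=> N; apply: eq_bigr => n _; rewrite (@U_block_gS p k i n 1 aq ki).
  apply: (@gS_limit 0 k i (fun s => D s + tri (3 * s)) A1 A2 c L) => // [n|s].
  - exact: ubeta_zsum.
  - by rewrite hA1; lia.
case: k i ki hA1 hA2 => [|//] [|//] _ hA1 hA2.
(* The remaining case k = 1, i = 0: the constant 1/(-q)_oo in the summand cancels the (-q)_oo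
   produced by the half-weight series. *)
have H1 : unit1 H by apply: unit1_qpochoo; [apply: vgeN|]; exact: vge1_self.
have H0 := unit1_neq0 H1.
have [b1 {}hb1] := hb1; have [b2 {}hb2] := hb2.
have E n : H^-1 * (whalf 1 n * bailey_beta p n) = U_block p 1 0 n.
  rewrite /U_block /= block1 aq /at_seq /= /sum1 /sum2 /denom !big_nat1 /= !big_geq //.
  rewrite mul1r subrr add0r /half_weight -qpochE mul1n addnC exprD.
  exact: mul_regroupE.
have R : q_cvg (fun N => \sum_(n < N) whalf 1 n * bailey_beta p n) (c * (P^-1 * H) * L).
  pose T n s := q ^ D s * (whalf 1 n * kerX 1 (3 * s) n).
  apply: (@two_term_limit c (P^-1 * H) L T A1 A2
    (fun n => whalf 1 n * bailey_beta p n)) => // [n|s|].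
  - apply: eq_has_zsum (has_zsumZ (whalf 1 n) (hbeta n)) => s.
    by rewrite /T [LHS]mulrCA [RHS]mulrA.
  - rewrite {}/T; have := q_cvgZ (q ^ D s) (whalf1_kerX_series (3 * s)).
    rewrite [q ^ _ * (_ * _ * _)]mulrA [q ^ _ * (q ^ _ * _)]mulrA -qzD mulrBr mulr1 -qzD.
    rewrite (_ : D s + _ = A1 s); last by rewrite hA1; lia.
    rewrite (_ : A1 s + _ = A2 s); last by rewrite hA2; lia.
    by apply: eq_q_cvg => N; rewrite mulr_sumr.
  exists (`|b1| + `|b2|) => n s; rewrite /T mul_kerX -qzD.
  apply: (vge_two (vgeM (vge_q _) (vge_whalf1_kerY _ _))
                  (vgeM (vge_q _) (vge_whalf1_kerY _ _))).
    by have := hb1 s; rewrite hA1; lia.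
  by have := hb2 s; rewrite hA2 hA1; lia.
have := q_cvgZ H^-1 R.
rewrite (_ : H^-1 * _ = c * P^-1 * L).
  by apply: eq_q_cvg => N; rewrite mulr_sumr; apply: eq_bigr => n _; rewrite E.
rewrite -[RHS]mul1r -(mulVf H0) -!mulrA; congr (_ * _).
by rewrite [RHS]mulrCA; congr (_ * _); rewrite mulrCA.
Qed.

(** * Identification with the characters *)

Lemma add1q_neq0 t : 1 + q ^+ t != 0.
Proof.
rewrite qXn -tofrac1 -tofracD tofrac_eq0; apply/eqP => /(congr1 (fun f => fps_coef f 0)).
rewrite fps_coefD -[fps_of_poly _ ^+ t]mulr1 coef_fpsXM /= !coef1 coef0.
by case: (t).
Qed.

Lemma sum_cubes (F : fieldType) (b : F) n : 1 - -1 * b ^+ 3 ^+ n =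
  (1 - b ^+ n + b ^+ (2 * n)) * (1 - -1 * b ^+ n).
Proof. by rewrite -exprM mulnC [(2 * n)%N]mulnC !exprM; ring. Qed.

(** The factorisation 1 + x^3 = (1 - x + x^2)(1 + x) at x = q^t identifies the product of [pair5]
    with (-1;q^3)_n/(-1;q)_n. *)
Lemma poch_cube (n : nat) : pochhammer (q ^+ 3) (- 1) n =
  (\prod_(t < n) (1 - q ^+ t + q ^+ (2 * t))) * pochhammer q (- 1) n.
Proof.
elim: n => [|n IH]; first by rewrite !poch0 big_ord0 mulr1.
rewrite !pochS big_ord_recr /= IH -!mulrA; congr (_ * _).
by rewrite [RHS]mulrCA sum_cubes.
Qed.

Lemma pair_P1 n : has_zsum (fun s => 1 * q ^ (6 * s * s - s) * bkerX q 1 (3 * s) n)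
  (bailey_beta P1 n).
Proof.
have h (s : int) : q ^ (6 * s * s + 5 * s + 1) = q ^ (6 * s * s - s) * q ^ (6 * s + 1).
  by rewrite -qzD; congr (q ^ _); ring.
have := has_zsum_pair1 q_neq0 q_order n h.
have [-> _] := pair12 q_neq0 q_order n.
by rewrite /bailey_beta mul1r; apply: eq_has_zsum => s; rewrite mul1r.
Qed.

Lemma pair_P3 n : has_zsum (fun s => 1 * q ^ (3 * s * s - 2 * s) * bkerX q 1 (3 * s) n)
  (bailey_beta P3 n).
Proof.
have h (s : int) : q ^ (3 * s * s + 4 * s + 1) = q ^ (3 * s * s - 2 * s) * q ^ (6 * s + 1).
  by rewrite -qzD; congr (q ^ _); ring.
have := has_zsum_pair1 q_neq0 q_order n h; rewrite (pair3 q_neq0 q_order).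
rewrite /bailey_beta (_ : n%:Z * n%:Z - n%:Z = (n ^ 2 - n)%N); last by nia.
by apply: eq_has_zsum => s; rewrite mul1r.
Qed.

Lemma pair_P5 n : has_zsum (fun s => 1 * q ^ tri (3 * s - 1) * bkerX q 1 (3 * s) n)
  (bailey_beta P5 n).
Proof.
have h (s : int) : q ^ tri (3 * s + 1) = q ^ tri (3 * s - 1) * q ^ (6 * s + 1).
  rewrite -qzD; congr (q ^ _).
  by have := triE (3 * s + 1); have := triE (3 * s - 1); nia.
have := has_zsum_pair1 q_neq0 q_order n h; rewrite (pair5 q_neq0 q_order).
have p0 : pochhammer q (- 1) n != 0.
  rewrite /pochhammer; apply/prodf_neq0 => t _; rewrite mulN1r opprK; exact: add1q_neq0.
rewrite /bailey_beta !qpochE poch_cube invfM mulrACA mulfV // mulr1.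
by apply: eq_has_zsum => s; rewrite mul1r.
Qed.

(** Since (q)_(2n+1) = (1-q) (q^2)_(2n), passing to a = q^2 introduces the factor 1 - q seen in the
    final formulas. *)
Lemma poch_q2 n : (1 - q) * qfacV q (2 * n + 1)%N = (pochhammer q (q ^+ 2) (2 * n))^-1.
Proof.
rewrite addn1 -[qfacV q _]/((pochhammer q q (2 * n).+1)^-1) pochSl -expr2 invfM mulVKf //.
by rewrite subr_eq0 eq_sym; exact: (q_order 0).
Qed.

Lemma pair_P2 n :
  has_zsum (fun s => (1 - q) * q ^ (6 * s * s + s) * bkerX q 2 (3 * s) n)
    (bailey_beta P2 n).
Proof.
have h (s : int) : q ^ (6 * s * s + 7 * s + 2) = q ^ (6 * s * s + s) * q ^ (6 * s + 2).
  by rewrite -qzD; congr (q ^ _); ring.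
have := has_zsumZ (1 - q) (has_zsum_pair2 q_neq0 q_order n h).
have [_ ->] := pair12 q_neq0 q_order n; rewrite poch_q2 /bailey_beta mul1r.
by apply: eq_has_zsum => s; rewrite mulrA.
Qed.

Lemma pair_P4 n :
  has_zsum (fun s => (1 - q) * q ^ (3 * s * s - s) * bkerX q 2 (3 * s) n)
    (bailey_beta P4 n).
Proof.
have h (s : int) : q ^ (3 * s * s + 5 * s + 2) = q ^ (3 * s * s - s) * q ^ (6 * s + 2).
  by rewrite -qzD; congr (q ^ _); ring.
have := has_zsumZ (1 - q) (has_zsum_pair2 q_neq0 q_order n h).
rewrite (pair4 q_neq0 q_order) mulrCA poch_q2 /bailey_beta.
rewrite (_ : n%:Z * n%:Z = (n ^ 2)%N); last by nia.
by apply: eq_has_zsum => s; rewrite mulrA.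
Qed.

(** * Matching theta exponents with the quintuple product *)

Lemma zcvg_opp (E1 E2 : int -> int) L : zcvg (fun s => q ^ E1 s - q ^ E2 s) L ->
  zcvg (fun s => q ^ E1 (- s) - q ^ E2 s) L.
Proof.
apply: eq_q_cvg => W.
by rewrite !bsumB (bsum_opp W (fun s => q ^ E1 s)).
Qed.

(** Reflecting only the second exponentials exchanges two boundary terms of the symmetric window,
    and both tend to 0 by the growth of [E2]. *)
Lemma zcvg_flip (E1 E2 : int -> int) L :
    (exists b : int, forall s, (`|s| - b <= E2 s)%R) ->
    zcvg (fun s => q ^ E1 s - q ^ E2 s) L ->
  zcvg (fun s => q ^ E1 s - q ^ E2 (- 1 - s)) L.
Proof.
move=> [b hb] hL.
have h0 : q_cvg (fun W => q ^ E2 W%:Z - q ^ E2 (- W.+1%:Z)) 0.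
  apply/q_cvgP => M; exists `|(M + b)%R|%N => n le; rewrite subr0.
  by apply: (vge_two (vge_q _) (vge_q _));
     [have := hb n%:Z|have := hb (- n.+1%:Z)]; lia.
have := q_cvgD hL h0; rewrite addr0; apply: eq_q_cvg => W.
rewrite !bsumB -addrA; congr (_ + _).
rewrite (@eq_bsum _ W (fun s => q ^ E2 (- 1 - s)) (fun s => q ^ E2 (- (s + 1)))).
  rewrite (bsum_shift W (fun s => q ^ E2 (- s))) (bsum_opp W (fun s => q ^ E2 s)) opprK.
  by move: (bsum _ _) => x; rewrite opprB opprD addrCA.
by move=> s; congr (q ^ E2 _); lia.
Qed.

Lemma quint_series1 (M t : nat) (A1 A2 : int -> int) :
    (0 < t)%N -> (2 * t < M)%N ->
    (forall s, 2 * A1 s = 3 * M%:Z * (s * s) + (M%:Z - 6 * t%:Z) * s) ->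
    (forall s, 2 * A2 s = 3 * M%:Z * (s * s) + (M%:Z + 6 * t%:Z) * s + 2 * t%:Z) ->
  [/\ exists b : int, forall s, (`|s| - b <= A1 s)%R,
      exists b : int, forall s, (`|s| - b <= A2 s)%R &
      zcvg (fun s => q ^ A1 s - q ^ A2 s) (quint_product M t)].
Proof.
move=> t0 tM h1 h2.
have E1 s : A1 s = quint_exp1 M t (- s).
  by apply: (@mulfI _ 2) => //; rewrite h1 quint_exp1E; ring.
have E2 s : A2 s = quint_exp2 M t s.
  by apply: (@mulfI _ 2) => //; rewrite h2 quint_exp2E; ring.
split.
- apply: (@quad_bound _ (3 * M%:Z) (M%:Z - 6 * t%:Z) 0); first by lia.
  by move=> s; rewrite h1 addr0.
- by apply: (@quad_bound _ (3 * M%:Z) (M%:Z + 6 * t%:Z) (2 * t%:Z)) => //; lia.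
apply: eq_q_cvg (zcvg_opp (quint_limit t0 tM)) => W.
by apply: eq_bsum => s; rewrite E1 E2.
Qed.

(** For a = q^2 the exponents are those of the quintuple product at s and at -1-s, whereas for a = q
    they are those at -s and at s. *)
Lemma quint_series2 (M t : nat) (A1 A2 : int -> int) :
    (0 < t)%N -> (2 * t < M)%N ->
    (forall s, 2 * A1 s = 3 * M%:Z * (s * s) + (6 * t%:Z - M%:Z) * s) ->
    (forall s, 2 * A2 s = 3 * M%:Z * (s * s) + (5 * M%:Z - 6 * t%:Z) * s
        + (2 * M%:Z - 4 * t%:Z)) ->
  [/\ exists b : int, forall s, (`|s| - b <= A1 s)%R,
      exists b : int, forall s, (`|s| - b <= A2 s)%R &
      zcvg (fun s => q ^ A1 s - q ^ A2 s) (quint_product M t)].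
Proof.
move=> t0 tM h1 h2.
have E1 s : A1 s = quint_exp1 M t s.
  by apply: (@mulfI _ 2) => //; rewrite h1 quint_exp1E; ring.
have E2 s : A2 s = quint_exp2 M t (- 1 - s).
  by apply: (@mulfI _ 2) => //; rewrite h2 quint_exp2E; ring.
split.
- apply: (@quad_bound _ (3 * M%:Z) (6 * t%:Z - M%:Z) 0); first by lia.
  by move=> s; rewrite h1 addr0.
- by apply: (@quad_bound _ (3 * M%:Z) (5 * M%:Z - 6 * t%:Z) (2 * M%:Z - 4 * t%:Z)) => //; lia.
apply: eq_q_cvg (zcvg_flip (quint_exp2_bound t0 tM) (quint_limit t0 tM)) => W.
by apply: eq_bsum => s; rewrite E1 E2.
Qed.

Lemma chi_quint (s0 s1 : nat) :
  chi (s0, s1) = P^-1 * quint_product (s0 + 2 * s1 + 3) (s1 + 1).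
Proof.
rewrite /chi /quint_product /modulus /= mulrC.
rewrite (_ : s0 + 2 * s1 + 3 - (s1 + 1) = s0 + s1 + 2)%N; last by lia.
rewrite (_ : s0 + 2 * s1 + 3 - 2 * (s1 + 1) = s0 + 1)%N; last by lia.
by rewrite (_ : s0 + 2 * s1 + 3 + 2 * (s1 + 1) = s0 + 4 * s1 + 5)%N; last by lia.
Qed.

Lemma summableE (u : nat -> laurent) l : q_cvg (fun n => \sum_(j < n) u j) l ->
  q_summable u /\ q_sum u = l.
Proof. by move=> h; split; [exists l|apply: q_limE]. Qed.

(** * Labels of the standard modules and the ten families *)

Lemma num_standardE l : num_standard l = (l./2).+1.
Proof.
pose f (i : 'I_(l./2).+1) : 'I_l.+1 * 'I_l.+1 := (inord (l - 2 * i), inord i).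
have le2 (i : 'I_(l./2).+1) : (2 * i <= l)%N.
  by have := ltn_ord i; have := odd_double_half l; lia.
have f2 i : val (f i).2 = i by rewrite /= inordK //; have := le2 i; lia.
have finj : injective f.
  by move=> i j /(congr1 (fun x => val x.2)); rewrite !f2 => /val_inj.
rewrite -[RHS]card_ord -(card_codom finj); apply: eq_card => -[a b].
rewrite inE /level /=; apply/eqP/codomP => [E|[i [-> ->]]].
  have hb : (b < (l./2).+1)%N by have := odd_double_half l; lia.
  exists (Ordinal hb); congr pair; apply: val_inj => /=.
    by rewrite inordK; lia.
  by rewrite inordK.
by rewrite !inordK; have := le2 i; lia.
Qed.

(** A label of level l is determined by s1 between 0 and l/2. The map [sg] from i to s1 is the
    identity or the reversal in every family, so being an involution is the convenient form of
    bijectivity. *)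
Lemma standard_once (l N m imax : nat) (Om : nat -> nat * nat) (sg : nat -> nat) :
    imax = l./2 -> N = imax.+1 -> m = (2 * (l + 3))%N ->
    (forall i, (i <= imax)%N -> level (Om i) = l /\ (Om i).2 = sg i) ->
    (forall i, (i <= imax)%N -> (sg i <= imax)%N /\ sg (sg i) = i) ->
  every_standard_once l N m imax Om.
Proof.
move=> El EN Em hOm hsg; split.
- by move=> i /hOm[].
- move=> [a b] /= E; have hb : (b <= imax)%N.
    by rewrite El; have := odd_double_half l; move: E; rewrite /level /=; lia.
  have [hs ss] := hsg b hb; exists (sg b); split.
    split=> //; have [lv o2] := hOm _ hs; move: lv o2 E; rewrite ss /level.
    by case: (Om (sg b)) => x y /= lv <-; move: lv => <- E; congr pair; lia.
  by move=> i [hi Oi]; have [_] := hOm i hi; rewrite Oi /= => ->; have [] := hsg i hi.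
- by rewrite num_standardE EN El.
by move=> i /hOm[]; rewrite /modulus /level => -> _.
Qed.

(** The last two hypotheses compare the quadratic and linear coefficients of 2 [A1] with those of
    the quintuple product at M = s0 + 2 s1 + 3, t = s1 + 1. Each family is thereby reduced to linear
    arithmetic. *)
Lemma S_odd p k i (D : int -> int) (a b : int) s0 s1 :
    bailey_a p = q -> (0 < k)%N ->
    (forall n, has_zsum (fun s => 1 * q ^ D s * bkerX q 1 (3 * s) n) (bailey_beta p n)) ->
    (forall s, 2 * D s = a * (s * s) + b * s) -> s1 = i ->
    3 * (s0 + 2 * s1 + 3)%N%:Z = a + 18 * k%:Z ->
    (s0 + 2 * s1 + 3)%N%:Z - 6 * (s1 + 1)%N%:Z = b + 6 * k%:Z - 6 * i%:Z ->
  q_summable (S_block p k i) /\ S_sum p k i = chi (s0, s1).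
Proof.
move=> aq k0 hp hD si hM ht.
pose A1 s := D s + k%:Z * (3 * s * (3 * s) + 1%N%:Z * (3 * s)) - i%:Z * (3 * s).
pose A2 s := A1 s + i.+1%:Z * (2 * (3 * s) + 1%N%:Z).
have h1 s : 2 * A1 s = 3 * (s0 + 2 * s1 + 3)%N%:Z * (s * s)
    + ((s0 + 2 * s1 + 3)%N%:Z - 6 * (s1 + 1)%N%:Z) * s.
  by rewrite hM ht mulrBr mulrDr hD; ring.
have h2 s : 2 * A2 s = 3 * (s0 + 2 * s1 + 3)%N%:Z * (s * s)
    + ((s0 + 2 * s1 + 3)%N%:Z + 6 * (s1 + 1)%N%:Z) * s + 2 * (s1 + 1)%N%:Z.
  rewrite mulrDr h1 si -[i.+1]addn1 !PoszD; ring.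
have [b1 b2 hL] := @quint_series1 (s0 + 2 * s1 + 3) (s1 + 1) A1 A2 ltac:(lia) ltac:(lia) h1 h2.
apply: summableE; rewrite chi_quint -[P^-1]mul1r.
rewrite S_blockE aq; apply: (gS_limit (e := 0) _ _ hp _ _ b1 b2 hL) => //.
by rewrite k0.
Qed.

Lemma U_odd p k i (D : int -> int) (a b : int) s0 s1 :
    bailey_a p = q -> (0 < k)%N ->
    (forall n, has_zsum (fun s => 1 * q ^ D s * bkerX q 1 (3 * s) n) (bailey_beta p n)) ->
    (forall s, 2 * D s = a * (s * s) + b * s) -> s1 = i ->
    3 * (s0 + 2 * s1 + 3)%N%:Z = a + 18 * k%:Z - 9 ->
    (s0 + 2 * s1 + 3)%N%:Z - 6 * (s1 + 1)%N%:Z = b + 6 * k%:Z - 3 - 6 * i%:Z ->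
  q_summable (U_block p k i) /\ U_sum p k i = chi (s0, s1).
Proof.
move=> aq k0 hp hD si hM ht.
pose A1 s := D s + tri (3 * s) + (k%:Z - 1) * (3 * s * (3 * s) + 3 * s) - i%:Z * (3 * s).
pose A2 s := A1 s + i.+1%:Z * (2 * (3 * s) + 1).
have h1 s : 2 * A1 s = 3 * (s0 + 2 * s1 + 3)%N%:Z * (s * s)
    + ((s0 + 2 * s1 + 3)%N%:Z - 6 * (s1 + 1)%N%:Z) * s.
  by rewrite hM ht mulrBr !mulrDr triE hD; ring.
have h2 s : 2 * A2 s = 3 * (s0 + 2 * s1 + 3)%N%:Z * (s * s)
    + ((s0 + 2 * s1 + 3)%N%:Z + 6 * (s1 + 1)%N%:Z) * s + 2 * (s1 + 1)%N%:Z.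
  rewrite mulrDr h1 si -[i.+1]addn1 !PoszD; ring.
have [b1 b2 hL] := @quint_series1 (s0 + 2 * s1 + 3) (s1 + 1) A1 A2
  ltac:(lia) ltac:(lia) h1 h2.
apply: summableE; rewrite chi_quint -[P^-1]mul1r.
exact: (U_limit aq k0 hp _ _ b1 b2 hL).
Qed.

Lemma S_even p k i (D : int -> int) (a b : int) s0 s1 :
    bailey_a p = q ^+ 2 -> (0 < k)%N ->
    (forall n, has_zsum (fun s => (1 - q) * q ^ D s * bkerX q 2 (3 * s) n)
       (bailey_beta p n)) ->
    (forall s, 2 * D s = a * (s * s) + b * s) -> s0 = (2 * i + 1)%N ->
    3 * (s0 + 2 * s1 + 3)%N%:Z = a + 18 * k%:Z ->
    6 * (s1 + 1)%N%:Z - (s0 + 2 * s1 + 3)%N%:Z = b + 12 * k%:Z - 6 * i%:Z ->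
  q_summable (S_block p k i) /\ S_sum p k i = (1 - q) * chi (s0, s1).
Proof.
move=> aq k0 hp hD si hM ht.
pose A1 s := D s + k%:Z * (3 * s * (3 * s) + 2%N%:Z * (3 * s)) - i%:Z * (3 * s).
pose A2 s := A1 s + i.+1%:Z * (2 * (3 * s) + 2%N%:Z).
have h1 s : 2 * A1 s = 3 * (s0 + 2 * s1 + 3)%N%:Z * (s * s)
    + (6 * (s1 + 1)%N%:Z - (s0 + 2 * s1 + 3)%N%:Z) * s.
  by rewrite hM ht mulrBr mulrDr hD; ring.
have h2 s : 2 * A2 s = 3 * (s0 + 2 * s1 + 3)%N%:Z * (s * s)
    + (5 * (s0 + 2 * s1 + 3)%N%:Z - 6 * (s1 + 1)%N%:Z) * s
    + (2 * (s0 + 2 * s1 + 3)%N%:Z - 4 * (s1 + 1)%N%:Z).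
  rewrite mulrDr h1 si -[i.+1]addn1 !PoszD; ring.
have [b1 b2 hL] := @quint_series2 (s0 + 2 * s1 + 3) (s1 + 1) A1 A2
  ltac:(lia) ltac:(lia) h1 h2.
apply: summableE; rewrite chi_quint mulrA.
rewrite S_blockE aq; apply: (gS_limit (e := 1) _ _ hp _ _ b1 b2 hL) => //.
by rewrite k0.
Qed.

Lemma T_assemble (F : fieldType) (c p h l : F) : h != 0 ->
  h^-1 * (c * (p * h) * l) = c * (p * l).
Proof. by move=> h0; field. Qed.

Lemma T_assemble0 (F : fieldType) (x p h l : F) : h != 0 ->
  h^-1 * ((1 - x) * (p * ((1 + x) * h)) * l) = (1 - x ^+ 2) * (p * l).
Proof. by move=> h0; field. Qed.

(** Source of the exceptional c_0: normalising by (-q^2)_oo instead of (-q)_oo multiplies 1 - q by 1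
    + q. *)
Lemma H_split : H = (1 + q) * qpochoo (- q ^+ 2) q.
Proof.
apply: (@q_cvg_unique (fun n => pochhammer q (- q) n.+1)).
  by apply: (q_cvg_sub (phi := S) leqnSn pochN_cvg).
apply: (@eq_q_cvg (fun n => (1 + q) * pochhammer q (- q ^+ 2) n)) => [n|].
  by rewrite pochSl opprK mulNr -expr2.
apply/q_cvgZ/qpochoo_cvg; last exact: vge1_self.
by apply/vgeN/vge1_qX.
Qed.

Lemma T_even p k i (D : int -> int) (a b : int) s0 s1 :
    bailey_a p = q ^+ 2 -> (0 < k)%N -> (forall s, 0 <= D s)%R ->
    (forall n, has_zsum (fun s => (1 - q) * q ^ D s * bkerX q 2 (3 * s) n)
       (bailey_beta p n)) ->
    (forall s, 2 * D s = a * (s * s) + b * s) -> s0 = (2 * i)%N ->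
    3 * (s0 + 2 * s1 + 3)%N%:Z = a + 18 * k%:Z - 9 ->
    6 * (s1 + 1)%N%:Z - (s0 + 2 * s1 + 3)%N%:Z = b + 12 * k%:Z - 3 - 6 * i%:Z ->
  q_summable (T_block p k i) /\ T_sum p k i = T_factor i * chi (s0, s1).
Proof.
move=> aq k0 D0 hp hD si hM ht.
pose A1 s := D s + (k%:Z - 1) * (3 * s * (3 * s) + 2 * (3 * s))
  - (i%:Z - 1) * (3 * s) + tri (3 * s).
pose A2 s := A1 s + (2 * i%:Z + 1) * (3 * s + 1).
have h1 s : 2 * A1 s = 3 * (s0 + 2 * s1 + 3)%N%:Z * (s * s)
    + (6 * (s1 + 1)%N%:Z - (s0 + 2 * s1 + 3)%N%:Z) * s.
  by rewrite hM ht mulrDr triE mulrBr mulrDr hD; ring.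
have h2 s : 2 * A2 s = 3 * (s0 + 2 * s1 + 3)%N%:Z * (s * s)
    + (5 * (s0 + 2 * s1 + 3)%N%:Z - 6 * (s1 + 1)%N%:Z) * s
    + (2 * (s0 + 2 * s1 + 3)%N%:Z - 4 * (s1 + 1)%N%:Z).
  by rewrite mulrDr h1 si; ring.
have [b1 b2 hL] := @quint_series2 (s0 + 2 * s1 + 3) (s1 + 1) A1 A2
  ltac:(lia) ltac:(lia) h1 h2.
have hT := T_limit (i := i) k0 D0 hp (fun=> erefl) (fun=> erefl) b1 b2 hL.
have [hs] : q_summable (T_block p k i) /\ q_sum (T_block p k i) =
    (1 - q) * (P^-1 * H) * quint_product (s0 + 2 * s1 + 3) (s1 + 1).
  apply: summableE; apply: eq_q_cvg hT => N; apply: eq_bigr => n _.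
  by rewrite (T_blockE p i n k0) -/(tfac n) S_blockE aq.
rewrite /T_sum => ->; split=> //; rewrite chi_quint mul1r /T_factor.
case: ifP => _.
  have h0 : qpochoo (- q ^+ 2) q != 0.
    by apply/unit1_neq0/unit1_qpochoo; [apply/vgeN/vge1_qX|exact: vge1_self].
  by rewrite H_split T_assemble0.
have h0 : H != 0.
  by apply/unit1_neq0/unit1_qpochoo; [apply/vgeN|]; exact: vge1_self.
by rewrite T_assemble.
Qed.

Theorem mainTheorem1 (k : nat) (hk : (1 <= k)%N) :
  ((forall i : nat, (i <= 3 * k)%N ->
      q_summable (S_block P1 k i) /\
      S_sum P1 k i = chi (6 * k + 1 - 2 * i, i)%N) /\
   every_standard_once (6 * k + 1) (3 * k + 1) (12 * k + 8) (3 * k)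
     (fun i => (6 * k + 1 - 2 * i, i)%N)) /\
  ((forall i : nat, (i <= 3 * k - 1)%N ->
      q_summable (U_block P1 k i) /\
      U_sum P1 k i = chi (6 * k - 2 - 2 * i, i)%N) /\
   every_standard_once (6 * k - 2) (3 * k) (12 * k + 2) (3 * k - 1)
     (fun i => (6 * k - 2 - 2 * i, i)%N)) /\
  ((forall i : nat, (i <= 3 * k)%N ->
      q_summable (S_block P2 k i) /\
      S_sum P2 k i = (1 - q) * chi (2 * i + 1, 3 * k - i)%N) /\
   every_standard_once (6 * k + 1) (3 * k + 1) (12 * k + 8) (3 * k)
     (fun i => (2 * i + 1, 3 * k - i)%N)) /\
  ((forall i : nat, (i <= 3 * k - 1)%N ->
      q_summable (T_block P2 k i) /\
      T_sum P2 k i = T_factor i * chi (2 * i, 3 * k - 1 - i)%N) /\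
   every_standard_once (6 * k - 2) (3 * k) (12 * k + 2) (3 * k - 1)
     (fun i => (2 * i, 3 * k - 1 - i)%N)) /\
  ((forall i : nat, (i <= 3 * k - 1)%N ->
      q_summable (S_block P3 k i) /\
      S_sum P3 k i = chi (6 * k - 1 - 2 * i, i)%N) /\
   every_standard_once (6 * k - 1) (3 * k) (12 * k + 4) (3 * k - 1)
     (fun i => (6 * k - 1 - 2 * i, i)%N)) /\
  ((forall i : nat, (i <= 3 * k - 2)%N ->
      q_summable (U_block P3 k i) /\
      U_sum P3 k i = chi (6 * k - 4 - 2 * i, i)%N) /\
   every_standard_once (6 * k - 4) (3 * k - 1) (12 * k - 2) (3 * k - 2)
     (fun i => (6 * k - 4 - 2 * i, i)%N)) /\
  ((forall i : nat, (i <= 3 * k - 1)%N ->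
      q_summable (S_block P4 k i) /\
      S_sum P4 k i = (1 - q) * chi (2 * i + 1, 3 * k - 1 - i)%N) /\
   every_standard_once (6 * k - 1) (3 * k) (12 * k + 4) (3 * k - 1)
     (fun i => (2 * i + 1, 3 * k - 1 - i)%N)) /\
  ((forall i : nat, (i <= 3 * k - 2)%N ->
      q_summable (T_block P4 k i) /\
      T_sum P4 k i = T_factor i * chi (2 * i, 3 * k - 2 - i)%N) /\
   every_standard_once (6 * k - 4) (3 * k - 1) (12 * k - 2) (3 * k - 2)
     (fun i => (2 * i, 3 * k - 2 - i)%N)) /\
  ((forall i : nat, (i <= 3 * k)%N ->
      q_summable (S_block P5 k i) /\
      S_sum P5 k i = chi (6 * k - 2 * i, i)%N) /\
   every_standard_once (6 * k) (3 * k + 1) (12 * k + 6) (3 * k)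
     (fun i => (6 * k - 2 * i, i)%N)) /\
  ((forall i : nat, (i <= 3 * k - 2)%N ->
      q_summable (U_block P5 k i) /\
      U_sum P5 k i = chi (6 * k - 3 - 2 * i, i)%N) /\
   every_standard_once (6 * k - 3) (3 * k - 1) (12 * k) (3 * k - 2)
     (fun i => (6 * k - 3 - 2 * i, i)%N)).
Proof.
have half_odd m : ((2 * m + 1)./2 = m)%N by rewrite mul2n addn1 /= uphalf_double.
have half_even m : ((2 * m)./2 = m)%N by rewrite mul2n doubleK.
split; [|split; [|split; [|split; [|split; [|split; [|split; [|split; [|split]]]]]]]]; split.
(* Throughout, a and b are read off from twice the exponent of the pair, here 2 (6 s^2 - s). *)
- move=> i hi; apply: (S_odd (a := 12) (b := -2) _ hk pair_P1) => //;
    first [lia|by move=> s; ring].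
- apply: (standard_once (sg := id)) => [|||i hi|i hi] //;
    rewrite /level /=; lia.
- move=> i hi; apply: (U_odd (a := 12) (b := -2) _ hk pair_P1) => //;
    first [lia|by move=> s; ring].
- apply: (standard_once (sg := id)) => [|||i hi|i hi] //;
    rewrite /level /=; lia.
- move=> i hi; apply: (S_even (a := 12) (b := 2) _ hk pair_P2) => //;
    first [lia|by move=> s; ring].
- apply: (standard_once (sg := fun i => 3 * k - i)%N) => [|||i hi|i hi] //;
    rewrite /level /=; lia.
- move=> i hi; apply: (T_even (a := 12) (b := 2) _ hk _ pair_P2) => //;
    first [lia|by move=> s; ring|by move=> s; nia].
- apply: (standard_once (sg := fun i => 3 * k - 1 - i)%N) => [|||i hi|i hi] //;
    rewrite /level /=; lia.
- move=> i hi; apply: (S_odd (a := 6) (b := -4) _ hk pair_P3) => //;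
    first [lia|by move=> s; ring].
- apply: (standard_once (sg := id)) => [|||i hi|i hi] //;
    rewrite /level /=; lia.
- move=> i hi; apply: (U_odd (a := 6) (b := -4) _ hk pair_P3) => //;
    first [lia|by move=> s; ring].
- apply: (standard_once (sg := id)) => [|||i hi|i hi] //;
    rewrite /level /=; lia.
- move=> i hi; apply: (S_even (a := 6) (b := -2) _ hk pair_P4) => //;
    first [lia|by move=> s; ring].
- apply: (standard_once (sg := fun i => 3 * k - 1 - i)%N) => [|||i hi|i hi] //;
    rewrite /level /=; lia.
- move=> i hi; apply: (T_even (a := 6) (b := -2) _ hk _ pair_P4) => //;
    first [lia|by move=> s; ring|by move=> s; nia].
- apply: (standard_once (sg := fun i => 3 * k - 2 - i)%N) => [|||i hi|i hi] //;
    rewrite /level /=; lia.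
- move=> i hi; apply: (S_odd (a := 9) (b := -3) _ hk pair_P5) => //;
    first [lia|by move=> s; rewrite triE; ring].
- apply: (standard_once (sg := id)) => [|||i hi|i hi] //;
    rewrite /level /=; lia.
- move=> i hi; apply: (U_odd (a := 9) (b := -3) _ hk pair_P5) => //;
    first [lia|by move=> s; rewrite triE; ring].
apply: (standard_once (sg := id)) => [|||i hi|i hi] //;
    rewrite /level /=; lia.
Qed.
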